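(* Let $(R,\mathfrak m,\mathsf k)$ be a noetherian local ring. Suppose that either (i) $R$ is a fiber product ring, or (ii) $R$ is an artinian stretched Gorenstein ring and $\operatorname{char}(\mathsf k)\neq 2$. Then for every positive integer $r$ and every finitely generated $R$-module $M$ with $\operatorname{projdim}_R M=\infty$, we have $I^R_{n,r}(M)=I^R_{n+2,r}(M)$ for all $n\gg 0$.
   Context: For a finitely generated module $M$ over a noetherian local ring $R$, let $(F_\bullet,\partial_\bullet)$ be its minimal free resolution, $\partial_n\colon F_n\to F_{n-1}$. $I^R_{n,r}(M)$ denotes the ideal of $R$ generated by all $r\times r$ minors of a matrix representing $\partial_n$ (independent of bases); by convention it is zero if $r$ exceeds the number of rows or columns, and equals $R$ if $r=0$. $\operatorname{embdim}(R)$ is the minimal number of generators of $\mathfrak m$. Fiber product ring: $R\cong S\times_{\mathsf k}T=\{(s,t)\in S\times T:\bar s=\bar t \text{ in }\mathsf k\}$, where $S$ and $T$ are noetherian local rings with common residue field $\mathsf k$; fiber products are assumed non-trivial, i.e. $S\not\cong\mathsf k$ and $T\not\cong\mathsf k$. An artinian local ring $(R,\mathfrak m)$ is stretched if $\lambda(R)-\operatorname{embdim}(R)$ is the least integer $i$ such that $\mathfrak m^{i+1}=0$, where $\lambda(R)$ is the length of $R$. *)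

(* Defs.v *)
From HB Require Import structures.
From mathcomp Require Import all_boot all_order all_algebra.
From mathcomp Require Import boolp classical_sets.

Set Implicit Arguments.
Unset Strict Implicit.
Unset Printing Implicit Defensive.

Import GRing.Theory.
Local Open Scope classical_set_scope.
Local Open Scope ring_scope.

Section Ideals.
Variable R : comNzRingType.
Implicit Types (I J m : set R).

Definition ideal I :=
  [/\ I 0, forall x y, I x -> I y -> I (x + y) & forall a x, I x -> I (a * x)].

Definition ideal_gen (A : set R) : set R := smallest ideal A.

Definition ideal_mul I J : set R := ideal_gen [set x * y | x in I & y in J].

Definition ideal_pow I (n : nat) : set R := iter n (ideal_mul I) setT.

Definition maximal_ideal m :=
  [/\ ideal m, m <> setT
    & forall J, ideal J -> m `<=` J -> J = m \/ J = setT].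

Definition local_ring m :=
  maximal_ideal m /\ forall m', maximal_ideal m' -> m' = m.

(* [k] is the residue field of [(R, m)], with canonical projection [p]. *)
Definition residue_map m (k : fieldType) (p : {rmorphism R -> k}) :=
  range p = setT /\ m = [set x | p x = 0].

Definition ideal_chain (l : nat) :=
  exists I : nat -> set R,
    (forall i, (i <= l)%N -> ideal (I i)) /\
    (forall i, (i < l)%N -> I i `<` I i.+1).

(* The length of [R] as an [R]-module is the finite number [l]. *)
Definition has_length (l : nat) :=
  ideal_chain l /\ forall l', ideal_chain l' -> (l' <= l)%N.

(* Applied to the maximal ideal, this says that [e] is the embedding
   dimension. *)
Definition min_num_gens I (e : nat) :=
  (exists2 s : seq R, size s = e & I = ideal_gen [set` s]) /\
  (forall s : seq R, I = ideal_gen [set` s] -> (e <= size s)%N).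

(* The equation [l = e + i] avoids the truncated subtraction [l - e]. *)
Definition stretched m :=
  exists l e i : nat,
    [/\ has_length l, min_num_gens m e, l = (e + i)%N,
        ideal_pow m i.+1 = [set 0]
      & forall j, ideal_pow m j.+1 = [set 0] -> (i <= j)%N].

(* The ideal of [r]-minors.  For [r = 0] the only minor is the empty
   determinant [1]; for [r] larger than [p] or [q] there is no minor, and the
   ideal is zero. *)
Definition minors_ideal p q (A : 'M[R]_(p, q)) (r : nat) : set R :=
  ideal_gen [set x | exists (f : 'I_r -> 'I_p) (g : 'I_r -> 'I_q),
    [/\ {homo f : i j / (i < j)%N}, {homo g : i j / (i < j)%N}
      & x = \det (mxsub f g A)]].

End Ideals.

Definition noetherian (R : comNzRingType) :=
  forall I : set R, ideal I -> exists s : seq R, I = ideal_gen [set` s].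

Definition artinian (R : comNzRingType) :=
  forall I : nat -> set R,
    (forall n, ideal (I n)) -> (forall n, I n.+1 `<=` I n) ->
    exists N, forall n, (N <= n)%N -> I n = I N.

Definition ring_isomorphic (A B : comNzRingType) :=
  exists f : {rmorphism A -> B}, bijective f.

(* The ring isomorphism from [R] to the fiber product is given as an injective
   morphism to [S * T] whose range is the subring of the pairs that agree in
   [k]. *)
Definition fiber_product_ring (R : comNzRingType) :=
  exists (S T : comNzRingType) (mS : set S) (mT : set T) (k : fieldType)
         (pS : {rmorphism S -> k}) (pT : {rmorphism T -> k}),
    [/\ [/\ noetherian S, local_ring mS & residue_map mS pS],
        [/\ noetherian T, local_ring mT & residue_map mT pT],
        ~ ring_isomorphic S k,
        ~ ring_isomorphic T k
      & exists2 phi : {rmorphism R -> (S * T)%type},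
          injective phi & range phi = [set st | pS st.1 = pT st.2]].

Section Modules.
Variable R : comNzRingType.
Implicit Types M E P : lmodType R.

Definition finitely_generated M :=
  exists (n : nat) (x : 'I_n -> M),
    forall y : M, exists c : 'I_n -> R, y = \sum_i c i *: x i.

Definition kernel (U V : lmodType R) (f : {linear U -> V}) : set U :=
  [set x | f x = 0].

Definition resolution M (P : nat -> lmodType R)
    (d : forall n, {linear P n.+1 -> P n}) (eps : {linear P 0%N -> M}) :=
  [/\ range eps = setT, range (d 0%N) = kernel eps
    & forall n, range (d n.+1) = kernel (d n)].

Definition coresolution M (E : nat -> lmodType R)
    (d : forall n, {linear E n -> E n.+1}) (eta : {linear M -> E 0%N}) :=
  [/\ injective eta, range eta = kernel (d 0%N)
    & forall n, range (d n) = kernel (d n.+1)].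

Definition projective_module P :=
  forall (A B : lmodType R) (g : {linear A -> B}) (f : {linear P -> B}),
    range g = setT -> exists h : {linear P -> A}, forall x, g (h x) = f x.

Definition injective_module E :=
  forall (A B : lmodType R) (i : {linear A -> B}) (f : {linear A -> E}),
    injective i -> exists h : {linear B -> E}, forall x, h (i x) = f x.

Definition finite_projdim M :=
  exists (P : nat -> lmodType R) (d : forall n, {linear P n.+1 -> P n})
         (eps : {linear P 0%N -> M}) (N : nat),
    [/\ resolution d eps, forall n, projective_module (P n)
      & forall n, (N < n)%N -> forall x : P n, x = 0].

Definition finite_injdim M :=
  exists (E : nat -> lmodType R) (d : forall n, {linear E n -> E n.+1})
         (eta : {linear M -> E 0%N}) (N : nat),
    [/\ coresolution d eta, forall n, injective_module (E n)
      & forall n, (N < n)%N -> forall x : E n, x = 0].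

End Modules.

(* To be used for noetherian local rings only: a noetherian ring of infinite
   Krull dimension may be Gorenstein without having finite injective
   dimension over itself. *)
Definition gorenstein (R : comNzRingType) := finite_injdim (R^o : lmodType R).

(* The n-th free module is ['rV[R]_(mfr_rank n)], and [mfr_diff n] represents
   the differential from degree [n.+1] to degree [n], acting on row vectors by
   right multiplication: it is the transpose of the usual matrix, and has the
   same minors. *)
Record minimal_free_resolution (R : comNzRingType) (m : set R)
    (M : lmodType R) := MinimalFreeResolution {
  mfr_rank : nat -> nat;
  mfr_diff : forall n, 'M[R]_(mfr_rank n.+1, mfr_rank n);
  mfr_aug : {linear 'rV[R]_(mfr_rank 0%N) -> M};
  mfr_resolution :
    @resolution R M (fun n => 'rV[R]_(mfr_rank n) : lmodType R)
      (fun n => mulmxr (mfr_diff n)) mfr_aug;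
  mfr_minimal : forall n i j, m (mfr_diff n i j)
}.

(* [res_minors F n r] is the ideal of [r]-minors of the differential from
   degree [n] to degree [n - 1], whose target is zero if [n = 0]. *)
Definition res_minors (R : comNzRingType) (m : set R) (M : lmodType R)
    (F : minimal_free_resolution m M) (n r : nat) : set R :=
  if n is n'.+1 then minors_ideal (mfr_diff F n') r
  else minors_ideal (0 : 'M[R]_(mfr_rank F 0%N, 0%N)) r.

(* Main.v *)
(* Let (b_n, A_n) be the ranks and differentials of a minimal free resolution,
   and for a submodule G of R^b let sdim G be the dimension of its image in k^b.

   Fiber products: the maximal ideal is a direct sum of two nonzero ideals I, J
   with I J = 0.  Let alpha_n and beta_n be the sdim of the rows sent by A_n into I
   and into J.  If I or J is not principal, or is principal with a nilpotent
   generator, both numbers tend to infinity, and the r-minors generate m^r.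
   Otherwise the ideal of r-minors of A_(n+1) is x^r R (if beta_n >= r) plus y^r R
   (if alpha_n >= r), where I = x R and J = y R, and it increases with n -> n + 2.

   Stretched Gorenstein rings: counting lengths and using char k <> 2, there is x
   with m = x R + ann x, (ann x)^2 inside the socle x^s R.  If ann x contains two
   elements independent modulo x, the Betti numbers grow and the r-minors
   eventually generate m^r.  If m = x R, or m = (x, y) with x y = 0 and y^2 a
   socle generator, the numbers P_n(i) = sdim {w | x^i w + y q in im A_n} obey
   linear recurrences which give P_n(i) <= P_(n+2)(i) for large n.  A minor of A_n
   is expanded along these flags, whence I_r(A_n) is contained in
   I_r(A_(n+2)) + y^r R.  It remains to see that y^r belongs to I_r(A_(n+2)): for
   r >= 3 since y^3 = 0, and for r <= 2 except when A_n has the image of a scalar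
   matrix or vanishing 2-minors; in both cases the minors are eventually periodic.
   In all the other cases noetherianity stabilizes the ascending chains. *)

Require Import Defs.
From HB Require Import structures.
From mathcomp Require Import all_boot all_order all_algebra.
From mathcomp Require Import fingroup perm ring zify.
From mathcomp Require Import boolp classical_sets.

Set Implicit Arguments.
Unset Strict Implicit.
Unset Printing Implicit Defensive.

Import GRing.Theory.
Local Open Scope classical_set_scope.
Local Open Scope ring_scope.

(** * Ideals and minors *)

Section IdealTheory.
Variable R : comNzRingType.
Implicit Types (I J : set R).

(** Lower bounds for ideals of minors become dimension counts over [k]: if [r] rows are independent
    modulo the maximal ideal and [c_i] times the i-th of them lies in the row space of a
    differential, then the product of the [c_i] belongs to its ideal of r-minors. The obstacle is
    that reduction modulo the maximal ideal is not exact, and that multiplying by a ring element and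
    then lifting through the next differential is a relation, not a map. Hence the use of submodules
    of [R^a x R^b], for which the [sdim] of the domain and image satisfy an exact identity that
    replaces rank-nullity. The step from n to n + 2 comes from annihilators, which are exchanged at
    each differential: I with J, [x ^+ i] with [x ^+ (s - i)], the scalar [x ^+ c + mu * y] with
    [y - u * mu * x ^+ (s - c)]. The condition on the characteristic lets products u v be written
    through squares, which provides an x with x^2 outside m^3. The Gorenstein condition enters
    through a one-dimensional socle, deduced from the finite injective resolution by Baer's
    criterion. *)

Lemma ideal_gen_ideal (A : set R) : ideal (ideal_gen A).
Proof.
split=> [I [[]]//|x y Ix Iy I hI|a x Ix I hI].
  by have [[_ ID _] _] := hI; apply: ID; [apply: Ix|apply: Iy].
by have [[_ _ IM] _] := hI; apply: IM; apply: Ix.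
Qed.

Lemma ideal_gen_sub (A : set R) I : ideal I -> A `<=` I -> ideal_gen A `<=` I.
Proof. exact: smallest_sub. Qed.

Lemma mem_ideal_gen (A : set R) x : A x -> ideal_gen A x.
Proof. exact: sub_gen_smallest. Qed.

Lemma ideal0 I : ideal I -> I 0. Proof. by case. Qed.

Lemma idealD I x y : ideal I -> I x -> I y -> I (x + y).
Proof. by case=> _ + _; apply. Qed.

Lemma idealMl I a x : ideal I -> I x -> I (a * x).
Proof. by case=> _ _; apply. Qed.

Lemma idealMr I a x : ideal I -> I x -> I (x * a).
Proof. by rewrite mulrC; apply: idealMl. Qed.

Lemma idealN I x : ideal I -> I x -> I (- x).
Proof. by move=> hI Ix; rewrite -mulN1r; apply: idealMl. Qed.

Lemma idealB I x y : ideal I -> I x -> I y -> I (x - y).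
Proof. by move=> hI Ix Iy; apply: idealD => //; apply: idealN. Qed.

Lemma ideal_sum I (T : Type) (s : seq T) (P : pred T) (F : T -> R) : ideal I ->
  (forall i, P i -> I (F i)) -> I (\sum_(i <- s | P i) F i).
Proof.
move=> hI IF; elim/big_ind: _ => //; first exact: ideal0.
by move=> x y; apply: idealD.
Qed.

Lemma ideal_zero : ideal [set (0 : R)].
Proof. by split=> [//|x y /= -> ->|a x /= ->]; rewrite ?addr0 ?mulr0. Qed.

Definition principal (a : R) : set R := [set r | exists c, r = c * a].

Lemma principal_ideal a : ideal (principal a).
Proof.
split; first by exists 0; rewrite mul0r.
  by move=> _ _ [c ->] [d ->]; exists (c + d); rewrite mulrDl.
by move=> b _ [c ->]; exists (b * c); rewrite mulrA.
Qed.

Lemma ideal_add (I J : set R) : ideal I -> ideal J ->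
  ideal [set z | exists x y, [/\ I x, J y & z = x + y]].
Proof.
move=> hI hJ; split.
- by exists 0, 0; split; rewrite ?addr0//; apply: ideal0.
- move=> _ _ [x [y [Ix Jy ->]]] [x' [y' [Ix' Jy' ->]]].
  by exists (x + x'), (y + y'); split; [exact: idealD|exact: idealD|rewrite addrACA].
- move=> a _ [x [y [Ix Jy ->]]].
  by exists (a * x), (a * y); split; [exact: idealMl|exact: idealMl|rewrite mulrDr].
Qed.

Lemma ideal_gen_finP (s : seq R) x :
  ideal_gen [set` s] x <-> exists c : nat -> R, x = \sum_(i < size s) c i * s`_i.
Proof.
split; last first.
  case=> c ->; apply: ideal_sum; first exact: ideal_gen_ideal.
  move=> i _.
  apply: (idealMl _ (ideal_gen_ideal _)).
  by apply: mem_ideal_gen => /=; apply: mem_nth.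
move: x; apply: (@ideal_gen_sub _ [set x | exists c : nat -> R, x = \sum_(i < size s) c i * s`_i]).
  split.
  - by exists (fun=> 0); rewrite big1// => i _; rewrite mul0r.
  - move=> _ _ [c ->] [d ->]; exists (fun i => c i + d i).
    by rewrite -big_split/=; apply: eq_bigr => i _; rewrite mulrDl.
  - move=> a _ [c ->]; exists (fun i => a * c i).
    by rewrite mulr_sumr; apply: eq_bigr => i _; rewrite mulrA.
move=> x /= xs; exists (fun i => (i == index x s)%:R).
have xi : (index x s < size s)%N by rewrite index_mem.
rewrite (bigD1 (Ordinal xi))//= eqxx mul1r nth_index// big1 ?addr0// => i /negPf.
by rewrite -val_eqE/= => ->; rewrite mul0r.
Qed.

Lemma noetherian_chain_stable (I : nat -> set R) : noetherian R ->
  (forall n, ideal (I n)) -> (forall n, I n `<=` I n.+1) ->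
  exists N, forall n, (N <= n)%N -> I n = I N.
Proof.
move=> hR hI mono.
have le i j : (i <= j)%N -> I i `<=` I j.
  move=> /subnK <-; elim: (j - i)%N => // m IH x /IH; apply: mono.
have hU : ideal (\bigcup_n I n).
  split; first by exists 0%N => //; apply: ideal0.
  - move=> x y [i _ Ix] [j _ Iy]; exists (maxn i j) => //.
    by apply: idealD => //; [apply: (le i); rewrite ?leq_maxl|apply: (le j); rewrite ?leq_maxr].
  - by move=> a x [i _ Ix]; exists i => //; apply: idealMl.
have [s sE] := hR _ hU.
have [N NP] : exists N, forall x, x \in s -> I N x.
  have : forall x, x \in s -> (\bigcup_n I n) x.
    by move=> x xs; rewrite sE; apply: mem_ideal_gen.
  elim: {sE} s => [_|x s IH sP]; first by exists 0%N.
  have [N NP] := IH (fun y ys => sP y (@mem_behead _ (x :: s) y ys)).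
  have [n _ nx] := sP x (mem_head _ _).
  exists (maxn n N) => y; rewrite inE => /orP[/eqP->|/NP].
    by apply: (le n); rewrite ?leq_maxl.
  by apply: le; rewrite ?leq_maxr.
exists N => n Nn; apply/seteqP; split; last exact: le.
move=> x Ix; have : (\bigcup_n I n) x by exists n.
by rewrite sE; apply: ideal_gen_sub => // y; apply: NP.
Qed.

(** Even and odd offsets from [n0] give two separate ascending chains, each of which becomes
    constant. *)
Lemma noetherian_chain2_stable (I : nat -> set R) n0 : noetherian R ->
  (forall n, ideal (I n)) -> (forall n, (n0 <= n)%N -> I n `<=` I n.+2) ->
  exists N, forall n, (N <= n)%N -> I n = I n.+2.
Proof.
move=> hR hI mono.
have st (c : bool) : exists N, forall n, (N <= n)%N ->
    I (n0 + (c + n.*2))%N = I (n0 + (c + N.*2))%N.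
  apply: (@noetherian_chain_stable (fun n => I (n0 + (c + n.*2))%N)) => // n.
  by rewrite doubleS !addnS; apply: mono; apply: leq_addr.
have [e e_st] := st false; have [o o_st] := st true.
exists (n0 + (e + o).*2.+1)%N => n hn.
have [m [nE em om]] : exists m, [/\ n = (n0 + (odd m + m./2.*2))%N, (e <= m./2)%N & (o <= m./2)%N].
  by exists (n - n0)%N; rewrite odd_double_half; split; lia.
rewrite nE -!addnS -doubleS; case: (odd m).
  by rewrite (o_st _ om) -(o_st _ (leqW om)).
by rewrite (e_st _ em) -(e_st _ (leqW em)).
Qed.

(** Otherwise every admissible ideal has a strictly larger one, and iterating a choice of these from
    [I0] contradicts the chain condition. *)
Lemma noetherian_maximal (P : set (set R)) I0 : noetherian R -> (forall I, P I -> ideal I) ->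
  P I0 -> exists I, [/\ P I, I0 `<=` I & forall J, P J -> I `<=` J -> J `<=` I].
Proof.
move=> hR Pideal PI0; apply: contrapT => H.
have next I : exists J, P I /\ I0 `<=` I -> [/\ P J, I0 `<=` J, I `<=` J & ~ (J `<=` I)].
  have [[PI I0I]|nI] := pselect (P I /\ I0 `<=` I); last by exists I.
  apply: contrapT => nJ; apply: H; exists I; split => // J PJ IJ.
  by apply: contrapT => JI; apply: nJ; exists J => _; split => //; apply: subset_trans IJ.
have [f fE] := choice next; pose F n := iter n f I0.
have FP n : P (F n) /\ I0 `<=` F n by elim: n => [|n /fE[]]; split.
have [n|n|N NP] := @noetherian_chain_stable F hR; first by apply: Pideal; case: (FP n).
  by case: (fE _ (FP n)).
by case: (fE _ (FP N)) => _ _ _; rewrite -[f _]/(F N.+1) (NP _ (leqnSn N)); apply.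
Qed.

End IdealTheory.

Lemma not_injective_pair (aT : eqType) (rT : Type) (f : aT -> rT) : ~ injective f ->
  exists i j, i != j /\ f i = f j.
Proof.
move=> nf; apply: contrapT => H; apply: nf => i j fij; apply/eqP/negP => /negP ij.
by apply: H; exists i, j.
Qed.

(** * Ideals of minors, independently of the choice of bases *)

Section Minors.
Variable R : comNzRingType.

(** Cauchy-Binet in unsorted form: the sum runs over all maps, non-injective ones included, which
    avoids orderings and signs. *)
Lemma det_mulmx_rowsub r p (C : 'M[R]_(r, p)) (B : 'M[R]_(p, r)) :
  \det (C *m B) =
  \sum_(f : {ffun 'I_r -> 'I_p}) (\prod_i C i (f i)) * \det (rowsub f B).
Proof.
rewrite /determinant.
under eq_bigr => s _.
  under eq_bigr => i _ do rewrite mxE.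
  rewrite bigA_distr_bigA mulr_sumr.
  over.
rewrite exchange_big/=; apply: eq_bigr => f _; rewrite mulr_sumr.
apply: eq_bigr => s _; rewrite big_split/= mulrCA; congr (_ * (_ * _)).
by apply: eq_bigr => i _; rewrite mxE.
Qed.

Lemma det_mulmx_colsub r q (B : 'M[R]_(r, q)) (D : 'M[R]_(q, r)) :
  \det (B *m D) =
  \sum_(g : {ffun 'I_r -> 'I_q}) (\prod_i D (g i) i) * \det (colsub g B).
Proof.
rewrite -det_tr trmx_mul det_mulmx_rowsub; apply: eq_bigr => g _.
congr (_ * _); first by apply: eq_bigr => i _; rewrite mxE.
by rewrite -det_tr; congr (\det _); apply/matrixP => i j; rewrite !mxE.
Qed.

(** The generators of [minors_ideal] use increasing indices only; any injective selection is brought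
    to that form by sorting. *)
Lemma injective_perm_homo r n (f : 'I_r -> 'I_n) : injective f ->
  exists s : 'S_r, {homo (f \o s) : i j / (i < j)%N}.
Proof.
move=> f_inj; pose le i j := (f i <= f j)%N; pose e := sort le (enum 'I_r).
have se : size e == r by rewrite size_sort size_enum_ord.
have t_inj : injective (tnth (Tuple se)).
  by apply/tuple_uniqP; rewrite sort_uniq enum_uniq.
exists (perm t_inj) => i j ij /=; rewrite !permE ltn_neqAle; apply/andP; split.
  by rewrite (inj_eq val_inj) (inj_eq f_inj) (inj_eq t_inj) -val_eqE /= ltn_eqF.
have le_trans : transitive le by move=> a b c; apply: leq_trans.
have le_e : sorted le e by apply: sort_sorted => a b; apply: leq_total.
have mono := sorted_leq_nth le_trans (fun=> leqnn _) i le_e.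
by rewrite !(tnth_nth i); apply: (mono i j _ _ (ltnW ij)); rewrite inE (eqP se) ltn_ord.
Qed.

Lemma minors_ideal_ideal p q (A : 'M[R]_(p, q)) r : ideal (minors_ideal A r).
Proof. exact: ideal_gen_ideal. Qed.

Lemma minors_ideal_mxsub p q (A : 'M[R]_(p, q)) r f g :
  minors_ideal A r (\det (mxsub f g A : 'M_r)).
Proof.
have hI := minors_ideal_ideal A r.
have [f_inj|] := pselect (injective f); last first.
  move=> /not_injective_pair[i [j [ij fij]]]; rewrite (_ : \det _ = 0); first exact: ideal0.
  by apply: (determinant_alternate ij) => l; rewrite !mxE fij.
have [g_inj|] := pselect (injective g); last first.
  move=> /not_injective_pair[i [j [ij fij]]]; rewrite (_ : \det _ = 0); first exact: ideal0.
  by rewrite -det_tr; apply: (determinant_alternate ij) => l; rewrite !mxE fij.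
have [s sf] := injective_perm_homo f_inj.
have [t tg] := injective_perm_homo g_inj.
have -> : mxsub f g A = row_perm s^-1 (col_perm t^-1 (mxsub (f \o s) (g \o t) A)).
  by apply/matrixP => i j; rewrite !mxE /= !permKV.
rewrite row_permE col_permE !det_mulmx; apply: (idealMl _ hI); apply: (idealMr _ hI).
by apply: mem_ideal_gen; exists (f \o s), (g \o t).
Qed.

(** Together with [minors_ideal_sub] this describes the ideal of minors without indices, as the
    ideal generated by all [\det (C *m A *m D)]. This is the form in which minors are handled from
    here on. *)
Lemma minors_ideal_mulmx p q (A : 'M[R]_(p, q)) r (C : 'M_(r, p)) (D : 'M_(q, r)) :
  minors_ideal A r (\det (C *m A *m D)).
Proof.
have hI := minors_ideal_ideal A r.
rewrite -mulmxA det_mulmx_rowsub; apply: (ideal_sum _ hI) => f _; apply: (idealMl _ hI).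
rewrite -mul_rowsub_mx det_mulmx_colsub; apply: (ideal_sum _ hI) => g _.
apply: (idealMl _ hI); rewrite (_ : colsub _ _ = mxsub f g A); first exact: minors_ideal_mxsub.
by apply/matrixP => i j; rewrite !mxE.
Qed.

Lemma minors_ideal_sub p q (A : 'M[R]_(p, q)) r (J : set R) : ideal J ->
  (forall (C : 'M_(r, p)) (D : 'M_(q, r)), J (\det (C *m A *m D))) ->
  minors_ideal A r `<=` J.
Proof.
move=> hJ H; apply: ideal_gen_sub => // _ [f [g [_ _ ->]]].
rewrite (_ : mxsub f g A = rowsub f 1%:M *m A *m colsub g 1%:M); first exact: H.
rewrite mulmx_colsub mulmx1 mul_rowsub_mx mul1mx.
by apply/matrixP => i j; rewrite !mxE.
Qed.

End Minors.

Lemma det_mulmx_lt (R : comNzRingType) r q (C : 'M[R]_(r, q)) (D : 'M[R]_(q, r)) :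
  (q < r)%N -> \det (C *m D) = 0.
Proof.
move=> qr; rewrite det_mulmx_rowsub big1// => f _.
have [|/not_injective_pair[i [j [ij fij]]]] := pselect (injective f).
  by move=> /leq_card; rewrite !card_ord leqNgt qr.
by rewrite (determinant_alternate ij) ?mulr0// => l; rewrite !mxE fij.
Qed.

Lemma minors_ideal_mul_sub (R : comNzRingType) a b' b (C : 'M[R]_(a, b')) (B : 'M[R]_(b', b)) r :
  minors_ideal (C *m B) r `<=` minors_ideal B r.
Proof.
apply: minors_ideal_sub => [|E D]; first exact: minors_ideal_ideal.
by rewrite mulmxA; apply: minors_ideal_mulmx.
Qed.

(** * Local rings, submodules and partial linear maps *)

Section LocalRing.
Variable R : comNzRingType.

Lemma ideal1 (I : set R) : ideal I -> I 1 -> I = setT.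
Proof. by move=> hI I1; rewrite -subTset => x _; rewrite -(mulr1 x); apply: idealMl. Qed.

Lemma proper_ideal_sub_maximal (I : set R) : noetherian R -> ideal I -> ~ I 1 ->
  exists m, maximal_ideal m /\ I `<=` m.
Proof.
move=> hR hI I1.
have [J [[hJ J1] IJ Jmax]] :=
  @noetherian_maximal R [set J | ideal J /\ ~ J 1] I hR (fun J => @proj1 _ _) (conj hI I1).
exists J; split=> //; split=> // [JT|K hK JK]; first by apply: J1; rewrite JT.
have [K1|K1] := pselect (K 1); first by right; apply: ideal1.
by left; apply/seteqP; split=> //; apply: Jmax.
Qed.

Lemma local_unit (m : set R) r : noetherian R -> local_ring m -> ~ m r ->
  exists r', r * r' = 1.
Proof.
move=> hR [[hm _ _] m_uniq] mr.
have [[c c1]|/(proper_ideal_sub_maximal hR (principal_ideal r))] := pselect (principal r 1).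
  by exists c; rewrite mulrC.
by move=> [m' [/m_uniq-> rm]]; case: mr; apply: rm; exists 1; rewrite mul1r.
Qed.

End LocalRing.

Section Submodule.
Variable R : comNzRingType.

Definition submod (V : lmodType R) (G : set V) :=
  [/\ G 0, forall u v, G u -> G v -> G (u + v) & forall a u, G u -> G (a *: u)].

Lemma submod_sum (V : lmodType R) (G : set V) (T : Type) (s : seq T) (P : pred T)
    (F : T -> V) : submod G -> (forall i, P i -> G (F i)) -> G (\sum_(i <- s | P i) F i).
Proof. by move=> [G0 GD _] GF; elim/big_ind: _. Qed.

Lemma submod_mulmx n q (G : set 'rV[R]_q) (u : 'rV[R]_n) (W : 'M[R]_(n, q)) :
  submod G -> (forall i, G (row i W)) -> G (u *m W).
Proof.
move=> hG GW; rewrite mulmx_sum_row; apply: (submod_sum _ hG) => i _.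
by case: hG => _ _ GZ; apply: GZ.
Qed.

End Submodule.

(** Among the matrices with rows in [S], take one of maximal rank: a vector of [S] outside its row
    space would raise the rank. *)
Lemma submod_matrix (k : fieldType) n (S : set 'rV[k]_n) : submod S ->
  exists W : 'M[k]_n, forall v, (v <= W)%MS <-> S v.
Proof.
move=> hS.
pose P r := `[< exists2 W : 'M[k]_n, \rank W = r & forall i, S (row i W) >].
have P0 : exists r, P r.
  exists 0%N; apply/asboolP; exists 0; first by rewrite mxrank0.
  by move=> i; rewrite row0; case: hS.
have Pn r : P r -> (r <= n)%N.
  by move=> /asboolP[W <- _]; exact: rank_leq_col.
have [r /asboolP[W Wr SW] rmax] := ex_maxnP P0 Pn.
exists W => v; split=> [/submxP[u ->]|Sv]; first exact: submod_mulmx.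
apply/negPn/negP => vW.
have : P (\rank (W + v)%MS).
  apply/asboolP; exists (W + v)%MS => // i.
  have := row_sub i (W + v)%MS => /sub_addsmxP[u ->].
  case: (hS) => _ SD _; apply: SD; apply: submod_mulmx => // j.
  by rewrite row_id.
move=> /rmax; rewrite leqNgt -Wr ltn_neqAle mxrankS ?addsmxSl// andbT negbK => /eqP e.
suff : (W + v <= W)%MS by rewrite addsmx_sub (negPf vW) andbF.
by rewrite -(geq_leqif (mxrank_leqif_sup (addsmxSl W v))) e.
Qed.

(* A linear map defined on an ideal of [R], with values in [E], is given by its
   graph. *)
Section PartialLinear.
Variables (R : comNzRingType) (E : lmodType R).

Definition linear_graph (G : set (R * E)%type) :=
  submod (G : set ((R^o : lmodType R) * E : lmodType R)%type) /\ forall e, G (0, e) -> e = 0.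

Definition graph_dom (G : set (R * E)%type) : set R := [set r | exists e, G (r, e)].

Lemma linear_graph_fun G r e e' : linear_graph G -> G (r, e) -> G (r, e') -> e = e'.
Proof.
move=> [[G0 GD GZ] Gf] Gre Gre'; apply/eqP; rewrite -subr_eq0; apply/eqP; apply: Gf.
have := GD _ _ Gre (GZ (-1) _ Gre'); rewrite /= scaleN1r.
by rewrite -[(r, e) + _]/(r + - r, e + - e') subrr.
Qed.

Lemma linear_graphZ G a r e : linear_graph G -> G (r, e) -> G (a * r, a *: e).
Proof. by move=> [[_ _ GZ] _] Ge; apply: (GZ a _ Ge). Qed.

Lemma graph_dom_ideal G : linear_graph G -> ideal (graph_dom G).
Proof.
move=> [[G0 GD GZ] _]; split; first by exists 0.
- by move=> x y [e Ge] [e' Ge']; exists (e + e'); apply: (GD _ _ Ge Ge').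
- by move=> a x [e Ge]; exists (a *: e); apply: (GZ a _ Ge).
Qed.

Section Sub.
Variable G : set (R * E)%type.
Hypothesis hG : linear_graph G.

Definition graph_pred : {pred (R^o : lmodType R) * E} := fun z => `[< G z >].

Fact graph_pred_submod : GRing.submod_closed graph_pred.
Proof.
have [[G0 GD GZ] _] := hG; split; first by rewrite unfold_in; apply/asboolP.
move=> a u v; rewrite !unfold_in => /asboolP Gu /asboolP Gv.
by apply/asboolP; apply: GD => //; apply: GZ.
Qed.
HB.instance Definition _ := GRing.isSubmodClosed.Build R _ graph_pred graph_pred_submod.

(** The graph is made into a module of its own because [injective_module] speaks of linear maps
    between modules. *)
Record graph_type := GraphElt { graph_val :> (R^o : lmodType R) * E; _ : graph_val \in graph_pred }.
HB.instance Definition _ := [isSub for graph_val].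
HB.instance Definition _ := [Choice of graph_type by <:].
HB.instance Definition _ := [SubChoice_isSubLmodule of graph_type by <:].

Definition graph_fst (z : graph_type) : R^o := (val z).1.
Definition graph_snd (z : graph_type) : E := (val z).2.

Fact graph_fst_linear : linear graph_fst.
Proof. by move=> a u v; rewrite /graph_fst linearP. Qed.
Fact graph_snd_linear : linear graph_snd.
Proof. by move=> a u v; rewrite /graph_snd linearP. Qed.
HB.instance Definition _ := GRing.isLinear.Build R graph_type R^o _ graph_fst graph_fst_linear.
HB.instance Definition _ := GRing.isLinear.Build R graph_type E _ graph_snd graph_snd_linear.

(** The first projection of the graph is injective; the second one extends along it to all of [R],
    and [c] is the value of the extension at 1. *)
Lemma injective_module_graph : injective_module E ->
  exists c, forall r e, G (r, e) -> e = r *: c.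
Proof.
move=> E_inj.
have [|h hE] := @E_inj graph_type R^o graph_fst graph_snd.
  move=> [[r e] ge] [[r' e'] ge']; rewrite /graph_fst /= => rr'; apply: val_inj => /=.
  have /asboolP Gre := ge; have /asboolP Gre' := ge'.
  have {}rr' : r = r' := rr'; rewrite -rr' in Gre'; rewrite -rr'.
  by rewrite (linear_graph_fun hG Gre Gre').
exists (h 1) => r e Gre.
have Gz : (r, e) \in graph_pred by apply/asboolP.
have hre : h r = e := hE (GraphElt Gz).
by rewrite -hre -linearZ /= -[r *: 1]/(r * 1) mulr1.
Qed.

End Sub.
End PartialLinear.

Section Chains.
Variable R : comNzRingType.
Implicit Types I J K : set R.

Definition chain_between I J (n : nat) := exists f : nat -> set R,
  [/\ f 0%N = I, f n = J, forall i, (i <= n)%N -> ideal (f i)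
    & forall i, (i < n)%N -> f i `<` f i.+1].

Lemma chain_between0 I : ideal I -> chain_between I I 0.
Proof. by move=> hI; exists (fun=> I). Qed.

Lemma chain_between_snoc I J K n : chain_between I J n -> ideal K -> J `<` K ->
  chain_between I K n.+1.
Proof.
move=> [f [f0 fn fI fS]] hK JK.
exists (fun i => if (i <= n)%N then f i else K); split => // [|i _|i].
- by rewrite ltnn.
- by case: ifP => // /fI.
rewrite ltnS => le_in; rewrite le_in; case: (ltngtP i n) le_in => // [lt_in|->] _.
  exact: fS.
by rewrite fn.
Qed.

Lemma chain_between_ideal_chain I J n : chain_between I J n -> ideal_chain R n.
Proof. by move=> [f [_ _ fI fS]]; exists f. Qed.

End Chains.

Lemma row_choice (R : Type) n (Q : 'I_n -> R -> Prop) : (forall j, exists c, Q j c) ->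
  exists v : 'rV_n, forall j, Q j (v 0 j).
Proof. by move=> /choice[f fE]; exists (\row_j f j) => j; rewrite mxE. Qed.

Lemma row_choice2 (R : Type) n (Q : 'I_n -> R -> R -> Prop) :
  (forall j, exists c d, Q j c d) -> exists v w : 'rV_n, forall j, Q j (v 0 j) (w 0 j).
Proof.
move=> H; have [v /row_choice[w vwE]] := row_choice H.
by exists v, w.
Qed.

Section Selection.
Variable k : fieldType.

Lemma row_free_rowsub n r q (f : 'I_n -> 'I_r) (W : 'M[k]_(r, q)) :
  injective f -> row_free W -> row_free (rowsub f W).
Proof.
move=> f_inj /row_freeP[B WB]; apply/row_freeP; exists (colsub f B).
rewrite mulmx_colsub mul_rowsub_mx WB; apply/matrixP => i j; rewrite !mxE.
by rewrite (inj_eq f_inj).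
Qed.

(* A greedy form of Rado's theorem for a chain of subspaces. *)
Lemma select_independent q r (Q : nat -> 'M[k]_q) (i : 'I_r -> nat) :
  (forall j, (#|[pred t | (i t <= j)%N]| <= \rank (Q j))%N) ->
  exists2 W : 'M[k]_(r, q), row_free W & forall t, (row t W <= Q (i t))%MS.
Proof.
elim: r i => [|r IH] i card_i.
  by exists 0 => [|[]//]; rewrite /row_free mxrank0.
(* The index of largest value is treated last: [Q (i t0)] has dimension at least [r.+1], so it is
   not contained in the span of the [r] vectors already found. *)
pose t0 := [arg max_(t > ord0) i t].
have t0P t : (i t <= i t0)%N.
  by rewrite /t0; case: arg_maxnP => // t' _; apply.
have [j|W Wf WQ] := IH (i \o lift t0).
  apply: leq_trans (card_i j).
  rewrite -(card_image (lift_inj (h:=t0)))//; apply: subset_leq_card.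
  by apply/fintype.subsetP => t' /fintype.imageP[t tj ->]; move: tj; rewrite !inE.
have [v vQ vW] : exists2 v : 'rV[k]_q, (v <= Q (i t0))%MS & ~~ (v <= W)%MS.
  have : ~~ (Q (i t0) <= W)%MS.
    apply/negP => /mxrankS; rewrite (eqP Wf) leqNgt => /negP; apply.
    have card0 : #|[pred t | (i t <= i t0)%N]| = r.+1.
      by rewrite -[RHS]card_ord; apply: eq_card => t; rewrite !unfold_in /= t0P.
    by have := card_i (i t0); rewrite card0.
  move=> /negP nQ; apply: contrapT => n; apply: nQ; apply/rV_subP => v vQ.
  by apply: contrapT => /negP vW; apply: n; exists v.
exists (\matrix_t (if unlift t0 t is Some t' then row t' W else v)); last first.
  move=> t; rewrite rowK; case: unliftP => [t' ->|->]; last exact: vQ.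
  exact: (WQ t').
set U := \matrix_t _.
have WU : (W + v <= U)%MS.
  rewrite addsmx_sub; apply/andP; split.
    apply/row_subP => t; have -> : row t W = row (lift t0 t) U by rewrite rowK liftK.
    exact: row_sub.
  have -> : v = row t0 U by rewrite rowK unlift_none.
  exact: row_sub.
rewrite /row_free eqn_leq rank_leq_row/=; apply: leq_trans (mxrankS WU).
rewrite ltn_neqAle -{1 3}(eqP Wf) mxrankS ?addsmxSl// andbT.
apply/negP => /eqP e; move/negP: vW; apply; apply: submx_trans (addsmxSr W v) _.
by rewrite -(geq_leqif (mxrank_leqif_sup (addsmxSl W v))) e.
Qed.

End Selection.

Section Functionals.
Variables (R : comNzRingType) (n : nat).
Implicit Types (v w : 'rV[R]_n) (f g : 'cV[R]_n).

Definition app v f : R := (v *m f) 0 0.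

Lemma appDl v w f : app (v + w) f = app v f + app w f.
Proof. by rewrite /app mulmxDl mxE. Qed.

Lemma appZl a v f : app (a *: v) f = a * app v f.
Proof. by rewrite /app -scalemxAl mxE. Qed.

Lemma appBl v w f : app (v - w) f = app v f - app w f.
Proof. by rewrite appDl -scaleN1r appZl mulN1r. Qed.

Lemma appDr v f g : app v (f + g) = app v f + app v g.
Proof. by rewrite /app mulmxDr mxE. Qed.

Lemma appZr a v f : app v (a *: f) = a * app v f.
Proof. by rewrite /app -scalemxAr mxE. Qed.

Lemma appBr v f g : app v (f - g) = app v f - app v g.
Proof. by rewrite appDr -scaleN1r appZr mulN1r. Qed.

Lemma app_delta v j : app v (delta_mx j 0) = v 0 j.
Proof. by rewrite /app -colE mxE. Qed.

Lemma app_res (k : fieldType) (p : {rmorphism R -> k}) v f :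
  map_mx p v = 0 -> p (app v f) = 0.
Proof.
by move=> v0; have := map_mxM p v f; rewrite v0 mul0mx => /matrixP/(_ 0 0); rewrite mxE => ->; rewrite mxE.
Qed.

End Functionals.

Lemma inj_surj_bij (A B : Type) (f : A -> B) :
  injective f -> (forall y, exists x, f x = y) -> bijective f.
Proof.
move=> f_inj /choice[g gK]; exists g => // x.
by apply: f_inj; rewrite gK.
Qed.

Lemma residue_local_unit (S : comNzRingType) (mS : set S) (k' : fieldType)
    (pS : {rmorphism S -> k'}) s : noetherian S ->
  local_ring mS -> residue_map mS pS -> pS s <> 0 -> exists s', s * s' = 1.
Proof. by move=> nS hS [_ mSE] s0; apply: (local_unit nS hS); rewrite mSE. Qed.

Lemma rmorphism_iso_residue (S : comNzRingType) (mS : set S) (k' : fieldType)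
    (pS : {rmorphism S -> k'}) : residue_map mS pS -> ~ ring_isomorphic S k' ->
  exists2 s, pS s = 0 & s <> 0.
Proof.
move=> [pS_surj _] nS; apply: contrapT => H; apply: nS; exists pS.
apply: inj_surj_bij => [x y xy|y].
  apply/eqP; rewrite -subr_eq0; apply/eqP; apply: contrapT => xy0; apply: H.
  by exists (x - y); rewrite ?rmorphB ?xy ?subrr.
have : range pS y by rewrite pS_surj.
by move=> [x _ <-]; exists x.
Qed.

Lemma wide_common_kernel (k : fieldType) b (v1 v2 : 'rV[k]_b) : (3 <= b)%N ->
  exists f : 'cV[k]_b, [/\ f <> 0, v1 *m f = 0 & v2 *m f = 0].
Proof.
move=> b3; pose M := col_mx v1 v2.
have : kermx M^T != 0.
  by rewrite -mxrank_eq0 mxrank_ker mxrank_tr; have := rank_leq_row M; lia.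
move=> /rowV0Pn[h /sub_kermxP hM /eqP h0]; exists h^T.
have : M *m h^T = 0 by rewrite -[M]trmxK -trmx_mul hM trmx0.
rewrite mul_col_mx => /eqP; rewrite col_mx_eq0 => /andP[/eqP -> /eqP ->]; split => // e.
by apply: h0; rewrite -[h]trmxK e trmx0.
Qed.

(** * Residual dimensions and minimal complexes *)

Section ResidueField.
Variables (R : comNzRingType) (k : fieldType) (p : {rmorphism R -> k}).
Hypothesis p_surj : range p = setT.
Hypothesis p_unit : forall r, p r <> 0 -> exists r', r * r' = 1.
Hypothesis R_noeth : noetherian R.

Local Notation "v ^p" := (map_mx p v) (at level 2, format "v ^p").
Local Notation mm := [set u : R | p u = 0].
Local Notation pow n := (ideal_pow mm n).

Lemma resmx_lift a b (M : 'M[k]_(a, b)) : exists N : 'M[R]_(a, b), N^p = M.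
Proof.
have H (c : k) : exists r, p r = c.
  have : range p c by rewrite p_surj.
  by move=> [r _ <-]; exists r.
have [f fE] := choice H.
by exists (map_mx f M); apply/matrixP => i j; rewrite !mxE.
Qed.

Lemma map_mx_eq0 a b (M : 'M[R]_(a, b)) :
  M^p = 0 <-> forall i j, p (M i j) = 0.
Proof.
split=> [M0 i j|M0]; first by have /matrixP/(_ i j) := M0; rewrite !mxE.
by apply/matrixP => i j; rewrite !mxE.
Qed.

Lemma residue_unitmx n (M : 'M[R]_n) : M^p \in unitmx ->
  exists N, M *m N = 1%:M /\ N *m M = 1%:M.
Proof.
rewrite unitmxE det_map_mx unitfE => /eqP/p_unit[d dE].
exists (d *: \adj M); rewrite -scalemxAl -scalemxAr mul_mx_adj mul_adj_mx.
by rewrite !scale_scalar_mx mulrC dE.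
Qed.

Lemma residue_row_free r b (W : 'M[R]_(r, b)) : row_free W^p ->
  exists D, W *m D = 1%:M.
Proof.
move=> /row_freeP[D' D'E]; have [D DE] := resmx_lift D'.
have [N [NE _]] : exists N, (W *m D) *m N = 1%:M /\ N *m (W *m D) = 1%:M.
  by apply: residue_unitmx; rewrite map_mxM DE D'E unitmx1.
by exists (D *m N); rewrite mulmxA.
Qed.

(* A matrix whose row space is the image of [G] modulo the maximal ideal; it is
   meaningful for submodules only, and [0] by default. *)
Definition resmx b (G : set 'rV[R]_b) : 'M[k]_b :=
  xget 0 [set W | forall v : 'rV[k]_b, (v <= W)%MS <-> exists2 g, G g & v = g^p].

Definition sdim b (G : set 'rV[R]_b) := \rank (resmx G).

Lemma submod_residue b (G : set 'rV[R]_b) : submod G ->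
  submod [set v : 'rV[k]_b | exists2 g, G g & v = g^p].
Proof.
case=> G0 GD GZ; split.
- by exists 0; rewrite ?map_mx0.
- by move=> _ _ [g Gg ->] [h Gh ->]; exists (g + h); [exact: GD|rewrite map_mxD].
- move=> c _ [g Gg ->].
  have : range p c by rewrite p_surj.
  by move=> [r _ <-]; exists (r *: g); [exact: GZ|rewrite map_mxZ].
Qed.

Lemma resmxP b (G : set 'rV[R]_b) (v : 'rV[k]_b) : submod G ->
  (v <= resmx G)%MS <-> exists2 g, G g & v = g^p.
Proof.
move=> hG; have [W WP] := submod_matrix (submod_residue hG).
rewrite /resmx; case: xgetP => [M _ /(_ v)//|/(_ W)]; case; exact: WP.
Qed.

Lemma resmx_sub b (G H : set 'rV[R]_b) : submod G -> submod H ->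
  (forall g, G g -> exists2 h, H h & h^p = g^p) -> (resmx G <= resmx H)%MS.
Proof.
move=> hG hH GH; apply/rV_subP => v /(resmxP _ hG)[g /GH[h Hh hg] ->].
by apply/(resmxP _ hH); exists h.
Qed.

Lemma sdim_le b (G H : set 'rV[R]_b) : submod G -> submod H ->
  (forall g, G g -> exists2 h, H h & h^p = g^p) -> (sdim G <= sdim H)%N.
Proof. by move=> hG hH GH; apply/mxrankS/resmx_sub. Qed.

Lemma sdim_eq b (G H : set 'rV[R]_b) : (forall g, G g <-> H g) -> sdim G = sdim H.
Proof. by move=> GH; congr sdim; apply/seteqP; split=> g /GH. Qed.

Lemma sdim_max b (G : set 'rV[R]_b) : (sdim G <= b)%N.
Proof. exact: rank_leq_col. Qed.

Lemma sdim0 b (G : set 'rV[R]_b) : submod G -> (forall g, G g -> g^p = 0) ->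
  sdim G = 0%N.
Proof.
move=> hG G0; apply/eqP; rewrite mxrank_eq0 -submx0; apply/rV_subP => v.
by move=> /(resmxP _ hG)[g /G0 -> ->]; apply: sub0mx.
Qed.

Lemma sdim_full b (G : set 'rV[R]_b) : submod G -> (forall v, exists2 g, G g & g^p = v) ->
  sdim G = b.
Proof.
move=> hG GT; apply/eqP; apply: (_ : row_full _); rewrite -sub1mx.
by apply/rV_subP => v _; apply/(resmxP _ hG); have [g] := GT v; exists g.
Qed.

Lemma sdim_free r b (G : set 'rV[R]_b) : submod G -> (r <= sdim G)%N ->
  exists2 W : 'M[R]_(r, b), forall i, G (row i W) & row_free W^p.
Proof.
move=> hG rG.
have lift_row (i : 'I_r) : exists w : 'rV[R]_b,
    G w /\ w^p = row (widen_ord rG i) (row_base (resmx G)).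
  have : (row (widen_ord rG i) (row_base (resmx G)) <= resmx G)%MS.
    by rewrite (submx_trans (row_sub _ _))// eq_row_base.
  by move=> /(resmxP _ hG)[g Gg ->]; exists g.
have [f fP] := choice lift_row.
exists (\matrix_i f i); first by move=> i; rewrite rowK; case: (fP i).
have -> : (\matrix_i f i)^p = rowsub (widen_ord rG) (row_base (resmx G)).
  apply/row_matrixP => i; rewrite -map_row rowK; have [_ ->] := fP i.
  by apply/rowP => j; rewrite !mxE.
rewrite -(mul1mx (row_base _)) -mul_rowsub_mx /row_free mxrankMfree ?row_base_free//.
rewrite -/(row_free _); apply/row_freeP; exists (colsub (widen_ord rG) 1%:M).
rewrite mulmx_colsub mulmx1; apply/matrixP => i j; rewrite !mxE.
by rewrite -!val_eqE.
Qed.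

Lemma free_sdim r b (G : set 'rV[R]_b) (W : 'M[R]_(r, b)) : submod G ->
  (forall i, G (row i W)) -> row_free W^p -> (r <= sdim G)%N.
Proof.
move=> hG GW /eqP <-; apply: mxrankS; apply/row_subP => i.
by apply/(resmxP _ hG); exists (row i W) => //; rewrite map_row.
Qed.

Lemma sdim_gt0 b (G : set 'rV[R]_b) : submod G ->
  (0 < sdim G)%N <-> exists2 g, G g & g^p <> 0.
Proof.
move=> hG; split=> [|[g Gg g0]]; last first.
  apply: (@free_sdim _ _ _ g) => //; first by move=> i; rewrite row_id.
  by rewrite /row_free; apply/eqP; rewrite rank_rV; case: eqP g0.
move=> /(sdim_free hG)[W GW Wf]; exists (row 0 W) => // W0.
move: Wf; rewrite /row_free (_ : W^p = 0) ?mxrank0// -W0 map_row.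
by apply/rowP => j; rewrite !mxE.
Qed.

Lemma submod_cap_res b (G : set 'rV[R]_b) (Y : 'M[k]_b) : submod G ->
  submod [set v | G v /\ (v^p <= Y)%MS].
Proof.
move=> [G0 GD GZ]; split=> [|u v [Gu uY] [Gv vY]|a u [Gu uY]]; split.
- exact: G0.
- by rewrite map_mx0 sub0mx.
- exact: GD.
- by rewrite map_mxD addmx_sub.
- exact: GZ.
- by rewrite map_mxZ scalemx_sub.
Qed.

Lemma sdim_cap_res b (G : set 'rV[R]_b) (Y : 'M[k]_b) : submod G ->
  sdim [set v | G v /\ (v^p <= Y)%MS] = \rank (resmx G :&: Y)%MS.
Proof.
move=> hG; have hGY := submod_cap_res Y hG; apply/eqP; rewrite eqn_leq; apply/andP.
split; apply: mxrankS; apply/rV_subP => v.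
  move=> /(resmxP _ hGY)[g [Gg gY] ->]; rewrite sub_capmx gY andbT.
  by apply/(resmxP _ hG); exists g.
rewrite sub_capmx => /andP[/(resmxP _ hG)[g Gg ->] gY].
by apply/(resmxP _ hGY); exists g.
Qed.

Section Relation.
Variables (a b : nat) (G : set ('rV[R]_a * 'rV[R]_b)%type).

Definition rel_dom : set 'rV[R]_a := [set u | exists v, G (u, v)].
Definition rel_img : set 'rV[R]_b := [set v | exists u, G (u, v)].
(** The suffix [0] keeps the pairs whose other component vanishes modulo the maximal ideal. *)
Definition rel_dom0 : set 'rV[R]_a := [set u | exists v, G (u, v) /\ v^p = 0].
Definition rel_img0 : set 'rV[R]_b := [set v | exists u, G (u, v) /\ u^p = 0].

Hypothesis hG : submod (G : set ('rV[R]_a * 'rV[R]_b : lmodType R)%type).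

Lemma swap_submod :
  submod ([set vu | G (vu.2, vu.1)] : set ('rV[R]_b * 'rV[R]_a : lmodType R)%type).
Proof.
have [G0 GD GZ] := hG; split=> [|u v Gu Gv|r u Gu]; first exact: G0.
  exact: (GD _ _ Gu Gv).
exact: (GZ r _ Gu).
Qed.

Lemma rel_dom_submod : submod rel_dom.
Proof.
have [G0 GD GZ] := hG; split; first by exists 0.
- by move=> u u' [v Gv] [v' Gv']; exists (v + v'); apply: (GD _ _ Gv Gv').
- by move=> r u [v Gv]; exists (r *: v); apply: (GZ r _ Gv).
Qed.

Lemma rel_dom0_submod : submod rel_dom0.
Proof.
have [G0 GD GZ] := hG; split; first by exists 0; rewrite map_mx0.
- move=> u u' [v [Gv v0]] [v' [Gv' v'0]]; exists (v + v').
  by rewrite map_mxD v0 v'0 addr0; split=> //; apply: (GD _ _ Gv Gv').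
- move=> r u [v [Gv v0]]; exists (r *: v); rewrite map_mxZ v0 scaler0.
  by split=> //; apply: (GZ r _ Gv).
Qed.

End Relation.

Lemma rel_img_submod a b (G : set ('rV[R]_a * 'rV[R]_b : lmodType R)%type) :
  submod G -> submod (rel_img G).
Proof. by move=> /swap_submod/rel_dom_submod. Qed.

Lemma rel_img0_submod a b (G : set ('rV[R]_a * 'rV[R]_b : lmodType R)%type) :
  submod G -> submod (rel_img0 G).
Proof. by move=> /swap_submod/rel_dom0_submod. Qed.

(* Compare both sides with the dimension of the residue of [G] in [k^a x k^b]. *)
Lemma sdim_rel_le a b (G : set ('rV[R]_a * 'rV[R]_b : lmodType R)%type) : submod G ->
  (sdim (rel_dom G) + sdim (rel_img0 G) <= sdim (rel_img G) + sdim (rel_dom0 G))%N.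
Proof.
move=> hG; have [G0 GD GZ] := hG.
have hW : submod [set w : 'rV[R]_(a + b) | G (lsubmx w, rsubmx w)].
  split; first by rewrite /= !linear0.
  - by move=> u v /= Gu Gv; rewrite !linearD; apply: (GD _ _ Gu Gv).
  - by move=> r u /= Gu; rewrite !linearZ; apply: (GZ r _ Gu).
pose W := resmx [set w : 'rV[R]_(a + b) | G (lsubmx w, rsubmx w)].
have WP u v : (row_mx u v <= W)%MS <-> exists u' v', [/\ G (u', v'), u = u'^p & v = v'^p].
  split=> [/(resmxP _ hW)[w Gw]|[u' [v' [Guv -> ->]]]].
    rewrite -{1}(hsubmxK w) map_row_mx => /eq_row_mx[-> ->].
    by exists (lsubmx w), (rsubmx w).
  by apply/(resmxP _ hW); exists (row_mx u' v'); rewrite /= ?row_mxKl ?row_mxKr ?map_row_mx.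
pose L : 'M[k]_(a + b, a) := col_mx 1%:M 0.
pose M : 'M[k]_(a + b, b) := col_mx 0 1%:M.
have LE (u : 'rV_a) (v : 'rV_b) : row_mx u v *m L = u.
  by rewrite mul_row_col mulmx1 mulmx0 addr0.
have ME (u : 'rV_a) (v : 'rV_b) : row_mx u v *m M = v.
  by rewrite mul_row_col mulmx1 mulmx0 add0r.
apply: (@leq_trans (\rank W)).
  rewrite -(mxrank_mul_ker W L); apply: leq_add.
    apply/mxrankS/rV_subP => u /(resmxP _ (rel_dom_submod hG))[g [v Gv] ->].
    by rewrite -(LE g^p v^p); apply: submxMr; apply/WP; exists g, v.
  have freeM : row_free (row_mx 0 1%:M : 'M[k]_(b, a + b)).
    by apply/row_freeP; exists M; rewrite mul_row_col mul0mx mulmx1 add0r.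
  rewrite /sdim -(mxrankMfree _ freeM); apply/mxrankS/row_subP => i.
  rewrite row_mul mul_mx_row mulmx0 mulmx1.
  have /(resmxP _ (rel_img0_submod hG))[v [u [Gu u0]] ->] := row_sub i (resmx (rel_img0 G)).
  rewrite sub_capmx; apply/andP; split; last by apply/sub_kermxP; rewrite LE.
  by apply/WP; exists u, v; rewrite u0.
rewrite -(mxrank_mul_ker W M); apply: leq_add.
  apply/mxrankS/rV_subP => _ /submxP[w ->]; rewrite mulmxA.
  have := submxMl w W; rewrite -(hsubmxK (w *m W)) => /WP[u' [v' [Guv uE vE]]].
  by rewrite ME vE; apply/(resmxP _ (rel_img_submod hG)); exists v' => //; exists u'.
have freeL : row_free (row_mx 1%:M 0 : 'M[k]_(a, a + b)).
  by apply/row_freeP; exists L; rewrite mul_row_col mul0mx mulmx1 addr0.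
rewrite /sdim -[X in (_ <= X)%N](mxrankMfree _ freeL); apply/mxrankS/rV_subP => w.
rewrite -(hsubmxK w) sub_capmx => /andP[/WP[u [v [Guv uE vE]]] /sub_kermxP].
rewrite ME => w0; rewrite w0 uE -[u^p]mulmx1 -[0](mulmx0 _ u^p) -mul_mx_row.
apply: submxMr; apply/(resmxP _ (rel_dom0_submod hG)); exists u => //.
by exists v; rewrite -vE.
Qed.

(** This is the substitute for rank-nullity. Almost every dimension count below consists in choosing
    [G] and recognizing the four submodules. *)
Lemma sdim_rel a b (G : set ('rV[R]_a * 'rV[R]_b : lmodType R)%type) : submod G ->
  (sdim (rel_dom G) + sdim (rel_img0 G) = sdim (rel_img G) + sdim (rel_dom0 G))%N.
Proof.
move=> hG; apply/eqP; rewrite eqn_leq sdim_rel_le//=.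
exact: (sdim_rel_le (swap_submod hG)).
Qed.

Lemma scaled_rel_submod a b c d (M : 'M[R]_(a, b)) :
  submod ([set wv | c *: (wv.1 *m M) = d *: wv.2]
    : set ('rV[R]_a * 'rV[R]_b : lmodType R)%type).
Proof.
split=> [|[u v] [u' v'] /= e e'|r [u v] /= e] /=; first by rewrite mul0mx !scaler0.
  by rewrite mulmxDl !scalerDr e e'.
by rewrite -scalemxAl scalerA mulrC -scalerA e !scalerA mulrC.
Qed.

Lemma scaled_ker_submod a b c (M : 'M[R]_(a, b)) : submod [set w : 'rV_a | c *: (w *m M) = 0].
Proof.
split=> [|u v /= e e'|r u /= e] /=; first by rewrite mul0mx scaler0.
  by rewrite mulmxDl scalerDr e e' addr0.
by rewrite -scalemxAl scalerA mulrC -scalerA e scaler0.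
Qed.

Lemma rel_cap_submod a b (G : set ('rV[R]_a * 'rV[R]_b : lmodType R)%type) (X : 'M[k]_b) :
  submod G -> submod ([set wv | G wv /\ (wv.2^p <= X)%MS]
    : set ('rV[R]_a * 'rV[R]_b : lmodType R)%type).
Proof.
move=> [G0 GD GZ]; split=> [|v w [Gv vX] [Gw wX]|r v [Gv vX]]; split.
- exact: G0.
- by rewrite map_mx0 sub0mx.
- exact: GD.
- by rewrite map_mxD addmx_sub.
- exact: GZ.
- by rewrite map_mxZ scalemx_sub.
Qed.

Section Lift.
Variables (a b : nat) (M : 'M[R]_(a, b)).

(** Lifting [x *: q] to [w] is only a relation, but the hypothesis on rows [w] with zero residue
    kills [rel_img0], so that no dimension is lost. *)
Lemma sdim_lift x (Q : set 'rV[R]_b) (H : set 'rV[R]_a) : submod Q -> submod H ->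
  (forall (w : 'rV_a) q, w^p = 0 -> w *m M = x *: q -> q^p = 0) ->
  (forall q, Q q -> exists w, x *: q = w *m M) ->
  (forall w q, w *m M = x *: q -> H w) -> (sdim Q <= sdim H)%N.
Proof.
move=> hQ hH free QM MH; have hG := scaled_rel_submod 1 x M.
have e := sdim_rel hG; rewrite (sdim0 (rel_img0_submod hG)) ?addn0 in e; last first.
  by move=> q [w [/= e w0]]; rewrite scale1r in e; apply: free w0 e.
apply: leq_trans (sdim_le hQ (rel_img_submod hG) _) _ => [q /QM[w wE]|].
  by exists q => //; exists w; rewrite /= scale1r.
apply: leq_trans (sdim_le (rel_dom_submod hG) hH _); first by rewrite e leq_addr.
by move=> w [q /=]; rewrite scale1r => /MH; exists w.
Qed.

(** [Q1] bounds the image of the relation between [w] and [q1]; the lifts of the elements of [Q2]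
    are related to [q1 = 0] and are counted by [rel_dom0]. *)
Lemma sdim_lift2 x1 x2 (Q1 Q2 : set 'rV[R]_b) (H : set 'rV[R]_a) :
  submod Q1 -> submod Q2 -> submod H ->
  (forall (w : 'rV_a) q1 q2, w^p = 0 -> w *m M = x1 *: q1 + x2 *: q2 -> q1^p = 0 /\ q2^p = 0) ->
  (forall q, Q1 q -> exists w q2, x1 *: q + x2 *: q2 = w *m M) ->
  (forall q, Q2 q -> exists w, x2 *: q = w *m M) ->
  (forall w q1 q2, w *m M = x1 *: q1 + x2 *: q2 -> H w) -> (sdim Q1 + sdim Q2 <= sdim H)%N.
Proof.
move=> hQ1 hQ2 hH free Q1M Q2M MH.
pose G := [set wq : 'rV[R]_a * 'rV[R]_b | exists q2, wq.1 *m M = x1 *: wq.2 + x2 *: q2].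
have hG : submod (G : set ('rV[R]_a * 'rV[R]_b : lmodType R)%type).
  split=> [|[u v] [u' v'] [q /= e] [q' /= e']|r [u v] [q /= e]].
  - by exists 0; rewrite /= mul0mx !scaler0 addr0.
  - by exists (q + q') => /=; rewrite mulmxDl e e' !scalerDr addrACA.
  - by exists (r *: q) => /=; rewrite -scalemxAl e scalerDr !scalerA !(mulrC r).
have e := sdim_rel hG; rewrite (sdim0 (rel_img0_submod hG)) ?addn0 in e; last first.
  by move=> q [w [[q2 /= e] w0]]; have [] := free _ _ _ w0 e.
apply: leq_trans (sdim_le (rel_dom_submod hG) hH _); last first.
  by move=> w [q [q2 /= /MH]]; exists w.
rewrite e; apply: leq_add.
  apply: (sdim_le hQ1 (rel_img_submod hG)) => q /Q1M[w [q2 wE]].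
  by exists q => //; exists w, q2.
apply: (sdim_lift (x := x2) hQ2 (rel_dom0_submod hG) _ Q2M) => w q.
  by move=> w0 e'; have [] // := free w 0 q w0; rewrite scaler0 add0r.
move=> e'; exists 0; rewrite map_mx0; split => //; exists q.
by rewrite /= scaler0 add0r.
Qed.

End Lift.

(** All mixed products vanish. The empty product would give 1 = 1 + 1, whence the positivity of
    [r]. *)
Lemma prod_add_orthogonal r (u v : 'I_r -> R) : (0 < r)%N ->
  (forall i j, u i * v j = 0) ->
  \prod_i (u i + v i) = \prod_i u i + \prod_i v i.
Proof.
case: r u v => // r u v _; elim: r u v => [|r IH] u v uv.
  by rewrite !big_ord_recl !big_ord0 !mulr1.
rewrite big_ord_recl IH// [X in _ = X + _]big_ord_recl [X in _ = _ + X]big_ord_recl.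
rewrite mulrDl !mulrDr.
have -> : u ord0 * \prod_(i < r.+1) v (lift ord0 i) = 0.
  by rewrite big_ord_recl mulrA uv mul0r.
have -> : v ord0 * \prod_(i < r.+1) u (lift ord0 i) = 0.
  by rewrite big_ord_recl mulrA (mulrC (v _)) uv mul0r.
by rewrite addr0 add0r.
Qed.

Lemma det_add_orthogonal r (U V : 'M[R]_r) : (0 < r)%N ->
  (forall i j i' j', U i j * V i' j' = 0) -> \det (U + V) = \det U + \det V.
Proof.
move=> r0 UV; rewrite /determinant -big_split/=; apply: eq_bigr => s _.
rewrite -mulrDr -prod_add_orthogonal//.
by congr (_ * _); apply: eq_bigr => i _; rewrite mxE.
Qed.

Lemma detZ_row r (c : 'I_r -> R) (M : 'M[R]_r) :
  \det (\matrix_(i, j) (c i * M i j)) = (\prod_i c i) * \det M.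
Proof.
rewrite /determinant mulr_sumr; apply: eq_bigr => s _; rewrite mulrCA -big_split/=.
by congr (_ * _); apply: eq_bigr => i _; rewrite mxE.
Qed.

Lemma rows_factor r n q (V : 'M[R]_(r, q)) (A : 'M[R]_(n, q)) :
  (forall i, exists w, row i V = w *m A) -> exists C, V = C *m A.
Proof.
move=> /choice[f fE]; exists (\matrix_i f i).
by apply/row_matrixP => i; rewrite fE row_mul rowK.
Qed.

Lemma minors_ideal_rowspace r n q (A : 'M[R]_(n, q)) (V : 'M[R]_(r, q)) D :
  (forall i, exists w, row i V = w *m A) -> minors_ideal A r (\det (V *m D)).
Proof. by move=> /rows_factor[C ->]; apply: minors_ideal_mulmx. Qed.

(** A right inverse [D] of [W] turns the matrix with rows [c i *: row i W] into a diagonal one, so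
    the product of the [c i] is the determinant of a matrix [C *m A *m D]. *)
Lemma minors_ideal_prod r n q (A : 'M[R]_(n, q)) (W : 'M[R]_(r, q)) (c : 'I_r -> R) :
  row_free W^p -> (forall i, exists w, c i *: row i W = w *m A) ->
  minors_ideal A r (\prod_i c i).
Proof.
move=> /(residue_row_free)[D WD] cW.
have -> : \prod_i c i = \det ((\matrix_(i, j) (c i * W i j)) *m D).
  transitivity ((\prod_i c i) * \det (W *m D)); first by rewrite WD det1 mulr1.
  rewrite -detZ_row; congr (\det _).
  by apply/matrixP => i j; rewrite !mxE mulr_sumr; apply: eq_bigr => l _; rewrite mxE mulrA.
apply: minors_ideal_rowspace => i; have [w wE] := cW i; exists w; rewrite -wE.
by apply/rowP => j; rewrite !mxE.
Qed.

Lemma minors_ideal_prod_sdim r n q (A : 'M[R]_(n, q)) (G : set 'rV[R]_q) (c : 'I_r -> R) :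
  submod G -> (r <= sdim G)%N -> (forall i g, G g -> exists w, c i *: g = w *m A) ->
  minors_ideal A r (\prod_i c i).
Proof.
move=> hG /(sdim_free hG)[W GW Wf] cG.
by apply: (minors_ideal_prod Wf) => i; apply: cG.
Qed.

Lemma minors_ideal_exp_sdim r n q (A : 'M[R]_(n, q)) (G : set 'rV[R]_q) c :
  submod G -> (r <= sdim G)%N -> (forall g, G g -> exists w, c *: g = w *m A) ->
  minors_ideal A r (c ^+ r).
Proof.
move=> hG rG cG; have := @minors_ideal_prod_sdim r _ _ A G (fun=> c) hG rG (fun=> cG).
by rewrite prodr_const card_ord.
Qed.

Lemma minors_ideal_sub_prods r n q (A : 'M[R]_(n, q)) (J : set R) : ideal J ->
  A^p = 0 -> (forall f : 'I_r -> R, (forall i, p (f i) = 0) -> J (\prod_i f i)) ->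
  minors_ideal A r `<=` J.
Proof.
move=> hJ A0 JP; apply: minors_ideal_sub => // C D; apply: (ideal_sum _ hJ) => s _.
apply: (idealMl _ hJ); apply: JP => i.
have : (C *m A *m D)^p = 0 by rewrite !map_mxM A0 mulmx0 mul0mx.
by move=> /map_mx_eq0.
Qed.

(** * Minimal complexes and criteria for the eventual periodicity of their minors *)

Section MinimalComplex.

Definition minimal_complex (b : nat -> nat) (A : forall n, 'M[R]_(b n.+1, b n)) :=
  (forall n, (A n)^p = 0) /\
  (forall n (v : 'rV_(b n.+1)), v *m A n = 0 <-> exists w, v = w *m A n.+1).

Definition minors_periodic (b : nat -> nat) (A : forall n, 'M[R]_(b n.+1, b n)) r :=
  exists N, forall n, (N <= n)%N -> minors_ideal (A n) r = minors_ideal (A n.+2) r.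

Variables (b : nat -> nat) (A : forall n, 'M[R]_(b n.+1, b n)).
Hypothesis A_min : minimal_complex A.

Lemma complex_residue n : (A n)^p = 0. Proof. by case: A_min. Qed.

Lemma complex_ker n (v : 'rV_(b n.+1)) : v *m A n = 0 -> exists w, v = w *m A n.+1.
Proof. by case: A_min => _ /(_ n v)[]. Qed.

Lemma complex_comp n : A n.+1 *m A n = 0.
Proof.
apply/row_matrixP => i; rewrite row0 row_mul.
by case: A_min => _ /(_ n (row i (A n.+1)))[_]; apply; exists (delta_mx 0 i); rewrite rowE.
Qed.

Lemma complex_image n (w : 'rV_(b n.+2)) : w *m A n.+1 *m A n = 0.
Proof. by rewrite -mulmxA complex_comp mulmx0. Qed.

Lemma complex_ker_residue n (v : 'rV_(b n.+1)) : v *m A n = 0 -> v^p = 0.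
Proof. by move=> /complex_ker[w ->]; rewrite map_mxM complex_residue mulmx0. Qed.

(** A basis vector in the degree after a zero module would be a cycle, against minimality; so all
    later ranks vanish and there are no minors. The other criteria are then applied to complexes of
    positive ranks. *)
Lemma rank0_minors_periodic n0 r : (0 < r)%N -> b n0 = 0%N -> minors_periodic A r.
Proof.
move=> r0 b0.
have bS n : b n = 0%N -> b n.+1 = 0%N.
  move=> bn; apply/eqP; rewrite -leqn0 leqNgt; apply/negP => bS.
  have : (delta_mx 0 (Ordinal bS) : 'rV[R]_(b n.+1)) *m A n = 0.
    by apply/rowP => -[j jP]; exfalso; move: jP; rewrite bn.
  move=> /complex_ker_residue /map_mx_eq0/(_ 0 (Ordinal bS)).
  by rewrite mxE !eqxx rmorph1 => /eqP; rewrite oner_eq0.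
have b0n n : (n0 <= n)%N -> b n = 0%N.
  by move=> /subnK <-; elim: (n - n0)%N => // m IH; apply: bS.
have I0 n : (n0 <= n)%N -> minors_ideal (A n) r = ideal_gen set0.
  move=> /b0n bn; congr ideal_gen; rewrite -subset0 => x [f [g _]].
  by case: (g (Ordinal r0)) => j jP; move: jP; rewrite bn.
by exists n0 => n nn; rewrite !I0// !leqW.
Qed.

Lemma ascending_minors_periodic r n0 :
  (forall n, (n0 <= n)%N -> minors_ideal (A n) r `<=` minors_ideal (A n.+2) r) ->
  minors_periodic A r.
Proof.
move=> mono.
by apply: (@noetherian_chain2_stable _ (fun n => minors_ideal (A n) r) n0) => // n;
  apply: minors_ideal_ideal.
Qed.

(* The minors of a minimal differential lie in the r-th power of the maximal
   ideal, which the hypothesis makes them generate. *)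
Lemma full_minors_periodic r n0 :
  (forall n, (n0 <= n)%N -> forall f : 'I_r -> R, (forall i, p (f i) = 0) ->
    minors_ideal (A n) r (\prod_i f i)) ->
  minors_periodic A r.
Proof.
move=> full; exists n0 => n nn; apply/seteqP; split.
  apply: (minors_ideal_sub_prods (minors_ideal_ideal _ _) (complex_residue n)).
  by apply: full; rewrite !leqW.
apply: (minors_ideal_sub_prods (minors_ideal_ideal _ _) (complex_residue n.+2)).
exact: full.
Qed.

End MinimalComplex.

Definition maximal_mul (I : set R) : set R :=
  ideal_gen [set u * v | u in [set u | p u = 0] & v in I].

Lemma residue_unitmx1B n (M : 'M[R]_n) : M^p = 0 ->
  exists N, (1%:M - M) *m N = 1%:M /\ N *m (1%:M - M) = 1%:M.
Proof.
move=> M0; apply: (residue_unitmx).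
by rewrite map_mxB map_mx1 M0 subr0 unitmx1.
Qed.

(** Modulo [H] the column [S] of generators satisfies [S = M *m S] with [M] zero in the residue
    field, and [1%:M - M] is invertible. *)
Lemma nakayama (I H : set R) : ideal I -> ideal H ->
  (forall x, I x -> exists y h, [/\ maximal_mul I y, H h & x = y + h]) -> I `<=` H.
Proof.
move=> hI hH IH; have [s sE] := R_noeth hI.
have mulP y : maximal_mul I y ->
    exists c : 'rV[R]_(size s), c^p = 0 /\ y = \sum_i c 0 i * s`_i.
  move: y; apply: (@ideal_gen_sub _ _ [set y | exists c : 'rV[R]_(size s),
      c^p = 0 /\ y = \sum_i c 0 i * s`_i]).
    split.
    - by exists 0; rewrite map_mx0 big1// => i _; rewrite mxE mul0r.
    - move=> _ _ [c [c0 ->]] [d [d0 ->]]; exists (c + d); rewrite map_mxD c0 d0 addr0.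
      by split => //; rewrite -big_split; apply: eq_bigr => i _; rewrite mxE mulrDl.
    - move=> a _ [c [c0 ->]]; exists (a *: c); rewrite map_mxZ c0 scaler0.
      by split => //; rewrite mulr_sumr; apply: eq_bigr => i _; rewrite mxE mulrA.
  move=> _ [u /= pu [v Iv <-]]; move: Iv; rewrite sE => /ideal_gen_finP[c ->].
  exists (\row_i (u * c i)); split.
    by apply/rowP => i; rewrite !mxE rmorphM pu mul0r.
  by rewrite mulr_sumr; apply: eq_bigr => i _; rewrite mxE mulrA.
have gens (i : 'I_(size s)) : exists ch : 'rV[R]_(size s) * R,
    [/\ ch.1^p = 0, H ch.2 & s`_i = \sum_j ch.1 0 j * s`_j + ch.2].
  have /IH[y [h [/mulP[c [c0 ->]] Hh e]]] : I s`_i.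
    by rewrite sE; apply: mem_ideal_gen => /=; apply: mem_nth.
  by exists (c, h).
have [f fP] := choice gens.
pose M : 'M[R]_(size s) := \matrix_i (f i).1.
have M0 : M^p = 0.
  by apply/row_matrixP => i; rewrite -map_row rowK row0; case: (fP i).
have [N [_ NM]] := residue_unitmx1B M0.
pose S : 'cV[R]_(size s) := \col_i s`_i.
have SE : S = N *m \col_i (f i).2.
  rewrite -[LHS]mul1mx -NM -mulmxA; congr (_ *m _); rewrite mulmxBl mul1mx.
  apply/colP => i; rewrite !mxE; have [_ _ {1}->] := fP i.
  rewrite [X in _ - X](_ : _ = \sum_j (f i).1 0 j * s`_j); first by rewrite addrAC subrr add0r.
  by apply: eq_bigr => j _; rewrite !mxE.
rewrite sE; apply: (ideal_gen_sub hH) => x /= xs.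
have xi : (index x s < size s)%N by rewrite index_mem.
have -> : x = S (Ordinal xi) 0 by rewrite mxE /= nth_index.
rewrite SE mxE; apply: (ideal_sum _ hH) => j _; apply: (idealMl _ hH).
by rewrite mxE; case: (fP j).
Qed.

(** * Fiber products *)

Section FiberProduct.
Variables (b : nat -> nat) (A : forall n, 'M[R]_(b n.+1, b n)).
Hypothesis A_min : minimal_complex A.
Hypothesis b_gt0 : forall n, (0 < b n)%N.

Definition maximal_decomposition (I J : set R) :=
  [/\ ideal I, ideal J, forall x, I x -> p x = 0, forall x, J x -> p x = 0
   & (forall x, I x -> J x -> x = 0) /\
     (forall z, p z = 0 -> exists x y, [/\ I x, J y & z = x + y])].

Lemma maximal_decompositionC I J :
  maximal_decomposition I J -> maximal_decomposition J I.
Proof.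
case=> hI hJ Im Jm [cap dec]; split=> //; split=> [x Jx Ix|z /dec[x [y [Ix Jy ->]]]].
  exact: cap.
by exists y, x; rewrite addrC.
Qed.

Definition rows_in (I : set R) n : set 'rV[R]_n := [set v | forall j, I (v 0 j)].

Lemma rows_in_submod I n : ideal I -> submod (@rows_in I n).
Proof.
move=> hI; split=> [j|u v Iu Iv j|a u Iu j]; rewrite mxE.
- exact: ideal0.
- by apply: idealD; [|exact: Iu|exact: Iv].
- by apply: idealMl; [|exact: Iu].
Qed.

Lemma rows_in_mulmx I n q (v : 'rV[R]_n) (M : 'M[R]_(n, q)) : ideal I ->
  rows_in I v -> rows_in I (v *m M).
Proof.
by move=> hI Iv j; rewrite mxE; apply: (ideal_sum _ hI) => i _; apply: (idealMr _ hI).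
Qed.

Lemma rows_inZ I n x (v : 'rV[R]_n) : ideal I -> I x -> rows_in I (x *: v).
Proof. by move=> hI Ix j; rewrite mxE; apply: (idealMr _ hI). Qed.

Definition into_rows q n (M : 'M[R]_(q, n)) (I : set R) : set 'rV[R]_q :=
  [set w | rows_in I (w *m M)].

Lemma into_rows_submod q n (M : 'M[R]_(q, n)) I : ideal I -> submod (into_rows M I).
Proof.
move=> hI; have [h0 hD hZ] := @rows_in_submod I n hI; split=> [|u v Iu Iv|a u Iu].
- by rewrite /into_rows /= mul0mx.
- by rewrite /into_rows /= mulmxDl; apply: hD.
- by rewrite /into_rows /= -scalemxAl; apply: hZ.
Qed.

Local Notation msq := (maximal_mul [set u | p u = 0]).

Lemma residue_ideal : ideal [set u | p u = 0].
Proof.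
split=> [|x y /= x0 y0|a x /= x0]; rewrite /= ?rmorph0 ?rmorphD ?rmorphM ?x0 ?y0 ?addr0//.
by rewrite mulr0.
Qed.

Lemma mulmx_msq q n (w : 'rV[R]_q) (M : 'M[R]_(q, n)) : w^p = 0 -> M^p = 0 ->
  rows_in msq (w *m M).
Proof.
move=> /map_mx_eq0 w0 /map_mx_eq0 M0 j; rewrite mxE.
apply: ideal_sum => [|i _]; first exact: ideal_gen_ideal.
by apply: mem_ideal_gen; exists (w 0 i) => //; exists (M i j).
Qed.

(** The image of [x] in m/m^2 is nonzero; for [free2], the images of [x1] and [x2] are linearly
    independent there. *)
Definition free1 x := forall c, msq (c * x) -> p c = 0.
Definition free2 x1 x2 := forall c1 c2, msq (c1 * x1 + c2 * x2) -> p c1 = 0 /\ p c2 = 0.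

Lemma free2_free1 x1 x2 : free2 x1 x2 -> free1 x1.
Proof. by move=> f2 c cx; have [] // := f2 c 0; rewrite mul0r addr0. Qed.

Section Side.
Variables I J : set R.
Hypothesis IJ : maximal_decomposition I J.

Let hI : ideal I. Proof. by case: IJ. Qed.
Let hJ : ideal J. Proof. by case: IJ. Qed.
Let Im x : I x -> p x = 0. Proof. by case: IJ => _ _ + _ _; apply. Qed.
Let capIJ x : I x -> J x -> x = 0. Proof. by case: IJ => _ _ _ _ [+ _]; apply. Qed.
Let dec z : p z = 0 -> exists x y, [/\ I x, J y & z = x + y].
Proof. by case: IJ => _ _ _ _ [_ +]; apply. Qed.

Lemma decomposition_mul0 x y : I x -> J y -> x * y = 0.
Proof. by move=> Ix Jy; apply: capIJ; [apply: idealMr|apply: idealMl]. Qed.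

Lemma rows_dec n (v : 'rV[R]_n) : v^p = 0 ->
  exists u w, [/\ rows_in I u, rows_in J w & v = u + w].
Proof.
move=> /map_mx_eq0 v0; have [u [w H]] := row_choice2 (fun j => dec (v0 0 j)).
exists u, w; split=> [j|j|]; [by case: (H j)|by case: (H j)|].
by apply/rowP => j; rewrite mxE; case: (H j).
Qed.

Lemma rows_cap n (v : 'rV[R]_n) : rows_in I v -> rows_in J v -> v = 0.
Proof. by move=> Iv Jv; apply/rowP => j; rewrite mxE; apply: capIJ. Qed.

Lemma rows_in_residue n (v : 'rV[R]_n) : rows_in I v -> v^p = 0.
Proof. by move=> Iv; apply/map_mx_eq0 => i j; rewrite ord1; apply: Im. Qed.

Lemma rows_cap_add n q (u v : 'rV[R]_q) (M : 'M[R]_(q, n)) :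
  rows_in I u -> rows_in J v -> (u + v) *m M = 0 -> u *m M = 0.
Proof.
move=> Iu Jv; rewrite mulmxDl => /eqP; rewrite addr_eq0 => /eqP e.
apply: rows_cap; first exact: rows_in_mulmx.
rewrite e; have [_ _ hZ] := @rows_in_submod J n hJ.
by rewrite -scaleN1r; apply: hZ; apply: rows_in_mulmx.
Qed.

(** The I-component of the cycle [w *m A n.+1] is itself a cycle, because I and J meet in zero;
    hence it is the image of some [w1]. *)
Lemma into_rows_dec n (w : 'rV[R]_(b n.+2)) : exists u v,
  [/\ into_rows (A n.+1) I u, into_rows (A n.+1) J v & w = u + v].
Proof.
have [|u [v [Iu Jv e]]] := @rows_dec _ (w *m A n.+1).
  by rewrite map_mxM (complex_residue A_min) mulmx0.
have : (u + v) *m A n = 0 by rewrite -e (complex_image A_min).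
move=> /(rows_cap_add Iu Jv)/(complex_ker A_min)[w1 w1E].
exists w1, (w - w1); split; first by rewrite /into_rows /= -w1E.
  by rewrite /into_rows /= mulmxBl e -w1E addrC addKr.
by rewrite addrC subrK.
Qed.

Lemma into_rows_kill n x (w : 'rV[R]_(b n.+1)) : I x -> into_rows (A n) J w ->
  exists v, x *: w = v *m A n.+1.
Proof.
move=> Ix Jw; apply: (complex_ker A_min); rewrite -scalemxAl.
by apply/rowP => j; rewrite !mxE; apply: decomposition_mul0 => //; have := Jw j; rewrite mxE.
Qed.

Lemma minors_ideal_prod_into n r (f : 'I_r -> R) : (forall i, I (f i)) ->
  (r <= sdim (into_rows (A n) J))%N -> minors_ideal (A n.+1) r (\prod_i f i).
Proof.
move=> If rW; apply: (minors_ideal_prod_sdim (into_rows_submod _ hJ) rW).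
by move=> i g Jg; apply: into_rows_kill.
Qed.

(** A row sent into J, multiplied by [x], becomes a cycle, and its lift is sent into I. A lift with
    zero residue would have its image in m^2, which [free1 x] allows only if the original row has
    zero residue. *)
Lemma into_rows_sdim_growth1 n x : I x -> free1 x ->
  (sdim (into_rows (A n) J) <= sdim (into_rows (A n.+1) I))%N.
Proof.
move=> Ix fx; apply: (sdim_lift (M := A n.+1) (x := x)); try exact: into_rows_submod.
- move=> w q w0 e; apply/map_mx_eq0 => i j; rewrite ord1.
  by apply: fx; have := mulmx_msq w0 (complex_residue A_min n.+1) j; rewrite e mxE mulrC.
- by move=> q; apply: into_rows_kill.
- by move=> w q e; rewrite /into_rows /= e; apply: rows_inZ.
Qed.

Lemma into_rows_sdim_growth2 n x1 x2 : I x1 -> I x2 -> free2 x1 x2 ->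
  (2 * sdim (into_rows (A n) J) <= sdim (into_rows (A n.+1) I))%N.
Proof.
move=> Ix1 Ix2 fx; rewrite mul2n -addnn.
apply: (sdim_lift2 (M := A n.+1) (x1 := x1) (x2 := x2)); try exact: into_rows_submod.
- move=> w q1 q2 w0 e; suff H j : p (q1 0 j) = 0 /\ p (q2 0 j) = 0.
    by split; apply/map_mx_eq0 => i j; rewrite ord1; case: (H j).
  apply: fx; have := mulmx_msq w0 (complex_residue A_min n.+1) j.
  by rewrite e !mxE (mulrC x1) (mulrC x2).
- by move=> q /(into_rows_kill Ix1)[w wE]; exists w, 0; rewrite scaler0 addr0.
- by move=> q; apply: into_rows_kill.
- move=> w q1 q2 e; rewrite /into_rows /= e.
  by have [_ hD _] := @rows_in_submod I (b n.+1) hI; apply: hD; apply: rows_inZ.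
Qed.

(* Koszul relation: [x1 w] and [x2 w] lift to [v1] and [v2], and
   [x2 v1 - x1 v2] is a further minimal generator. *)
Lemma into_rows_koszul n x1 x2 : I x1 -> I x2 -> free2 x1 x2 ->
  (0 < sdim (into_rows (A n) J))%N -> (0 < sdim (into_rows (A n.+2) I))%N.
Proof.
move=> Ix1 Ix2 fx.
move=> /(sdim_gt0 (into_rows_submod _ hJ))[w Jw w0].
have [v1 v1E] := into_rows_kill Ix1 Jw; have [v2 v2E] := into_rows_kill Ix2 Jw.
have [|u uE] := @complex_ker _ _ A_min n.+1 (x2 *: v1 - x1 *: v2).
  by rewrite mulmxBl -!scalemxAl -v1E -v2E !scalerA mulrC subrr.
apply/(sdim_gt0 (into_rows_submod _ hI)); exists u.
  rewrite /into_rows /= -uE; have [_ hD _] := @rows_in_submod I (b n.+2) hI.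
  by apply: hD; [|rewrite -scaleNr]; apply: rows_inZ => //; apply: idealN.
move=> u0; apply: w0; apply/map_mx_eq0 => i j; rewrite ord1.
have v10 : v1^p = 0.
  apply/map_mx_eq0 => i' j'; rewrite ord1.
  have := mulmx_msq u0 (complex_residue A_min n.+2) j'.
  rewrite -uE !mxE (mulrC x2) (mulrC x1) -mulNr addrC => /fx[_].
  by [].
have := mulmx_msq v10 (complex_residue A_min n.+1) j.
by rewrite -v1E mxE mulrC => /(free2_free1 fx).
Qed.

(** If [g] goes into I, [h] into J and both have the same residue, write [g - h = u + w] along I +
    J: then [g - u = h + w] is sent into both ideals, hence is a cycle, and minimality makes its
    residue zero. *)
Lemma into_rows_sdim_add n :
  (sdim (into_rows (A n) I) + sdim (into_rows (A n) J) <= b n.+1)%N.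
Proof.
have hWI := into_rows_submod (A n) hI; have hWJ := into_rows_submod (A n) hJ.
rewrite -mxrank_sum_cap [X in (_ + X)%N](_ : _ = 0%N) ?addn0 ?rank_leq_col//.
apply/eqP; rewrite mxrank_eq0 -submx0; apply/rV_subP => v; rewrite sub_capmx.
move=> /andP[/(resmxP _ hWI)[g Ig ->] /(resmxP _ hWJ)[h Jh e]].
have [|u [w [Iu Jw gh]]] := @rows_dec _ (g - h); first by rewrite map_mxB e subrr.
suff /(complex_ker_residue A_min) : (g - u) *m A n = 0.
  by rewrite map_mxB (rows_in_residue Iu) subr0 => ->; apply: sub0mx.
apply: rows_cap.
  have [_ hD hZ] := hWI; apply: hD => //; rewrite -scaleN1r; apply: hZ.
  exact: rows_in_mulmx.
have -> : g - u = h + w by apply/eqP; rewrite subr_eq addrAC -addrA -gh addrC subrK.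
by have [_ hD _] := hWJ; apply: hD => //; apply: rows_in_mulmx.
Qed.

(* [sdim (rel_img (G i)) + sdim (rel_dom0 (G i))] is nondecreasing in [i]: its
   value is at least [b n.+1] for [i = 0] and at most the claimed bound for [i = t]. *)
Lemma into_rows_sdim_nilpotent n y t : J `<=` principal y -> J y -> (0 < t)%N ->
  y ^+ t <> 0 -> y ^+ t.+1 = 0 ->
  (b n.+1 <= sdim (into_rows (A n.+1) J))%N.
Proof.
move=> Jy yJ t0 yt yt1.
have hW := into_rows_submod (A n.+1) hJ; have [W0 WD WZ] := hW.
have Iy x : I x -> y * x = 0 by move=> Ix; rewrite mulrC; apply: decomposition_mul0.
have ytm z : p z = 0 -> y ^+ t * z = 0.
  move=> /dec[u [v [Iu /Jy[c ->] ->]]]; rewrite mulrDr mulrCA -exprSr yt1 mulr0 addr0.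
  by case: (t) t0 => // t' _; rewrite exprSr -mulrA Iy// mulr0.
have ytrow q (v : 'rV[R]_q) : v^p = 0 -> y ^+ t *: v = 0.
  by move=> /map_mx_eq0 v0; apply/rowP => j; rewrite !mxE ytm.
have ytrow0 q (v : 'rV[R]_q) : y ^+ t *: v = 0 -> v^p = 0.
  move=> v0; apply/map_mx_eq0 => i j; rewrite ord1; apply: contrapT => /p_unit[c cE].
  have := congr1 (fun v : 'rV_q => v 0 j * c) v0; rewrite !mxE -mulrA cE mulr1 mul0r.
  exact: yt.
pose G i := [set wv : 'rV[R]_(b n.+2) * 'rV[R]_(b n.+1) |
  into_rows (A n.+1) J wv.1 /\ y ^+ i *: (wv.1 *m A n.+1) = y ^+ t *: wv.2].
have hG i : submod (G i : set ('rV[R]_(b n.+2) * 'rV[R]_(b n.+1) : lmodType R)%type).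
  split=> [|[u v] [u' v'] [/= Jv e] [/= Jv' e']|a [u v] [/= Jv e]]; split => //=.
  - by rewrite mul0mx !scaler0.
  - exact: WD.
  - by rewrite mulmxDl !scalerDr; congr (_ + _).
  - exact: WZ.
  - by rewrite -scalemxAl scalerA mulrC -scalerA e !scalerA mulrC.
(* By [sdim_rel] the left side is the sum for [rel_img0 (G i)] and [rel_dom (G i)]. The former lies
   in [rel_img (G i.+1)], since a row of zero residue is, up to its irrelevant I-part, a multiple of
   [y]; the latter lies in [rel_dom0 (G i.+1)] because [y ^+ t.+1 = 0]. *)
have step i : (sdim (rel_img (G i)) + sdim (rel_dom0 (G i)) <=
    sdim (rel_img (G i.+1)) + sdim (rel_dom0 (G i.+1)))%N.
  rewrite -(sdim_rel (hG i)) addnC; apply: leq_add.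
    apply: (sdim_le (rel_img0_submod (hG i)) (rel_img_submod (hG i.+1))).
    move=> v [w [[/= Jw e] w0]]; exists v => //.
    have [w1 [w2 [Iw1 Jw2 wE]]] := rows_dec w0.
    have [f fE] := choice (fun j => Jy _ (Jw2 j)).
    have w2E : w2 = y *: \row_j f j by apply/rowP => j; rewrite !mxE mulrC.
    have [u1 [u2 [Iu1 Ju2 uE]]] := into_rows_dec (\row_j f j).
    have yu1 : y *: (u1 *m A n.+1) = 0.
      by apply/rowP => j; rewrite !mxE; have := Iu1 j; rewrite mxE; apply: Iy.
    exists u2; split => //=.
    have w1A : w1 *m A n.+1 = 0.
      apply: rows_cap; first exact: rows_in_mulmx.
      have -> : w1 = w + (- 1) *: w2 by rewrite wE scaleN1r addrK.
      by apply: WD => //; apply: WZ; apply: rows_in_mulmx.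
    rewrite -e wE mulmxDl w1A add0r w2E uE -scalemxAl mulmxDl scalerDr yu1 add0r.
    by rewrite scalerA -exprSr.
  apply: (sdim_le (rel_dom_submod (hG i)) (rel_dom0_submod (hG i.+1))).
  move=> w [v [/= Jw e]]; exists w => //; exists 0; rewrite map_mx0; split => //.
  by split => //=; rewrite exprS -scalerA e scaler0 scalerA -exprS yt1 scale0r.
have tot : (sdim (rel_img (G 0%N)) + sdim (rel_dom0 (G 0%N)) <=
    sdim (rel_img (G t)) + sdim (rel_dom0 (G t)))%N.
  by elim: (t) => // i /leq_trans; apply; apply: step.
have img0 : sdim (rel_img (G 0%N)) = b n.+1.
  apply: (sdim_full (rel_img_submod (hG 0%N))) => v.
  have [w wE] := resmx_lift v; exists w => //.
  have [|u uE] := @complex_ker _ _ A_min n (y ^+ t *: w).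
    rewrite -scalemxAl; apply: ytrow; rewrite map_mxM (complex_residue A_min).
    by rewrite mulmx0.
  exists u; split => /=; last by rewrite scale1r uE.
  rewrite /into_rows /= -uE; apply: rows_inZ => //.
  by case: (t) t0 => // t' _; rewrite exprSr; apply: idealMl.
have imgt : sdim (rel_img (G t)) = 0%N.
  apply: (sdim0 (rel_img_submod (hG t))) => v [w [/= Jw e]].
  by apply: ytrow0; rewrite -e ytrow// map_mxM (complex_residue A_min) mulmx0.
rewrite img0 imgt add0n in tot.
apply: leq_trans (leq_trans (leq_addr _ _) tot) _.
apply: (sdim_le (rel_dom0_submod (hG t)) hW) => w [v [[/= Jw _] _]].
by exists w.
Qed.

(** Write [X = x *: X']. Since the I-part of a boundary is a cycle and [x] is regular on I, the rows
    of [X'] are sent into J by [A n]. If there are fewer than [r] independent such rows, [X] factors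
    through fewer than [r] rows and its r-minors vanish. *)
Lemma minors_side_sub n r x X Y : (0 < r)%N ->
  I x -> I `<=` principal x -> (forall z, I z -> x * z = 0 -> z = 0) ->
  A n.+1 = X + Y -> (forall i, rows_in I (row i X)) -> (forall i, rows_in J (row i Y)) ->
  forall (C : 'M_(r, _)) (D : 'M_(_, r)),
    \det (C *m X *m D) = 0 \/
    ((r <= sdim (into_rows (A n) J))%N /\ principal (x ^+ r) (\det (C *m X *m D))).
Proof.
move=> r0 Ix Ixp xreg AE IX JY C D.
have hW := into_rows_submod (A n) hJ; have [W0 WD WZ] := hW.
have [X' XE] : exists X', X = x *: X'.
  have H i : exists f : 'I_(b n.+1) -> R, forall j, X i j = f j * x.
    by have [f fE] := choice (fun j => Ixp _ (IX i j)); exists f => j; have := fE j; rewrite mxE.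
  have [f fE] := choice H; exists (\matrix_(i, j) f i j).
  by apply/matrixP => i j; rewrite !mxE fE mulrC.
have xm z : p z = 0 -> x * z = 0 -> J z.
  move=> /dec[u [v [Iu Jv ->]]]; rewrite mulrDr (decomposition_mul0 Ix Jv) addr0.
  by move=> /(xreg _ Iu) ->; rewrite add0r.
have X'W i : into_rows (A n) J (row i X').
  have e : (row i X + row i Y) *m A n = 0.
    by rewrite -linearD/= -AE -row_mul (complex_comp A_min) row0.
  have := rows_cap_add (IX i) (JY i) e; rewrite XE linearZ/= -scalemxAl => e' j.
  apply: xm; last by have /rowP/(_ j) := e'; rewrite !mxE.
  have : (row i X' *m A n)^p = 0 by rewrite map_mxM (complex_residue A_min) mulmx0.
  by move=> /map_mx_eq0.
have [|ltr] := leqP r (sdim (into_rows (A n) J)).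
  move=> rW; right; split => //; exists (\det (C *m X' *m D)).
  by rewrite XE -scalemxAr -scalemxAl detZ mulrC.
left; have [W GW Wf] := sdim_free hW (leqnn _).
have fullW : (resmx (into_rows (A n) J) <= W^p)%MS.
  have WG : (W^p <= resmx (into_rows (A n) J))%MS.
    apply/row_subP => i; apply/(resmxP _ hW); exists (row i W) => //.
    by rewrite map_row.
  by rewrite -(geq_leqif (mxrank_leqif_sup WG)) (eqP Wf).
(* A row of [X'] is a combination of [W] plus a remainder of zero residue. The I-part of the
   remainder is a boundary, so [x] times it is a row of zero residue times [X]: a Nakayama argument
   with matrices then removes it. *)
have reduce i : exists cu : 'rV[R]_(sdim (into_rows (A n) J)) * 'rV[R]_(b n.+2),
    cu.2^p = 0 /\ row i X = cu.1 *m (x *: W) + cu.2 *m X.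
  have : ((row i X')^p <= W^p)%MS.
    by apply: submx_trans fullW; apply/(resmxP _ hW); exists (row i X').
  move=> /submxP[c' cE]; have [c c'E] := resmx_lift c'.
  pose z := row i X' - c *m W.
  have z0 : z^p = 0 by rewrite map_mxB map_mxM c'E cE subrr.
  have Wz : into_rows (A n) J z.
    apply: WD => //; rewrite -scaleN1r; apply: WZ.
    exact: (submod_mulmx _ hW).
  have [u [v [Iu Jv zE]]] := rows_dec z0.
  have uA : u *m A n = 0.
    apply: rows_cap; first exact: rows_in_mulmx.
    have -> : u = z + (- 1) *: v by rewrite zE scaleN1r addrK.
    by apply: WD => //; apply: WZ; apply: rows_in_mulmx.
  have [w wE] := complex_ker A_min uA.
  exists (c, x *: w); split.
    by rewrite map_mxZ (_ : p x = 0) ?scale0r//; apply: Im.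
  rewrite /= XE linearZ/= -[row i X'](subrK (c *m W)) -/z zE !scalerDr -scalemxAr addrC.
  congr (_ + _); rewrite [x *: v](_ : _ = 0) ?addr0; last first.
    by apply/rowP => j; rewrite !mxE; apply: decomposition_mul0.
  rewrite -scalemxAl -XE; congr (_ *: _).
  have wX : rows_in I (w *m X) := submod_mulmx w (rows_in_submod _ hI) IX.
  have wY : rows_in J (w *m Y) := submod_mulmx w (rows_in_submod _ hJ) JY.
  apply/eqP; rewrite -subr_eq0; apply/eqP; apply: rows_cap.
    have [_ hD hZ] := @rows_in_submod I (b n.+1) hI.
    by apply: hD => //; rewrite -scaleN1r; apply: hZ.
  by rewrite wE AE mulmxDr addrAC subrr add0r.
have [f fP] := choice reduce.
pose M : 'M[R]_(b n.+2) := \matrix_i (f i).2.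
have M0 : M^p = 0 by apply/row_matrixP => i; rewrite -map_row rowK row0; case: (fP i).
have [N [_ NM]] := residue_unitmx1B M0.
pose E := \matrix_i (f i).1.
have XE2 : X = N *m E *m (x *: W).
  rewrite -[LHS]mul1mx -NM -!mulmxA; congr (_ *m _); rewrite mulmxBl mul1mx.
  apply/row_matrixP => i; rewrite linearB/= !row_mul !rowK.
  by have [_ {1}->] := fP i; rewrite addrK.
rewrite XE2 (_ : _ *m D = (C *m (N *m E)) *m ((x *: W) *m D)); last by rewrite !mulmxA.
exact: det_mulmx_lt.
Qed.

(** As m = I + J, the square of m is m I + m J, and the J-component of an element of I is zero. *)
Lemma msq_maximal_mul z : I z -> msq z -> maximal_mul I z.
Proof.
have hmI : ideal (maximal_mul I) by exact: ideal_gen_ideal.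
have mII : maximal_mul I `<=` I.
  by apply: (ideal_gen_sub hI) => _ [u _ [v Iv <-]]; apply: (idealMl _ hI).
move=> Iz mz; suff [u [v [Iu Jv e]]] : exists u v, [/\ maximal_mul I u, J v & z = u + v].
  rewrite e (_ : v = 0) ?addr0//; apply: capIJ => //.
  have -> : v = z - u by rewrite e addrC addKr.
  by apply: (idealB hI) => //; apply: mII.
move: z mz {Iz}; apply: ideal_gen_sub; first exact: (ideal_add hmI hJ).
move=> _ [u pu [v /dec[v1 [v2 [Iv1 Jv2 ->]]] <-]].
exists (u * v1), (u * v2); rewrite mulrDr; split => //; last exact: (idealMl _ hJ).
by apply: mem_ideal_gen; exists u => //; exists v1.
Qed.

Lemma exists_free1 : (exists2 x, I x & x <> 0) -> exists2 x, I x & free1 x.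
Proof.
move=> [x0 Ix0 x0N0]; apply: contrapT => H; apply: x0N0.
have /(_ _ Ix0)// : I `<=` [set 0].
apply: (nakayama hI (@ideal_zero R)) => x Ix; exists x, 0; rewrite addr0; split => //.
apply: msq_maximal_mul => //; apply: contrapT => xm; apply: H; exists x => // c.
apply: contraPP => /p_unit[c' cE] cx; apply: xm.
by rewrite -[x]mul1r -cE (mulrC c) -mulrA; apply: (idealMl _ (ideal_gen_ideal _)).
Qed.

Lemma principal_or_free2 : (exists2 x, I x & x <> 0) ->
  (exists x, I x /\ I `<=` principal x) \/ (exists x1 x2, [/\ I x1, I x2 & free2 x1 x2]).
Proof.
move=> /exists_free1[x Ix fx].
have [|nf] := pselect (exists x1 x2, [/\ I x1, I x2 & free2 x1 x2]); first by right.
left; exists x; split => //; apply: (nakayama hI (principal_ideal x)).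
move=> y Iy.
have [c [c' [xy cc']]] : exists c c', msq (c * x + c' * y) /\ (p c <> 0 \/ p c' <> 0).
  apply: contrapT => H; apply: nf; exists x, y; split => // c c' xy.
  by apply: contrapT => cc'; apply: H; exists c, c'; split => //; exact/not_andP.
have c'N0 : p c' <> 0.
  move=> c'0; case: cc' => //; apply; apply: fx.
  rewrite -[_ * x](addrK (c' * y)); apply: (idealB (ideal_gen_ideal _) xy).
  by apply: mem_ideal_gen; exists c' => //; exists y => //; apply: Im.
have [d dE] := p_unit c'N0.
have yE : y = d * (c * x + c' * y) - d * c * x.
  by rewrite mulrDr !mulrA addrAC subrr add0r (mulrC d) dE mul1r.
have zm : msq (d * (c * x + c' * y)) by apply: (idealMl _ (ideal_gen_ideal _)).
have Iz : I (d * (c * x + c' * y)).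
  by apply: (idealMl _ hI); apply: (idealD hI); apply: (idealMl _ hI).
exists (d * (c * x + c' * y)), (- (d * c) * x); split; first exact: msq_maximal_mul.
  by exists (- (d * c)).
by rewrite {1}yE mulNr.
Qed.

(** Suppose [y] is not nilpotent and kills a nonzero [z] of I. Then [z] is divisible by every power
    of [y]: a unit quotient would make a power of [y] zero, and any other quotient gains a factor
    [y]. The stabilizing annihilators of the powers of [y] then force [z = 0]. *)
Lemma nilpotent_or_regular y : (exists2 x, I x & x <> 0) -> I y -> I `<=` principal y ->
  (forall z, I z -> y * z = 0 -> z = 0) \/
  exists t, [/\ (0 < t)%N, y ^+ t <> 0 & y ^+ t.+1 = 0].
Proof.
move=> [x Ix x0] Iy Iyp.
have [|nreg] := pselect (forall z, I z -> y * z = 0 -> z = 0); first by left.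
right; have [z [Iz [yz zN0]]] : exists z, I z /\ y * z = 0 /\ z <> 0.
  by apply: contrapT => H; apply: nreg => z Iz yz; apply: contrapT => z0; apply: H; exists z.
have [N N0] : exists N, y ^+ N = 0.
  apply: contrapT => yN.
  have [N annN] : exists N, forall n, (N <= n)%N ->
      [set r | r * y ^+ n = 0] = [set r | r * y ^+ N = 0].
    apply: (@noetherian_chain_stable R (fun n => [set r | r * y ^+ n = 0])) => // n.
      split=> [|r r' /= e e'|a r /= e]; rewrite /= ?mul0r// ?mulrDl ?e ?e' ?addr0//.
      by rewrite -mulrA e mulr0.
    by move=> r /= e; rewrite exprSr mulrA e mul0r.
  have div n : exists c, z = c * y ^+ n.+1.
    elim: n => [|n [c cE]]; first by have [c ->] := Iyp _ Iz; exists c.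
    have [pc|/p_unit[d dE]] := pselect (p c = 0).
      have [u [v [Iu Jv e]]] := dec pc.
      have [c' c'E] := Iyp _ Iu; exists c'.
      rewrite cE e mulrDl [v * _](_ : _ = 0) ?addr0; first by rewrite c'E -mulrA -exprS.
      by rewrite exprS mulrA (mulrC v) (decomposition_mul0 Iy Jv) mul0r.
    case: yN; exists n.+2; transitivity (d * (y * z)); last by rewrite yz mulr0.
    by rewrite cE [y * (c * _)]mulrCA [d * (c * _)]mulrA [d * c]mulrC dE mul1r -exprS.
  have [c cE] := div N; apply: zN0.
  have : [set r | r * y ^+ N.+2 = 0] c by rewrite /= exprS mulrCA -cE.
  by rewrite annN ?leqW//= => e; rewrite cE exprSr mulrA e mul0r.
have exN : exists n, y ^+ n == 0 by exists N; apply/eqP.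
case: (ex_minnP exN) => -[|[|t]] /eqP yt tmin.
- by move/eqP: yt; rewrite expr0 oner_eq0.
- by case: x0; have [c ->] := Iyp _ Ix; rewrite -[y]expr1 yt mulr0.
exists t.+1; split => // yt'.
by have := tmin t.+1; rewrite yt' eqxx ltnn => /(_ isT).
Qed.

End Side.

Section Pair.
Variables I J : set R.
Hypothesis IJ : maximal_decomposition I J.
Hypothesis I_n0 : exists2 x, I x & x <> 0.
Hypothesis J_n0 : exists2 x, J x & x <> 0.

Let JI := maximal_decompositionC IJ.

Local Notation "'beta' n" := (sdim (into_rows (A n) J)) (at level 10, n at level 9).
Local Notation "'alpha' n" := (sdim (into_rows (A n) I)) (at level 10, n at level 9).

Lemma decomposition_growth_periodic r : (0 < r)%N ->
  (exists n0, forall n, (n0 <= n)%N -> (r <= alpha n)%N /\ (r <= beta n)%N) ->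
  minors_periodic A r.
Proof.
move=> r0 [n0 big]; apply: (full_minors_periodic A_min (n0 := n0.+1)) => -[//|n] nn f fm.
have [ra rb] := big n nn.
have dec_f i : exists xy : R * R, [/\ I xy.1, J xy.2 & f i = xy.1 + xy.2].
  case: IJ => _ _ _ _ [_ dec]; have [x [y ?]] := dec _ (fm i); by exists (x, y).
have [g gE] := choice dec_f.
have -> : \prod_i f i = \prod_i (g i).1 + \prod_i (g i).2.
  rewrite -prod_add_orthogonal// => [|i j].
    by apply: eq_bigr => i _; case: (gE i).
  by apply: (decomposition_mul0 IJ); [case: (gE i)|case: (gE j)].
apply: (idealD (minors_ideal_ideal _ _)).
  by apply: (minors_ideal_prod_into IJ) => // i; case: (gE i).
by apply: (minors_ideal_prod_into JI) => // i; case: (gE i).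
Qed.

Lemma alpha_beta n x : I x -> free1 x -> (beta n <= alpha n.+1)%N.
Proof. by move=> Ix fx; apply: (into_rows_sdim_growth1 IJ n Ix fx). Qed.

Lemma beta_alpha n x : J x -> free1 x -> (alpha n <= beta n.+1)%N.
Proof. by move=> Jx fx; apply: (into_rows_sdim_growth1 JI n Jx fx). Qed.

Lemma alpha_beta_gt0 n : (0 < alpha n.+1)%N \/ (0 < beta n.+1)%N.
Proof.
have [hI hJ _ _ _] := IJ.
have [u [v [Iu Jv e]]] := into_rows_dec IJ (delta_mx 0 (Ordinal (b_gt0 n.+2))).
have [u0|u0] := pselect (u^p = 0); last first.
  by left; apply/(sdim_gt0 (into_rows_submod _ hI)); exists u.
right; apply/(sdim_gt0 (into_rows_submod _ hJ)); exists v => // v0.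
have : (delta_mx 0 (Ordinal (b_gt0 n.+2)) : 'rV[R]__)^p = 0.
  by rewrite e map_mxD u0 v0 addr0.
move=> /map_mx_eq0/(_ 0 (Ordinal (b_gt0 n.+2))); rewrite mxE !eqxx rmorph1 => /eqP.
by rewrite oner_eq0.
Qed.

Lemma decomposition_free2_periodic r y1 y2 : (0 < r)%N ->
  J y1 -> J y2 -> free2 y1 y2 -> minors_periodic A r.
Proof.
move=> r0 Jy1 Jy2 fy; apply: decomposition_growth_periodic => //.
have [x Ix fx] := exists_free1 IJ I_n0.
have ab n : (beta n <= alpha n.+1)%N by apply: alpha_beta fx.
have ba n : (2 * alpha n <= beta n.+1)%N by apply: (into_rows_sdim_growth2 JI n Jy1 Jy2 fy).
have [n an] : exists n, (0 < alpha n)%N.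
  have [a1|b1] := alpha_beta_gt0 0; first by exists 1%N.
  by exists 2%N; apply: leq_trans b1 (ab _).
(* The inequalities [ab] and [ba] alone would let [alpha] and [beta] vanish alternately; the Koszul
   relation makes both positive at one index, after which each at least doubles every two steps. *)
have bn := into_rows_koszul JI Jy1 Jy2 fy an.
have [n0 n0P] : exists n0, (0 < alpha n0)%N && (0 < beta n0)%N.
  exists n.+2; rewrite bn andbT; apply: leq_trans (ab _).
  by apply: leq_trans (ba _); rewrite muln_gt0.
elim: {r0} r => [|r [n1 n1P]]; first by exists 0%N.
exists (maxn n0 n1).+2 => -[|[|i]] // ni.
have {}ni : (maxn n0 n1 <= i)%N := ni.
have n0i : (0 < alpha i)%N && (0 < beta i)%N.
  have : (n0 <= i)%N by apply: leq_trans ni; rewrite leq_maxl.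
  move=> /subnK <-; elim: (i - n0)%N => // j /andP[aj bj]; rewrite addSn.
  rewrite (leq_trans bj)//=; apply: leq_trans (ba _); by rewrite muln_gt0.
have [|ra rb] := n1P i; first by apply: leq_trans ni; rewrite leq_maxr.
have a2 := leq_trans (ba i) (ab i.+1).
have b2 := leq_trans (leq_mul (leqnn 2) (ab i)) (ba i.+1).
move: n0i => /andP[a0 b0]; split.
  apply: leq_trans a2; rewrite mul2n -addnn; rewrite -addn1; exact: leq_add.
apply: leq_trans b2; rewrite mul2n -addnn; rewrite -addn1; exact: leq_add.
Qed.

(** The bounds squeeze: [beta] is at least the rank [b n.+1], which is at least the preceding
    [alpha] plus [beta], and [alpha] is eventually positive; so [beta] increases strictly, and
    [alpha] follows one step later. *)
Lemma decomposition_nilpotent_periodic r y t : (0 < r)%N ->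
  J y -> J `<=` principal y -> (0 < t)%N -> y ^+ t <> 0 -> y ^+ t.+1 = 0 ->
  minors_periodic A r.
Proof.
move=> r0 Jy Jyp t0 yt yt1; apply: decomposition_growth_periodic => //.
have [x Ix fx] := exists_free1 IJ I_n0.
have ab n : (beta n <= alpha n.+1)%N by apply: alpha_beta fx.
have bb n : (b n.+1 <= beta n.+1)%N by apply: (into_rows_sdim_nilpotent IJ n Jyp Jy t0 yt yt1).
have sum n : (alpha n + beta n <= b n.+1)%N by apply: into_rows_sdim_add.
have a0 n : (0 < alpha n.+2)%N.
  by apply: leq_trans (ab _); apply: leq_trans (bb _); apply: b_gt0.
have grow n : (beta n.+2 < beta n.+3)%N.
  apply: leq_trans (bb _); apply: leq_trans (sum _).
  by rewrite -[X in (X < _)%N]add0n ltn_add2r.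
have big n : (n <= beta n.+2)%N.
  by elim: n => // n IH; apply: leq_ltn_trans IH (grow n).
exists r.+3 => -[|[|[|n]]]// rn; have {}rn : (r <= n)%N := rn; split; last first.
  by apply: leq_trans (big _); apply: leqW.
by apply: leq_trans (ab _); apply: leq_trans (big _).
Qed.

Lemma decomposition_regular_periodic r x y : (0 < r)%N ->
  I x -> I `<=` principal x -> (forall z, I z -> x * z = 0 -> z = 0) ->
  J y -> J `<=` principal y -> (forall z, J z -> y * z = 0 -> z = 0) ->
  minors_periodic A r.
Proof.
move=> r0 Ix Ixp xreg Jy Jyp yreg.
have [x' Ix' fx] := exists_free1 IJ I_n0; have [y' Jy' fy] := exists_free1 JI J_n0.
have bb n : (beta n <= beta n.+2)%N.
  by apply: leq_trans (alpha_beta n Ix' fx) (beta_alpha n.+1 Jy' fy).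
have aa n : (alpha n <= alpha n.+2)%N.
  by apply: leq_trans (beta_alpha n Jy' fy) (alpha_beta n.+1 Ix' fx).
have [hI hJ _ _ _] := IJ.
apply: (ascending_minors_periodic (n0 := 1%N)) => -[//|n _].
have dec_row i : exists uv : 'rV[R]_(b n.+1) * 'rV[R]_(b n.+1),
    [/\ rows_in I uv.1, rows_in J uv.2 & row i (A n.+1) = uv.1 + uv.2].
  have [|u [v ?]] := rows_dec IJ (v := row i (A n.+1)); last by exists (u, v).
  by rewrite map_row (complex_residue A_min) row0.
have [f fP] := choice dec_row.
pose X := \matrix_i (f i).1; pose Y := \matrix_i (f i).2.
have AE : A n.+1 = X + Y.
  by apply/row_matrixP => i; rewrite linearD/= !rowK; case: (fP i).
have IX i : rows_in I (row i X) by rewrite rowK; case: (fP i).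
have JY i : rows_in J (row i Y) by rewrite rowK; case: (fP i).
apply: minors_ideal_sub; first exact: minors_ideal_ideal.
move=> C D; rewrite AE mulmxDr mulmxDl det_add_orthogonal//; last first.
  have IXD i j : I ((C *m X *m D) i j).
    have := rows_in_mulmx D hI (submod_mulmx (row i C) (rows_in_submod _ hI) IX) j.
    by rewrite -!row_mul mxE.
  have JYD i j : J ((C *m Y *m D) i j).
    have := rows_in_mulmx D hJ (submod_mulmx (row i C) (rows_in_submod _ hJ) JY) j.
    by rewrite -!row_mul mxE.
  by move=> i j i' j'; apply: (decomposition_mul0 IJ).
have hM := minors_ideal_ideal (A n.+3) r.
apply: (idealD hM).
  have [->|[rb [c ->]]] := minors_side_sub IJ r0 Ix Ixp xreg AE IX JY C D.
    exact: ideal0.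
  apply: (idealMl _ hM); rewrite -(card_ord r) -prodr_const card_ord.
  by apply: (minors_ideal_prod_into IJ) => //; apply: leq_trans rb (bb n).
have AE' : A n.+1 = Y + X by rewrite addrC.
have [->|[ra [c ->]]] := minors_side_sub JI r0 Jy Jyp yreg AE' JY IX C D.
  exact: ideal0.
apply: (idealMl _ hM); rewrite -(card_ord r) -prodr_const card_ord.
by apply: (minors_ideal_prod_into JI) => //; apply: leq_trans ra (aa n).
Qed.

End Pair.

Lemma decomposition_periodic I J r : maximal_decomposition I J ->
  (exists2 x, I x & x <> 0) -> (exists2 x, J x & x <> 0) -> (0 < r)%N ->
  minors_periodic A r.
Proof.
move=> IJ I0 J0 r0; have JI := maximal_decompositionC IJ.
have [[x [Ix Ixp]]|[x1 [x2 [Ix1 Ix2 fx]]]] := principal_or_free2 IJ I0; last first.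
  exact: (decomposition_free2_periodic JI J0 r0 Ix1 Ix2 fx).
have [[y [Jy Jyp]]|[y1 [y2 [Jy1 Jy2 fy]]]] := principal_or_free2 JI J0; last first.
  exact: (decomposition_free2_periodic IJ I0 r0 Jy1 Jy2 fy).
have [xreg|[t [t0 xt xt1]]] := nilpotent_or_regular IJ I0 Ix Ixp; last first.
  exact: (decomposition_nilpotent_periodic JI J0 r0 Ix Ixp t0 xt xt1).
have [yreg|[t [t0 yt yt1]]] := nilpotent_or_regular JI J0 Jy Jyp; last first.
  exact: (decomposition_nilpotent_periodic IJ I0 r0 Jy Jyp t0 yt yt1).
exact: (decomposition_regular_periodic IJ I0 J0 r0 Ix Ixp xreg Jy Jyp yreg).
Qed.

End FiberProduct.

(** I and J are the kernels of the projections to [T] and to [S]; they are nonzero because neither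
    factor is its residue field. *)
Lemma fiber_product_decomposition : fiber_product_ring R ->
  exists I J, [/\ maximal_decomposition I J, exists2 x, I x & x <> 0
    & exists2 x, J x & x <> 0].
Proof.
move=> [S [T [mS [mT [k' [pS [pT [[noeS hS rS] [noeT hT rT] nS nT [phi phi_inj phi_im]]]]]]]]].
pose I : set R := [set r | (phi r).2 = 0]; pose J : set R := [set r | (phi r).1 = 0].
have im s t : pS s = pT t -> exists r, phi r = (s, t).
  move=> st; have : [set st | pS st.1 = pT st.2] (s, t) by [].
  by rewrite -phi_im => -[r _ <-]; exists r.
exists I, J; split; last 2 first.
- have [s s0 sN0] := rmorphism_iso_residue rS nS.
  have [|x xE] := im s 0; first by rewrite s0 rmorph0.
  by exists x; rewrite /I /= ?xE// => x0; apply: sN0; move: xE; rewrite x0 rmorph0 => -[].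
- have [t t0 tN0] := rmorphism_iso_residue rT nT.
  have [|x xE] := im 0 t; first by rewrite t0 rmorph0.
  by exists x; rewrite /J /= ?xE// => x0; apply: tN0; move: xE; rewrite x0 rmorph0 => -[].
split.
- split=> [|x y|a x]; rewrite /I /= ?rmorph0//.
    by move=> x0 y0; rewrite rmorphD /= x0 y0 addr0.
  by move=> x0; rewrite rmorphM /= x0 mulr0.
- split=> [|x y|a x]; rewrite /J /= ?rmorph0//.
    by move=> x0 y0; rewrite rmorphD /= x0 y0 addr0.
  by move=> x0; rewrite rmorphM /= x0 mulr0.
- move=> x; rewrite /I /= => x0; apply: contrapT => /p_unit[x' xx'].
  have := congr1 (fun z => (phi z).2) xx'; rewrite rmorphM rmorph1 /= x0 mul0r => /esym/eqP.
  by rewrite oner_eq0.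
- move=> x; rewrite /J /= => x0; apply: contrapT => /p_unit[x' xx'].
  have := congr1 (fun z => (phi z).1) xx'; rewrite rmorphM rmorph1 /= x0 mul0r => /esym/eqP.
  by rewrite oner_eq0.
split=> [x Ix Jx|z z0].
  apply: phi_inj; rewrite rmorph0; move: Ix Jx; rewrite /I /J /=.
  by case: (phi x) => s t /= -> ->.
have zE : pS (phi z).1 = pT (phi z).2.
  have : (range phi) (phi z) by exists z.
  by rewrite phi_im.
(* The field [k] is given independently of [k']. A pair with nonzero image in [k'] has both
   components invertible, and the pair of inverses again belongs to the fiber product, so [z] would
   be a unit of [R]. *)
have s0 : pS (phi z).1 = 0.
  apply: contrapT => s0; have t0 := s0; rewrite zE in t0.
  have [s' ss'] := residue_local_unit noeS hS rS s0.
  have [t' tt'] := residue_local_unit noeT hT rT t0.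
  have [|r rE] := im s' t'.
    have /(congr1 pS) := ss'; have /(congr1 pT) := tt'; rewrite !rmorphM !rmorph1.
    rewrite -zE => e1 e2; apply: (@mulfI _ (pS (phi z).1)); first exact/eqP.
    by rewrite e1 e2.
  have /(congr1 p) : z * r = 1.
    apply: phi_inj; rewrite rmorphM rmorph1 rE.
    by case: (phi z) ss' tt' => s t /= ss' tt'; rewrite -[RHS]/(1, 1) -ss' -tt'.
  by rewrite rmorphM z0 mul0r rmorph1 => /esym/eqP; rewrite oner_eq0.
have [|x xE] := im (phi z).1 0; first by rewrite s0 rmorph0.
exists x, (z - x); split; rewrite /I /J /= ?xE//.
  by rewrite rmorphB /= xE subrr.
by rewrite addrC subrK.
Qed.

(** * The structure of stretched Gorenstein rings *)

Lemma ideal_setT : ideal [set: R]. Proof. by split. Qed.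

Lemma ideal_pow_ideal n : ideal (pow n).
Proof. by case: n => [|n]; [apply: ideal_setT|apply: ideal_gen_ideal]. Qed.

Lemma ideal_pow_mul n a z : p a = 0 -> pow n z -> pow n.+1 (a * z).
Proof. by move=> a0 zn; apply: mem_ideal_gen; exists a => //; exists z. Qed.

Lemma ideal_pow1 : pow 1 = mm.
Proof.
apply/seteqP; split; last by move=> x x0; rewrite -(mulr1 x); apply: ideal_pow_mul.
apply: (ideal_gen_sub (residue_ideal)) => _ [u u0 [v _ <-]].
exact: (idealMr _ (residue_ideal)).
Qed.

Lemma ideal_pow_leS n : pow n.+1 `<=` pow n.
Proof.
apply: (ideal_gen_sub (ideal_pow_ideal n)) => _ [u _ [v vn <-]].
exact: (idealMl _ (ideal_pow_ideal n)).
Qed.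

Lemma ideal_pow_eq0_leq i j : (i <= j)%N -> pow i = [set 0] -> pow j = [set 0].
Proof.
move=> /subnK <- i0; elim: (j - i)%N => // n IH; apply/seteqP; split.
  by apply: subset_trans (@ideal_pow_leS _) _; rewrite IH.
by move=> _ ->; apply: ideal0; apply: ideal_pow_ideal.
Qed.

Lemma ideal_pow_stable0 n j : pow j = pow j.+1 -> pow n = [set 0] -> pow j = [set 0].
Proof.
move=> e n0; have st i : pow (i + j) = pow j.
  elim: i => // i IH; rewrite addSn.
  by rewrite -[LHS]/(ideal_mul mm (pow (i + j))) IH -[LHS]/(pow j.+1).
have [nj|/ltnW jn] := leqP n j; first exact: ideal_pow_eq0_leq nj n0.
by rewrite -(st (n - j)%N) subnK.
Qed.

(** Take [t] in the last power of the maximal ideal that is not contained in [D]. *)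
Lemma exists_socle_mod (D : set R) n : pow n = [set 0] -> ideal D -> ~ D 1 ->
  exists2 t, ~ D t & forall a, p a = 0 -> D (a * t).
Proof.
move=> n0 hD D1.
have [j [jD jND]] : exists j, pow j.+1 `<=` D /\ ~ (pow j `<=` D).
  apply: contrapT => H.
  have H' j : ~ (pow j `<=` D).
    by elim: j => [DT|j jD jD']; [apply: D1; apply: DT|apply: H; exists j].
  by apply: (H' n); rewrite n0 => _ ->; apply: ideal0.
have [t tj tD] : exists2 t, pow j t & ~ D t.
  by apply: contrapT => H; apply: jND => t tj; apply: contrapT => tD; apply: H; exists t.
by exists t => // a a0; apply: jD; apply: ideal_pow_mul.
Qed.

(** * Baer's criterion along an injective resolution, and the socle *)

Section Extension.
Variable nil : nat.
Hypothesis m_nil : ideal_pow [set u : R | p u = 0] nil = [set 0].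

(** Baer's criterion relative to [C]: every linear map from an ideal of [R] to [C] is multiplication
    by an element of [C]. *)
Definition extension_property (E : lmodType R) (C : set E) :=
  forall G : set (R * E)%type, linear_graph G -> (forall r e, G (r, e) -> C e) ->
  exists2 c, C c & forall r e, G (r, e) -> e = r *: c.

Section OneModule.
Variables (E : lmodType R) (C : set E).
Hypothesis hC : submod C.

(** Maximality concerns the domain, which is an ideal, so that noetherianity takes the place of
    Zorn's lemma. *)
Lemma maximal_graph (G : set (R * E)%type) :
  linear_graph G -> (forall r e, G (r, e) -> C e) ->
  exists G', [/\ linear_graph G', forall r e, G' (r, e) -> C e, G `<=` G'
    & forall G'', linear_graph G'' -> (forall r e, G'' (r, e) -> C e) ->
        G' `<=` G'' -> graph_dom G'' `<=` graph_dom G'].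
Proof.
move=> hG GC; pose ext (H : set (R * E)%type) :=
  [/\ linear_graph H, forall r e, H (r, e) -> C e & G `<=` H].
have [||_ [[H [hH HC GH] <-] _ Hmax]] :=
  @noetherian_maximal R [set graph_dom H | H in ext] (graph_dom G) R_noeth.
- by move=> _ [H [hH _ _] <-]; apply: graph_dom_ideal.
- by exists G => //; split.
exists H; split => // G' hG' G'C HG'; apply: Hmax; last by move=> r [e He]; exists e; apply: HG'.
by exists G' => //; split => //; apply: subset_trans HG'.
Qed.

(** If a maximal graph has a proper domain, pick [t] outside it with m t inside. The map sending [a]
    in m to the value at [a * t] is induced by some [c], and declaring [c] to be the value at [t]
    extends the graph. *)
Lemma extension_property_maximal_ideal :
  (forall G : set (R * E)%type, linear_graph G -> (forall r e, G (r, e) -> C e) ->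
    (forall r, graph_dom G r <-> p r = 0) ->
    exists2 c, C c & forall r e, G (r, e) -> e = r *: c) ->
  extension_property C.
Proof.
move=> ext G0 hG0 G0C; have [G [hG GC G0G Gmax]] := maximal_graph hG0 G0C.
suff [c cC cE] : exists2 c, C c & forall r e, G (r, e) -> e = r *: c.
  by exists c => // r e /G0G; apply: cE.
have hD := graph_dom_ideal hG.
have [[G00 GD GZ] Gf] := hG.
have [[c Gc]|D1] := pselect (graph_dom G 1).
  exists c; first exact: GC Gc.
  move=> r e Ge; apply: (linear_graph_fun hG Ge).
  by have := linear_graphZ r hG Gc; rewrite mulr1.
have [t tD mt] := exists_socle_mod m_nil hD D1.
pose Gm := [set ae : R * E | p ae.1 = 0 /\ G (ae.1 * t, ae.2)].
have hGm : linear_graph Gm.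
  split; last by move=> e [_ /=]; rewrite mul0r; apply: Gf.
  split=> [|[a e] [a' e'] [/= a0 Ge] [/= a'0 Ge']|c [a e] [/= a0 Ge]]; split => /=.
  - by rewrite rmorph0.
  - by rewrite mul0r.
  - by rewrite rmorphD a0 a'0 addr0.
  - by rewrite mulrDl; apply: (GD _ _ Ge Ge').
  - by rewrite rmorphM a0 mulr0.
  - by rewrite -mulrA; apply: (GZ c _ Ge).
have [|r|c cC cE] := ext Gm hGm; first by move=> r e [_ /= /GC].
  split=> [[e []]//|r0]; have [e Ge] := mt _ r0.
  by exists e.
pose G' := [set se : R * E | exists a r e, G (r, e) /\ se = (r + a * t, e + a *: c)].
have hG' : linear_graph G'.
  split; last first.
    move=> x [a [r [e [Ge [/esym/eqP]]]]]; rewrite addrC addr_eq0 => /eqP atr ->.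
    have GN : G (- r, - e) by have := linear_graphZ (-1) hG Ge; rewrite mulN1r scaleN1r.
    have [a0|/p_unit[a' aa']] := pselect (p a = 0); last first.
      case: tD; exists (a' *: - e); rewrite (_ : t = a' * - r); first exact: (linear_graphZ a' hG GN).
      by rewrite -atr mulrA (mulrC a') aa' mul1r.
    rewrite -(cE a (- e)) ?subrr//; split => //=.
    by rewrite atr.
  split.
  - by exists 0, 0, 0; rewrite mul0r scale0r !addr0.
  - move=> _ _ [a [r [e [Ge ->]]]] [a' [r' [e' [Ge' ->]]]].
    exists (a + a'), (r + r'), (e + e'); split; first exact: (GD _ _ Ge Ge').
    by rewrite -[LHS]/(r + a * t + (r' + a' * t), e + a *: c + (e' + a' *: c))
      addrACA mulrDl [in X in (_, X)]addrACA scalerDl.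
  - move=> b _ [a [r [e [Ge ->]]]]; exists (b * a), (b * r), (b *: e).
    split; first exact: (GZ b _ Ge).
    by rewrite -[LHS]/(b * (r + a * t), b *: (e + a *: c)) mulrDr mulrA scalerDr scalerA.
case: tD; apply: (Gmax G' hG').
- move=> s f [a [r [e [/GC eC [_ ->]]]]].
  by case: hC => _ CD CZ; apply: CD => //; apply: CZ.
- by move=> [r e] Ge; exists 0, r, e; rewrite mul0r scale0r !addr0.
- by exists c; exists 1, 0, 0; rewrite mul1r scale1r !add0r.
Qed.

End OneModule.

Lemma extension_property_injective (E : lmodType R) :
  injective_module E -> extension_property [set: E].
Proof.
by move=> E_inj G hG _; have [c cE] := injective_module_graph hG E_inj; exists c.
Qed.

Lemma kernel_submod (U V : lmodType R) (f : {linear U -> V}) : submod (kernel f).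
Proof.
split=> [|u v|a u]; rewrite /kernel /= ?linear0//.
  by move=> fu fv; rewrite linearD fu fv addr0.
by move=> fu; rewrite linearZ_LR fu scaler0.
Qed.

(* Here [s] spans the socle: a map defined on the maximal ideal with values in
   [kernel d] is induced by some [z], and [s R -> E'], [s |-> d z], is well defined. *)
Lemma extension_property_step (E E' : lmodType R) (d : {linear E -> E'}) :
  injective_module E -> extension_property (range d) -> extension_property (kernel d).
Proof.
move=> E_inj ext; apply: (extension_property_maximal_ideal (kernel_submod d)).
move=> G hG GC Gdom; have [z zE] := injective_module_graph hG E_inj.
have [s sN0 ms] : exists2 s : R, ~ [set 0] s & forall a, p a = 0 -> [set 0] (a * s).
  apply: (exists_socle_mod m_nil).
    exact: ideal_zero.
  by move=> /eqP; rewrite oner_eq0.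
have mz a : p a = 0 -> a *: d z = 0.
  move=> /Gdom[e Ge]; rewrite -linearZ_LR -(zE _ _ Ge); exact: (GC _ _ Ge).
pose H := [set rf : R * E' | exists a, rf = (a * s, a *: d z)].
have hH : linear_graph H.
  split; last first.
    move=> e [a [/esym as0 ->]]; apply: mz; apply: contrapT => /p_unit[a' aa'].
    by apply: sN0; rewrite /= -(mul1r s) -aa' mulrAC as0 mul0r.
  split; first by exists 0; rewrite mul0r scale0r.
  - move=> _ _ [a ->] [a' ->]; exists (a + a').
    by rewrite mulrDl scalerDl.
  - by move=> c _ [a ->]; exists (c * a); rewrite -mulrA -scalerA.
have [r _ [a [_ ->]]|_ [e' _ <-] cE] := ext H hH.
  by exists (a *: z); rewrite ?linearZ_LR.
have dz : d z = s *: d e' by apply: cE; exists 1; rewrite mul1r scale1r.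
exists (z - s *: e').
  by rewrite /kernel /= linearB dz linearZ_LR subrr.
move=> a e Ge; rewrite scalerBr -(zE _ _ Ge) scalerA.
have -> : a * s = 0 by apply: ms; apply/Gdom; exists e.
by rewrite scale0r subr0.
Qed.

(* Dimension shifting along a finite injective resolution, from its end. *)
Lemma gorenstein_extension : gorenstein R ->
  extension_property ([set: R^o] : set (R^o : lmodType R)).
Proof.
move=> [E [d [eta [N [[eta_inj eta_im ex] E_inj E0]]]]].
have ext j : extension_property (kernel (d j)).
  have [|jN] := leqP N j.
    move=> Nj; have -> : kernel (d j) = setT.
      by rewrite -subTset => x _; apply: E0; apply: leq_ltn_trans Nj _.
    exact: extension_property_injective.
  have [n] : exists n, (j + n = N)%N by exists (N - j)%N; rewrite subnKC// ltnW.
  elim: n j {jN} => [|n IH] j jn.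
    have -> : kernel (d j) = setT.
      by rewrite -subTset => x _; apply: E0; rewrite -jn addn0.
    exact: extension_property_injective.
  by apply: extension_property_step => //; rewrite ex; apply: IH; rewrite addSnnS.
move=> G hG _.
pose G' := [set re : R * E 0%N | exists2 s, G (re.1, s) & re.2 = eta s].
have [[G0 GD GZ] Gf] := hG.
have hG' : linear_graph G'.
  split; last by move=> e [s /= /Gf -> ->]; rewrite linear0.
  split; first by exists 0; rewrite ?linear0.
  - move=> [r e] [r' e'] [s /= Gs ->] [s' /= Gs' ->]; exists (s + s').
      exact: (GD _ _ Gs Gs').
    by rewrite linearD.
  - move=> a [r e] [s /= Gs ->]; exists (a *: s); first exact: (GZ a _ Gs).
    by rewrite linearZ_LR.
have [r e [s _ /= ->]|c] := ext 0%N _ hG'.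
  by rewrite -eta_im; exists s.
rewrite -eta_im => -[c0 _ <-] cE; exists c0 => // r e Ge.
by apply: eta_inj; rewrite linearZ_LR; apply: cE; exists e.
Qed.

(** If [z'] were not a multiple of [z], the map killing [z] and sending [z'] to [z] would be
    multiplication by some [c]. As [z * c = 0], [c] is not a unit, so it kills the socle element
    [z'] and [z = 0]. *)
Lemma gorenstein_socle z z' : gorenstein R -> z <> 0 ->
  (forall a, p a = 0 -> a * z = 0) -> (forall a, p a = 0 -> a * z' = 0) ->
  exists c, z' = c * z.
Proof.
move=> gR z0 mz mz'; apply: contrapT => zz'.
pose G := [set rs : R * (R^o : lmodType R) | exists a b, rs = (a * z + b * z', b * z)].
have hG : linear_graph G.
  split; last first.
    move=> e [a [b [/esym/eqP]]]; rewrite addrC addr_eq0 => /eqP e0 ->; apply: mz.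
    apply: contrapT => /p_unit[b' bb']; apply: zz'; exists (- (b' * a)).
    by rewrite -[z']mul1r -bb' mulrAC mulrC e0 mulNr mulrN mulrA.
  split; first by exists 0, 0; rewrite !mul0r addr0.
  - move=> _ _ [a [b ->]] [a' [b' ->]]; exists (a + a'), (b + b').
    by rewrite !mulrDl addrACA.
  - move=> c _ [a [b ->]]; exists (c * a), (c * b).
    by rewrite -!mulrA -mulrDr.
have [//|c _ cE] := gorenstein_extension gR hG.
have zc : 0 = z * c by apply: cE; exists 1, 0; rewrite !mul0r mul1r addr0.
have z'c : z = z' * c by apply: cE; exists 0, 1; rewrite !mul1r mul0r add0r.
apply: (z0); rewrite z'c mulrC; apply: mz'; apply: contrapT => /p_unit[c' cc'].
by apply: z0; rewrite -(mulr1 z) -cc' mulrA -zc mul0r.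
Qed.

End Extension.

(** * Length counts in stretched rings *)

Lemma nakayama_maximal (s : seq R) : (forall x, x \in s -> p x = 0) ->
  (forall u, p u = 0 -> exists h v, [/\ ideal_gen [set` s] h, pow 2 v & u = h + v]) ->
  mm = ideal_gen [set` s].
Proof.
move=> sm dec; apply/seteqP; split; last first.
  by apply: (ideal_gen_sub (residue_ideal)) => x; apply: sm.
apply: (nakayama (residue_ideal) (ideal_gen_ideal _)) => u /dec.
move=> [h [v [hh vv ->]]]; exists v, h; split => //; last by rewrite addrC.
by move: vv; rewrite -[pow 2]/(ideal_mul mm (pow 1)) ideal_pow1.
Qed.

(** Start from m^2 and add elements of m one at a time: with fewer than [e] of them the ideal cannot
    be all of m, by Nakayama and the minimality of [e]. *)
Lemma chain_embdim e : min_num_gens mm e ->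
  exists2 J, chain_between (pow 2) J e & J `<=` mm.
Proof.
move=> [_ e_min].
suff H t : (t <= e)%N -> exists s : seq R,
    [/\ size s = t, forall x, x \in s -> p x = 0 & chain_between (pow 2)
      [set z | exists x y, [/\ ideal_gen [set` s] x, pow 2 y & z = x + y]] t].
  have [s [_ sm ch]] := H e (leqnn _).
  exists [set z | exists x y, [/\ ideal_gen [set` s] x, pow 2 y & z = x + y]] => //.
  move=> _ [x [y [xs y2 ->]]].
  apply: (idealD (residue_ideal)).
    by move: x xs; apply: (ideal_gen_sub (residue_ideal)) => x; apply: sm.
  by rewrite -ideal_pow1; apply: ideal_pow_leS.
elim: t => [_|t IH te]; last first.
  have [s [st sm ch]] := IH (ltnW te).
  pose J := [set z | exists x y, [/\ ideal_gen [set` s] x, pow 2 y & z = x + y]].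
  have hJ : ideal J by exact: (ideal_add (ideal_gen_ideal _) (ideal_pow_ideal 2)).
  have [z zm zJ] : exists2 z, p z = 0 & ~ J z.
    apply: contrapT => H.
    suff /e_min : mm = ideal_gen [set` s] by rewrite st leqNgt te.
    apply: nakayama_maximal => // u um; apply: contrapT => uJ; apply: H; exists u => //.
  exists (z :: s); split => //=; first by rewrite st.
  - by move=> x; rewrite inE => /orP[/eqP->|/sm].
  apply: chain_between_snoc ch _ _.
    exact: (ideal_add (ideal_gen_ideal _) (ideal_pow_ideal 2)).
  split.
    move=> _ [x [y [xs y2 ->]]]; exists x, y; split => //.
    move: x xs; apply: ideal_gen_sub; first exact: ideal_gen_ideal.
    by move=> x xs; apply: mem_ideal_gen; rewrite /= inE xs orbT.
  move=> /(_ z) H; apply: zJ; apply: H; exists z, 0; rewrite addr0; split => //.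
    by apply: mem_ideal_gen; rewrite /= inE eqxx.
  exact: ideal0 (ideal_pow_ideal 2).
exists [::]; split => //.
have -> : [set z | exists x y, [/\ ideal_gen [set` [::]] x, pow 2 y & z = x + y]] = pow 2.
  apply/seteqP; split; last first.
    by move=> y y2; exists 0, y; rewrite add0r; split => //; apply: ideal0; apply: ideal_gen_ideal.
  move=> _ [x [y [x0 y2 ->]]]; apply: (idealD (ideal_pow_ideal 2)) => //.
  by move: x x0; apply: (ideal_gen_sub (ideal_pow_ideal 2)).
exact: chain_between0 (ideal_pow_ideal 2).
Qed.

Lemma proper_subset_intro (I J : set R) x : I `<=` J -> J x -> ~ I x -> I `<` J.
Proof. by move=> IJ Jx Ix; split => // /(_ x Jx). Qed.

(* An ideal strictly between [m^3] and [m^2] would refine the chain through the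
   powers of [m] and a minimal set of generators beyond the length. *)
Lemma stretched_square i l e : has_length R l -> min_num_gens mm e -> l = (e + i)%N ->
  pow i.+1 = [set 0] -> (forall j, pow j.+1 = [set 0] -> (i <= j)%N) -> (2 <= i)%N ->
  forall z, pow 2 z -> ~ pow 3 z -> pow 2 `<=` principal z.
Proof.
move=> [_ l_max] e_min lE powi i_min i2 z z2 z3.
have strict j : (0 < j)%N -> (j <= i)%N -> pow j.+1 `<` pow j.
  move=> j0 ji; split; first exact: ideal_pow_leS.
  move=> jj; have : pow j = [set 0].
    by apply: (ideal_pow_stable0 (n := i.+1)) => //; apply/seteqP; split => //; apply: ideal_pow_leS.
  by case: j j0 ji {jj} => // j _ ji /i_min; rewrite leqNgt ji.
(* From m^(i+1) = 0 up to m^3 the powers of m give [i - 2] strict inclusions. *)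
have low j : (j <= i - 2)%N -> chain_between (pow i.+1) (pow (i.+1 - j)) j.
  elim: j => [|j IH] ji; first by rewrite subn0; apply: chain_between0; apply: ideal_pow_ideal.
  apply: (chain_between_snoc (IH (ltnW ji))); first exact: ideal_pow_ideal.
  have ji1 : (j <= i)%N by apply: leq_trans (leq_trans (leqnSn _) ji) (leq_subr _ _).
  have -> : (i.+1 - j = (i.+1 - j.+1).+1)%N by rewrite subSS subSn.
  by apply: strict; rewrite subSS ?leq_subr// subn_gt0; apply: leq_trans ji (leq_subr _ _).
have {low} := low (i - 2)%N (leqnn _).
have -> : (i.+1 - (i - 2) = 3)%N.
  by rewrite subSn ?leq_subr// subKn.
move=> ch3.
have h2 := ideal_pow_ideal 2; have h3 := ideal_pow_ideal 3.
pose J := [set w | exists x y, [/\ principal z x, pow 3 y & w = x + y]].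
have hJ : ideal J by apply: ideal_add => //; apply: principal_ideal.
have J3 : pow 3 `<` J.
  apply: (proper_subset_intro (x := z)) => // [y y3|].
    by exists 0, y; rewrite add0r; split => //; exists 0; rewrite mul0r.
  by exists z, 0; rewrite addr0; split; [exists 1; rewrite mul1r| exact: ideal0|].
have J2 : J `<=` pow 2.
  move=> _ [_ [y [[c ->] y3 ->]]]; apply: (idealD h2); first exact: (idealMl _ h2).
  exact: ideal_pow_leS.
have JE : pow 2 `<=` J.
  apply: contrapT => n2.
  have [K [f [f0 fe fI fS]] Km] := chain_embdim e_min.
  have chJ := chain_between_snoc ch3 hJ J3.
  have ch2 : chain_between (pow i.+1) (pow 2) (i - 2).+2.
    by apply: (chain_between_snoc chJ) => //; split.
  have chK : forall t, (t <= e)%N -> chain_between (pow i.+1) (f t) ((i - 2).+2 + t).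
    elim=> [|t IH] te; first by rewrite addn0 f0.
    rewrite addnS; apply: (chain_between_snoc (IH (ltnW te))); first exact: fI.
    exact: fS.
  have := chain_between_snoc (chK e (leqnn _)) ideal_setT; rewrite fe.
  case=> [|f' [f'0 f'n f'I f'S]].
    apply: (proper_subset_intro (x := 1)) => // /Km /eqP /=.
    by rewrite rmorph1 oner_eq0.
  (* The count: [i - 2] steps up to m^3, two more up to m^2 through [J], [e] steps inside m and a
     last one to [R]. The total [e + i + 1] exceeds the length [e + i]. *)
  have : ideal_chain R ((i - 2).+2 + e).+1 by exists f'.
  move=> /l_max; rewrite lE -[(i - 2).+2]addn2 subnK// addnC -addSn.
  by rewrite addSn ltnn.
apply: (nakayama h2 (principal_ideal z)) => w /JE[x [y [xz y3 ->]]].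
by exists y, x; rewrite addrC.
Qed.

(* The structure of a stretched Gorenstein ring: the maximal ideal is
   [x R + ann x], the square of [ann x] lies in the socle [x ^ s R]. *)
Definition stretched_generator (x : R) (s : nat) :=
  [/\ (0 < s)%N, p x = 0, x ^+ s <> 0, x ^+ s.+1 = 0 &
    [/\ forall z, (forall a, p a = 0 -> a * z = 0) -> exists c, z = c * x ^+ s,
        forall z, p z = 0 -> exists c, x * (z - x * c) = 0
      & forall y y', x * y = 0 -> x * y' = 0 -> p y = 0 -> p y' = 0 ->
          exists c, y * y' = c * x ^+ s]].

Lemma stretched_gorenstein_generator : stretched mm -> gorenstein R -> p 2%:R <> 0 ->
  exists x s, stretched_generator x s /\ ((s <= 1)%N -> forall z, p z = 0 -> principal x z).
Proof.
move=> [l [e [i [hl he lE powi i_min]]]] gR two.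
(* For [i = 0] the maximal ideal is zero, whence [e = 0] and length 0, although 0 and [R] form a
   chain of length 1. *)
have i0 : (0 < i)%N.
  rewrite lt0n; apply/eqP => i0; move: powi; rewrite i0 ideal_pow1 => m0.
  have e0 : e = 0%N.
    apply/eqP; rewrite -leqn0; case: he => _ /(_ [::]); apply.
    rewrite m0; apply/seteqP; split; first by move=> _ ->; apply: ideal0; apply: ideal_gen_ideal.
    by apply: ideal_gen_sub => //; apply: ideal_zero.
  have [_ /(_ 1%N)] := hl; rewrite lE e0 i0 => H.
  suff /H : ideal_chain R 1 by [].
  apply: (chain_between_ideal_chain (I := [set 0]) (J := setT)).
  apply: (chain_between_snoc (chain_between0 (@ideal_zero R)) ideal_setT).
  apply: (proper_subset_intro (x := 1)) => // /eqP /=; by rewrite oner_eq0.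
have nonzero j : (j <= i)%N -> (0 < j)%N -> exists2 z, pow j z & z <> 0.
  move=> ji j0; apply: contrapT => H; have : pow j = [set 0].
    apply/seteqP; split=> [z zj|_ ->]; last by apply: ideal0; apply: ideal_pow_ideal.
    by apply: contrapT => z0; apply: H; exists z.
  by case: j ji j0 {H} => // j ji _ /i_min; rewrite leqNgt ji.
have socle z z' := gorenstein_socle powi (z := z) (z' := z') gR.
have h2 := ideal_pow_ideal 2; have h3 := ideal_pow_ideal 3.
have mem_pow2 u v : p u = 0 -> p v = 0 -> pow 2 (u * v).
  by move=> u0 v0; apply: ideal_pow_mul => //; rewrite ideal_pow1.
have [i1|i2] := leqP i 1.
  have iE : i = 1%N by apply/eqP; rewrite eqn_leq i1.
  rewrite iE in powi i_min nonzero; have [//|x] := nonzero 1%N isT.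
  rewrite ideal_pow1 => xm x0.
  have mm0 u v : p u = 0 -> p v = 0 -> u * v = 0.
    by move=> u0 v0; have := mem_pow2 _ _ u0 v0; rewrite powi.
  have xsoc z : (forall a, p a = 0 -> a * z = 0) -> exists c, z = c * x ^+ 1.
    by move=> mz; apply: socle => // a a0; apply: mm0.
  exists x, 1%N; split; last by move=> _ z z0; apply: xsoc => a a0; apply: mm0.
  split => //; first by rewrite expr2 mm0.
  split => // [z z0|z z' _ _ z0 z'0]; exists 0; last by rewrite mm0 ?mul0r.
  by rewrite mulr0 subr0 mm0.
have square := stretched_square hl he lE powi i_min i2.
(* Polarization: if all squares lay in m^3, so would 2 u v = (u + v)^2 - u^2 - v^2. As 2 is a unit
   this gives m^2 = m^3, hence m^2 = 0. *)
have [x xm x3] : exists2 x, p x = 0 & ~ pow 3 (x * x).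
  apply: contrapT => H.
  have sq u : p u = 0 -> pow 3 (u * u).
    by move=> u0; apply: contrapT => u3; apply: H; exists u.
  have [t tE] := p_unit two.
  have pow23 : pow 2 `<=` pow 3.
    rewrite -[pow 2]/(ideal_mul mm (pow 1)) ideal_pow1.
    apply: (ideal_gen_sub h3) => _ [u u0 [v v0 <-]].
    have : pow 3 (t * ((u + v) * (u + v) - u * u - v * v)).
      apply: (idealMl _ h3); apply: (idealB h3); last exact: sq.
      apply: (idealB h3); last exact: sq.
      by apply: sq; rewrite rmorphD u0 v0 addr0.
    have -> : (u + v) * (u + v) - u * u - v * v = 2%:R * (u * v) by ring.
    by rewrite mulrA (mulrC t) tE mul1r.
  have [z z2 z0] := nonzero 2%N i2 isT; apply: z0.
  have : pow 2 `<=` [set 0]; last by apply.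
  apply: (nakayama h2).
    exact: ideal_zero.
  by move=> w /pow23 w3; exists w, 0; rewrite addr0.
have pow2x := square (x * x) (mem_pow2 _ _ xm xm) x3.
have powx j : (2 <= j)%N -> pow j `<=` principal (x ^+ j).
  elim: j => // j IH j2; have [j1|/IH powj] := leqP j 1.
    by rewrite (_ : j = 1%N) ?expr2//; apply/eqP; rewrite eqn_leq j1.
  apply: (ideal_gen_sub (principal_ideal _)) => _ [a a0 [b /powj[c ->] <-]].
  have [d dE] := pow2x _ (mem_pow2 _ _ a0 xm); exists (c * d).
  case: j j2 {IH powj} => // j _; have -> : a * (c * x ^+ j.+1) = c * (a * x) * x ^+ j.
    by rewrite exprS; ring.
  by rewrite dE !exprS; ring.
have xpow j : pow j (x ^+ j).
  by elim: j => // j IH; rewrite exprS; apply: ideal_pow_mul.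
have xi : x ^+ i <> 0.
  move=> xi0; have [z zi z0] := nonzero i (leqnn _) i0.
  by apply: z0; have [c ->] := powx _ i2 _ zi; rewrite xi0 mulr0.
have xi1 : x ^+ i.+1 = 0 by have := xpow i.+1; rewrite powi.
have msoc a : p a = 0 -> a * x ^+ i = 0.
  by move=> a0; have := ideal_pow_mul a0 (xpow i); rewrite powi.
have split_m z : p z = 0 -> exists c, x * (z - x * c) = 0.
  move=> z0; have [c cE] := pow2x _ (mem_pow2 _ _ xm z0); exists c.
  by rewrite mulrBr cE; ring.
have soc z : (forall a, p a = 0 -> a * z = 0) -> exists c, z = c * x ^+ i.
  by move=> mz; apply: socle.
exists x, i; split; last by rewrite leqNgt i2.
split => //; split => // y y' xy xy' y0 y'0; apply: soc => a /split_m[c ac].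
have [d dE] := pow2x _ (mem_pow2 _ _ y0 y'0).
(* Write [a] as [x * c] plus an element of the annihilator of [x]. The first part kills [y]; for the
   second, [y * y'] lies in m^2 and so is a multiple of x^2. Thus [y * y'] is in the socle. *)
have -> : a * (y * y') = (a - x * c) * (y * y') + c * (x * y) * y' by ring.
have -> : (a - x * c) * (y * y') = d * x * (x * (a - x * c)) by rewrite dE; ring.
by rewrite xy ac !mulr0 mul0r addr0.
Qed.

(** * Minors along a flag *)

Section FlagMinors.
Variables (x y : R).
Hypothesis xy : x * y = 0.
Hypothesis m_xy : forall z, p z = 0 -> exists c d, z = x * c + y * d.
Variable N : nat.
Hypothesis xN : x ^+ N = 0.

Definition row_module_y c' c (B : 'M[R]_(c', c)) : set 'rV[R]_c :=
  [set u | exists (q : 'rV_c) (v : 'rV_c'), u + y *: q = v *m B].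

(** For [B = A_n] its [sdim] is the number P_n(i). *)
Definition exp_module c' c (B : 'M[R]_(c', c)) i : set 'rV[R]_c :=
  [set w | row_module_y B (x ^+ i *: w)].

Lemma row_module_y_submod c' c (B : 'M[R]_(c', c)) : submod (row_module_y B).
Proof.
split.
- by exists 0, 0; rewrite mul0mx scaler0 addr0.
- move=> u v [q [w e]] [q' [w' e']]; exists (q + q'), (w + w').
  by rewrite scalerDr addrACA e e' mulmxDl.
- move=> a u [q [w e]]; exists (a *: q), (a *: w).
  by rewrite -scalemxAl -e scalerDr !scalerA (mulrC y).
Qed.

Lemma exp_module_submod c' c (B : 'M[R]_(c', c)) i : submod (exp_module B i).
Proof.
have [h0 hD hZ] := row_module_y_submod B; split; rewrite /exp_module /=.
- by rewrite scaler0.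
- by move=> u v hu hv; rewrite scalerDr; apply: hD.
- by move=> a u hu; rewrite scalerA mulrC -scalerA; apply: hZ.
Qed.

Lemma exp_module_mono c' c (B : 'M[R]_(c', c)) i j : (i <= j)%N ->
  exp_module B i `<=` exp_module B j.
Proof.
move=> ij w hw; rewrite /exp_module /= -(subnK ij) exprD -scalerA.
by have [_ _ hZ] := row_module_y_submod B; apply: hZ.
Qed.

Lemma split_row_xy n (v : 'rV[R]_n) : v^p = 0 -> exists c d, v = x *: c + y *: d.
Proof.
move=> /map_mx_eq0 v0; have [c [d H]] := row_choice2 (fun j => m_xy (v0 0 j)).
by exists c, d; apply/rowP => j; rewrite !mxE.
Qed.

Lemma exp_mul_y j : (0 < j)%N -> x ^+ j * y = 0.
Proof. by case: j => // j _; rewrite exprSr -mulrA xy mulr0. Qed.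

Section Compare.
Variables (b' b c' c : nat) (A : 'M[R]_(b', b)) (B : 'M[R]_(c', c)).
Hypothesis A0 : A^p = 0.
Hypothesis AB : forall i, (0 < i)%N -> (sdim (exp_module A i) <= sdim (exp_module B i))%N.
Variable r : nat.
Hypothesis r_gt0 : (0 < r)%N.

Let J : set R :=
  [set z | exists u d, [/\ minors_ideal B r u, principal (y ^+ r) d & z = u + d]].

Let hJ : ideal J.
Proof. exact: ideal_add (minors_ideal_ideal B r) (principal_ideal _). Qed.

(** The inequalities [AB] are exactly what the selection of independent vectors needs to transport
    the rows, with their exponents, from [A] to [B]. The resulting minor of [B] is the power of [x]
    plus a determinant in [y ^+ r R]. *)
Lemma exp_minors_independent (i : 'I_r -> nat) (w : 'M[R]_(r, b)) :
  (forall t, exp_module A (i t).+1 (row t w)) -> row_free w^p ->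
  J (x ^+ (\sum_t (i t).+1)).
Proof.
move=> wA wf.
have [j|W' Wf WQ] := @select_independent k c r (fun j => resmx (exp_module B j.+1)) i.
  apply: leq_trans (AB (ltn0Sn j)).
  pose f (t : 'I_#|[pred t | (i t <= j)%N]|) : 'I_r := enum_val t.
  apply: (free_sdim (W := rowsub f w) (exp_module_submod A j.+1)).
    move=> t; rewrite row_rowsub; apply: exp_module_mono (wA _).
    by rewrite ltnS; have := enum_valP t; rewrite inE.
  rewrite (_ : (rowsub f w)^p = rowsub f w^p).
    by apply: row_free_rowsub => //; apply: enum_val_inj.
  by apply/matrixP => t l; rewrite !mxE.
have lift_row t : exists w' : 'rV[R]_c, exp_module B (i t).+1 w' /\ w'^p = row t W'.
  by have /(resmxP _ (exp_module_submod B _))[g Bg ->] := WQ t; exists g.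
have [f fE] := choice lift_row.
have f_free : row_free (\matrix_t f t)^p.
  rewrite (_ : _^p = W')//; apply/row_matrixP => t.
  by rewrite -map_row rowK; case: (fE t).
have [D fD] := residue_row_free f_free.
have rows t : exists qv : 'rV[R]_c * 'rV[R]_c', x ^+ (i t).+1 *: f t + y *: qv.1 = qv.2 *m B.
  by have [[q [v e]] _] := fE t; exists (q, v).
have [g gE] := choice rows.
pose X := \matrix_t (x ^+ (i t).+1 *: f t); pose Y := y *: \matrix_t (g t).1.
have det_in : minors_ideal B r (\det ((X + Y) *m D)).
  apply: minors_ideal_rowspace => t; exists (g t).2; rewrite -gE.
  by rewrite linearD/= rowK linearZ/= rowK.
have XYD : \det ((X + Y) *m D) = x ^+ (\sum_t (i t).+1) + \det (Y *m D).
  rewrite mulmxDl det_add_orthogonal//.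
    congr (_ + _).
    rewrite (_ : X *m D = \matrix_(t, l) (x ^+ (i t).+1 * (1%:M : 'M_r) t l)).
      by rewrite detZ_row det1 mulr1 prodrXr.
    apply/matrixP => t l; rewrite -fD !mxE mulr_sumr; apply: eq_bigr => l' _.
    by rewrite !mxE mulrA.
  move=> t l t' l'; have -> : X = x *: \matrix_t (x ^+ (i t) *: f t).
    by apply/row_matrixP => t1; rewrite linearZ/= !rowK scalerA -exprS.
  by rewrite /Y -!scalemxAl !mxE mulrACA xy mul0r.
exists (\det ((X + Y) *m D)), (- \det (Y *m D)); split => //.
  rewrite /Y -scalemxAl detZ; apply: (idealN (principal_ideal _)).
  by exists (\det (\matrix_t (g t).1 *m D)); rewrite mulrC.
by rewrite XYD addrK.
Qed.

(* If the rows of [w] are dependent modulo the maximal ideal, the row of largest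
   exponent in a relation can be replaced by the relation, which [x] divides up
   to a multiple of [y]; the exponents increase until [x] vanishes. *)
Lemma exp_minors (n : nat) (i : 'I_r -> nat) (w : 'M[R]_(r, b)) (D : 'M[R]_(b, r)) :
  (N <= \sum_t (i t).+1 + n)%N -> (forall t, exp_module A (i t).+1 (row t w)) ->
  J (x ^+ (\sum_t (i t).+1) * \det (w *m D)).
Proof.
elim: n i w => [|n IH] i w Ni wA.
  by rewrite addn0 in Ni; rewrite -(subnK Ni) exprD xN mulr0 mul0r; apply: ideal0 hJ.
have [wf|] := boolP (row_free w^p).
  by apply: (idealMr _ hJ); apply: exp_minors_independent wf.
rewrite -kermx_eq0 => /rowV0Pn[l /sub_kermxP lw /eqP l0].
have [t1 t1P] : exists t, l 0 t != 0.
  apply: contrapT => H; apply: l0; apply/rowP => t; rewrite mxE; apply/eqP.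
  by apply/negPn/negP => lt; apply: H; exists t.
pose t0 := [arg max_(t > t1 | l 0 t != 0) i t].
have [lt0 t0max] : l 0 t0 != 0 /\ forall t, l 0 t != 0 -> (i t <= i t0)%N.
  by rewrite /t0; case: arg_maxnP.
have [m' m'E] := resmx_lift ((l 0 t0)^-1 *: l).
(* The lifted relation has coefficient 1 at [t0] and is exactly zero where [l] vanishes: only the
   rows with [l 0 t != 0] are known to have exponent at most [i t0]. *)
pose mu : 'rV[R]_r := \row_t (if t == t0 then 1 else if l 0 t == 0 then 0 else m' 0 t).
have muw : (mu *m w)^p = 0.
  rewrite map_mxM (_ : mu^p = (l 0 t0)^-1 *: l) -?scalemxAl ?lw ?scaler0//.
  apply/rowP => t; rewrite -m'E !mxE; have /rowP/(_ t) := m'E; rewrite !mxE => m't.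
  case: eqP => [->|_]; first by have /rowP/(_ t0) := m'E; rewrite !mxE => ->; rewrite mulVf ?rmorph1.
  by case: eqP => // lt; rewrite m't lt mulr0 rmorph0.
have [c0 [d0 cdE]] := split_row_xy muw.
have [u uE] : exists u : 'cV[R]_r, u = delta_mx t0 0 by exists (delta_mx t0 0).
have u0 : row t0 u = 1%:M by apply/rowP => j; rewrite uE ord1 !mxE !eqxx.
have uN t : t != t0 -> row t u = 0.
  by move=> tt0; apply/rowP => j; rewrite uE !mxE (negPf tt0).
(* [W z] is [w] with row [t0] replaced by [z]. As an update of rank one, it makes the passage to
   [mu *m w] multiplication by an explicitly invertible matrix. *)
pose W (z : 'rV[R]_b) := w + u *m (z - row t0 w).
have W0 z : row t0 (W z) = z.
  by rewrite /W raddfD/= row_mul u0 mul1mx addrC subrK.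
have WN z t : t != t0 -> row t (W z) = row t w.
  by move=> tt0; rewrite /W raddfD/= row_mul uN// mul0mx addr0.
have [v vE] : exists v, v = mu - delta_mx 0 t0 by exists (mu - delta_mx 0 t0).
have vu : v *m u = 0.
  rewrite uE vE -colE; apply/matrixP => i' j'; rewrite !ord1 !mxE !eqxx.
  by rewrite subrr.
have wE : \det (w *m D) = \det (1%:M - u *m v) * \det (W (mu *m w) *m D).
  rewrite -det_mulmx; congr (\det _); rewrite mulmxA; congr (_ *m _).
  have -> : W (mu *m w) = (1%:M + u *m v) *m w.
    by rewrite mulmxDl mul1mx -mulmxA vE mulmxBl -rowE.
  have inv1 : (1%:M - u *m v) *m (1%:M + u *m v) = 1%:M.
    rewrite mulmxBl mul1mx mulmxDr mulmx1 -mulmxA [v *m (u *m v)]mulmxA vu mul0mx mulmx0.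
    by rewrite addr0 addrK.
  by rewrite mulmxA inv1 mul1mx.
have row'W z z' : row' t0 (W z *m D) = row' t0 (W z' *m D).
  apply/row_matrixP => t; rewrite !row'Esub !row_rowsub !row_mul.
  by rewrite !WN// eq_sym neq_lift.
have detW : \det (W (mu *m w) *m D) = x * \det (W c0 *m D) + y * \det (W d0 *m D).
  apply: (@determinant_multilinear _ _ _ _ _ t0) => //.
  by rewrite !row_mul !W0 cdE mulmxDl -!scalemxAl.
pose i' t := (i t + (t == t0))%N.
have sumi' : (\sum_t (i' t).+1 = (\sum_t (i t).+1).+1)%N.
  rewrite /i' (bigD1 t0)//= [in RHS](bigD1 t0)//= eqxx addn1 -addSn; congr (_ + _)%N.
  by apply: eq_bigr => t /negPf ->; rewrite addn0.
have S0 : (0 < \sum_t (i t).+1)%N by rewrite (bigD1 t0).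
rewrite wE mulrCA; apply: (idealMl _ hJ).
rewrite detW mulrDr [x ^+ _ * (y * _)]mulrA (exp_mul_y S0) mul0r addr0 mulrA -exprSr -sumi'.
apply: IH => [|t]; first by rewrite sumi' addSnnS.
have [->|tt0] := eqVneq t t0; last by rewrite WN// /i' (negPf tt0) addn0; apply: wA.
rewrite W0 /i' eqxx addn1 /exp_module /=.
have -> : x ^+ (i t0).+2 *: c0 = x ^+ (i t0).+1 *: (mu *m w).
  by rewrite cdE scalerDr !scalerA exp_mul_y// scale0r addr0 -exprSr.
have hS := row_module_y_submod A; have [h0 _ hZ] := hS.
rewrite mulmx_sum_row scaler_sumr; apply: (submod_sum _ hS) => t' _.
rewrite scalerA mulrC -scalerA !mxE.
have [->|t't0] := eqVneq t' t0; first by apply: (hZ); apply: wA.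
have [_|lt] := eqVneq (l 0 t') 0; first by rewrite scale0r.
apply: (hZ); have itS : ((i t').+1 <= (i t0).+1)%N by rewrite ltnS t0max.
exact: (exp_module_mono itS (wA t')).
Qed.

(** Splitting the entries along [x] and [y] splits the determinant; the y-part is visibly in
    [y ^+ r R], and the x-part is the case of [exp_minors] in which all exponents equal 1. *)
Lemma flag_minors : minors_ideal A r `<=` J.
Proof.
apply: (minors_ideal_sub hJ) => C D.
have rows t : exists ad : 'rV[R]_b * 'rV[R]_b, row t (C *m A) = x *: ad.1 + y *: ad.2.
  have [|a [d e]] := @split_row_xy _ (row t (C *m A)); last by exists (a, d).
  by rewrite map_row map_mxM A0 mulmx0 row0.
have [f fE] := choice rows.
pose a := \matrix_t (f t).1; pose d := \matrix_t (f t).2.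
have -> : C *m A *m D = x *: (a *m D) + y *: (d *m D).
  rewrite !scalemxAl -mulmxDl; congr (_ *m _); apply/row_matrixP => t.
  by rewrite fE linearD/= !linearZ/= !rowK.
rewrite det_add_orthogonal// => [|i j i' j']; last by rewrite !mxE mulrACA xy mul0r.
rewrite !detZ; apply: (idealD hJ).
  have := @exp_minors N (fun=> 0%N) a D (leq_addl _ _).
  rewrite sum_nat_const card_ord muln1; apply => t.
  exists (f t).2, (row t C); rewrite rowK expr1 -row_mul fE.
  by [].
exists 0, (y ^+ r * \det (d *m D)); rewrite add0r; split => //.
  exact: ideal0 (minors_ideal_ideal B r).
by exists (\det (d *m D)); rewrite mulrC.
Qed.

End Compare.

Lemma flag_minors_sub b' b c' c (A : 'M[R]_(b', b)) (B : 'M[R]_(c', c)) r : A^p = 0 ->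
  (forall i, (0 < i)%N -> (sdim (exp_module A i) <= sdim (exp_module B i))%N) ->
  (0 < r)%N -> minors_ideal B r (y ^+ r) -> minors_ideal A r `<=` minors_ideal B r.
Proof.
move=> A0 AB r0 yB z /(flag_minors A0 AB r0)[u [_ [uB [d ->] ->]]].
have hB := minors_ideal_ideal B r.
by apply: (idealD hB) => //; apply: (idealMl _ hB).
Qed.

End FlagMinors.

(** * Resolutions over stretched Gorenstein rings *)

Section StretchedGenerator.
Variables (x : R) (s : nat).
Hypothesis x_gen : stretched_generator x s.

Lemma gen_s_gt0 : (0 < s)%N. Proof. by case: x_gen. Qed.

Lemma gen_m : p x = 0. Proof. by case: x_gen. Qed.

Lemma gen_xs_neq0 : x ^+ s <> 0. Proof. by case: x_gen. Qed.

Lemma gen_xs1 : x ^+ s.+1 = 0. Proof. by case: x_gen. Qed.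

Lemma gen_split z : p z = 0 -> exists c t, z = x * c + t /\ x * t = 0.
Proof.
case: x_gen => _ _ _ _ [_ + _] => /[apply] -[c cE].
by exists c, (z - x * c); rewrite addrC subrK.
Qed.

Lemma gen_exp_ann j t : (0 < j)%N -> x * t = 0 -> x ^+ j * t = 0.
Proof. by case: j => // j _ xt; rewrite exprSr -mulrA xt mulr0. Qed.

Lemma gen_xs_m a : p a = 0 -> x ^+ s * a = 0.
Proof.
move=> /gen_split[c [t [-> xt]]]; rewrite mulrDr mulrA -exprSr gen_xs1 mul0r add0r.
exact: gen_exp_ann gen_s_gt0 xt.
Qed.

Lemma gen_xs_eq0 a : x ^+ s * a = 0 -> p a = 0.
Proof.
move=> xa; apply: contrapT => /p_unit[c cE].
by apply: gen_xs_neq0; rewrite -(mulr1 (x ^+ s)) -cE mulrA xa mul0r.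
Qed.

Lemma gen_ann_m t : x * t = 0 -> p t = 0.
Proof. by move=> xt; apply: gen_xs_eq0; apply: gen_exp_ann gen_s_gt0 xt. Qed.

Lemma gen_ann_mul t t' : x * t = 0 -> x * t' = 0 -> exists c, t * t' = x ^+ s * c.
Proof.
move=> xt xt'; case: x_gen => _ _ _ _ [_ _].
move=> /(_ t t' xt xt' (gen_ann_m xt) (gen_ann_m xt'))[c ->].
by exists c; rewrite mulrC.
Qed.

(** The annihilator of [x ^+ (s.+1 - i)] is [x ^+ i R] plus the annihilator of [x]. Each induction
    step splits the current quotient, which is not a unit since [x ^+ s] is nonzero. *)
Lemma gen_ann_exp i r : (i <= s)%N -> x ^+ (s.+1 - i) * r = 0 ->
  exists z t, r = x ^+ i * z + t /\ x * t = 0.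
Proof.
elim: i r => [|i IH] r; first by exists r, 0; rewrite mul1r mulr0 addr0.
move=> ltis; rewrite subSS => xr.
have ltsi : (0 < s - i)%N by rewrite subn_gt0.
have [|c [t [rE xt]]] := @gen_split r.
  apply: contrapT => /p_unit[c cE]; apply: gen_xs_neq0.
  have x0 : x ^+ (s - i) = 0 by rewrite -[LHS]mulr1 -cE mulrA xr mul0r.
  by rewrite -(subnK (ltnW ltis)) exprD x0 mul0r.
have [|z [u [cE xu]]] := IH c (ltnW ltis).
  move: xr; rewrite rE mulrDr (gen_exp_ann ltsi xt) addr0 mulrA -exprSr.
  by rewrite subSn// ltnW.
exists z, t; split => //; rewrite rE cE mulrDr xu addr0.
by rewrite exprS mulrA.
Qed.

Lemma gen_split_row n (v : 'rV[R]_n) : v^p = 0 ->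
  exists c t, v = x *: c + t /\ x *: t = 0.
Proof.
move=> /map_mx_eq0 v0; have [c [t H]] := row_choice2 (fun j => gen_split (v0 0 j)).
by exists c, t; split; apply/rowP => j; rewrite !mxE; case: (H j).
Qed.

Lemma gen_ann_exp_row n i (v : 'rV[R]_n) : (i <= s)%N -> x ^+ (s.+1 - i) *: v = 0 ->
  exists z t, v = x ^+ i *: z + t /\ x *: t = 0.
Proof.
move=> lis xv; have [|c [t H]] := row_choice2 (fun j => @gen_ann_exp i (v 0 j) lis _).
  by move=> j; have /rowP/(_ j) := xv; rewrite !mxE.
by exists c, t; split; apply/rowP => j; rewrite !mxE; case: (H j).
Qed.

Lemma gen_exp_ann_row n j (t : 'rV[R]_n) : (0 < j)%N -> x *: t = 0 -> x ^+ j *: t = 0.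
Proof. by case: j => // j _ xt; rewrite exprSr -scalerA xt scaler0. Qed.

Lemma gen_xs_row_m n (v : 'rV[R]_n) : v^p = 0 -> x ^+ s *: v = 0.
Proof. by move=> /map_mx_eq0 v0; apply/rowP => j; rewrite !mxE gen_xs_m. Qed.

Lemma gen_xs_row_eq0 n (v : 'rV[R]_n) : x ^+ s *: v = 0 -> v^p = 0.
Proof.
move=> xv; apply/map_mx_eq0 => i j; rewrite ord1; apply: gen_xs_eq0.
by have /rowP/(_ j) := xv; rewrite !mxE.
Qed.

Lemma gen_ann_scale n y (u : 'rV[R]_n) : x * y = 0 -> u^p = 0 ->
  exists v, y *: u = x ^+ s *: v.
Proof.
move=> xy /map_mx_eq0 u0; have H j : exists c, y * u 0 j = x ^+ s * c.
  have [c [t [-> xt]]] := gen_split (u0 0 j); have [d dE] := gen_ann_mul xy xt.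
  by exists d; rewrite mulrDr dE mulrA (mulrC y) xy mul0r add0r.
by have [v vE] := row_choice H; exists v; apply/rowP => j; rewrite !mxE.
Qed.

(** * Duality between [x ^+ i] and [x ^+ (s - i)] for one matrix *)

Section Matrix.
Variables (b' b : nat) (A : 'M[R]_(b', b)).
Hypothesis A0 : A^p = 0.

Lemma mulmx_residue0 (w : 'rV[R]_b') : (w *m A)^p = 0.
Proof. by rewrite map_mxM A0 mulmx0. Qed.

Definition exp_ker i : set 'rV[R]_b' := [set w | x ^+ i *: (w *m A) = 0].
Definition exp_socle i : set 'rV[R]_b :=
  [set v | exists w : 'rV_b', x ^+ i *: (w *m A) = x ^+ s *: v].
Definition exp_coker i : set 'rV[R]_b :=
  [set w | exists (v : 'rV_b') t, x ^+ i *: w + t = v *m A /\ x *: t = 0].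

Lemma exp_ker_submod i : submod (exp_ker i).
Proof. exact: scaled_ker_submod. Qed.

Definition exp_rel i : set ('rV[R]_b' * 'rV[R]_b)%type :=
  [set wv | x ^+ i *: (wv.1 *m A) = x ^+ s *: wv.2].

Lemma exp_rel_submod i :
  submod (exp_rel i : set ('rV[R]_b' * 'rV[R]_b : lmodType R)%type).
Proof. exact: scaled_rel_submod. Qed.

Lemma exp_socle_submod i : submod (exp_socle i).
Proof. exact: rel_img_submod (exp_rel_submod i). Qed.

Lemma exp_coker_submod i : submod (exp_coker i).
Proof.
split.
- by exists 0, 0; rewrite mul0mx !scaler0 addr0.
- move=> u v [w [t [e xt]]] [w' [t' [e' xt']]]; exists (w + w'), (t + t').
  by rewrite mulmxDl -e -e' !scalerDr xt xt' addr0 addrACA.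
- move=> a u [w [t [e xt]]]; exists (a *: w), (a *: t).
  by rewrite -scalemxAl -e scalerDr !scalerA (mulrC a) (mulrC x) -!scalerA xt scaler0.
Qed.

(** This is [sdim_rel] for [exp_rel i]: the domain is the kernel for [i.+1], since [x] kills exactly
    the rows of the form [x ^+ s *: v] plus annihilated terms after multiplication by [x ^+ i]. *)
Lemma sdim_exp_ker_step i : (0 < i)%N -> (i <= s)%N ->
  (sdim (exp_ker i.+1) + sdim (exp_socle i.+1) =
   sdim (exp_ker i) + sdim (exp_socle i))%N.
Proof.
move=> i0 lis.
have -> : exp_ker i.+1 = rel_dom (exp_rel i).
  apply/seteqP; split=> w; rewrite /exp_ker /exp_rel /=.
    move=> xw; have [|z [t [wE xt]]] := @gen_ann_exp_row _ (s - i) (w *m A) (leq_subr _ _).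
      by rewrite subSn ?leq_subr// subKn.
    exists z; rewrite /= wE scalerDr (gen_exp_ann_row i0 xt) addr0 scalerA -exprD.
    by rewrite subnKC.
  by move=> [v /= e]; rewrite exprS -scalerA e scalerA -exprS gen_xs1 scale0r.
have -> : exp_socle i.+1 = rel_img0 (exp_rel i).
  apply/seteqP; split=> v; rewrite /exp_socle /rel_img0 /=.
    move=> [w e]; exists (x *: w); rewrite /exp_rel /= map_mxZ gen_m scale0r.
    by rewrite -scalemxAl scalerA -exprSr.
  move=> [w [e w0]]; have [c [t [wE xt]]] := gen_split_row w0; exists c.
  rewrite exprSr -scalerA scalemxAl -e /= wE mulmxDl scalerDr.
  by rewrite [_ *: (t *m A)]scalemxAl (gen_exp_ann_row i0 xt) mul0mx addr0.
rewrite (sdim_rel (exp_rel_submod i)) addnC; congr (_ + _)%N.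
congr sdim; apply/seteqP; split=> w; rewrite /rel_dom0 /exp_rel /exp_ker /=.
  by move=> [v [-> /gen_xs_row_m]].
by move=> e; exists 0; rewrite scaler0 map_mx0.
Qed.

(** The sum does not depend on [i], and at [i = s] the kernel has full residue while the socle part
    has none. *)
Lemma sdim_exp_ker_socle i : (0 < i)%N -> (i <= s)%N ->
  (sdim (exp_ker i) + sdim (exp_socle i) = b')%N.
Proof.
move=> i0 lis.
have top : (sdim (exp_ker s) + sdim (exp_socle s) = b')%N.
  rewrite (sdim_full (exp_ker_submod s)).
    rewrite (sdim0 (exp_socle_submod s)) ?addn0// => v [w e].
    by apply: gen_xs_row_eq0; rewrite -e gen_xs_row_m ?mulmx_residue0.
  move=> v; have [w wE] := resmx_lift v; exists w => //.
  by rewrite /exp_ker /= gen_xs_row_m ?mulmx_residue0.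
have [n nE] : exists n, (i + n = s)%N by exists (s - i)%N; rewrite subnKC.
elim: n i i0 lis nE => [|n IH] i i0 lis nE; first by rewrite -nE addn0 in top.
rewrite -sdim_exp_ker_step//; apply: IH => //.
  by rewrite -nE -addSnnS leq_addr.
by rewrite addSnnS.
Qed.

Lemma exp_socle_coker i v : (0 < i)%N -> (i <= s)%N -> exp_socle i v ->
  exists2 h, exp_coker (s - i) h & h^p = v^p.
Proof.
move=> i0 lis [w e].
have lisi : (s.+1 - i <= s)%N by lia.
have [|z [t [wE xt]]] := @gen_ann_exp_row _ _ (w *m A - x ^+ (s - i) *: v) lisi.
  by rewrite subKn ?leqW// scalerBr e scalerA -exprD subnKC// subrr.
exists (v + x *: z); last by rewrite map_mxD map_mxZ gen_m scale0r addr0.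
exists w, t; split => //; rewrite -[w *m A](subrK (x ^+ (s - i) *: v)) wE.
by rewrite scalerDr scalerA -exprSr -subSn// -addrA addrC.
Qed.

Lemma exp_coker_socle i w : (0 < i)%N -> (i <= s)%N -> exp_coker (s - i) w ->
  exp_socle i w.
Proof.
move=> i0 lis [v [t [e xt]]]; exists v.
by rewrite -e scalerDr (gen_exp_ann_row i0 xt) addr0 scalerA -exprD subnKC.
Qed.

Lemma resmx_exp_socle_coker i : (0 < i)%N -> (i <= s)%N ->
  (resmx (exp_socle i) :=: resmx (exp_coker (s - i)))%MS.
Proof.
move=> i0 lis; apply/eqmxP/andP; split.
  apply: (resmx_sub (exp_socle_submod i) (exp_coker_submod _)) => v.
  exact: exp_socle_coker.
apply: (resmx_sub (exp_coker_submod _) (exp_socle_submod i)) => w.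
by move=> /(exp_coker_socle i0 lis); exists w.
Qed.

Lemma sdim_exp_socle_coker i : (0 < i)%N -> (i <= s)%N ->
  sdim (exp_socle i) = sdim (exp_coker (s - i)).
Proof. by move=> i0 lis; rewrite /sdim resmx_exp_socle_coker. Qed.

Lemma sdim_exp_ker_coker i : (0 < i)%N -> (i <= s)%N ->
  (sdim (exp_ker i) + sdim (exp_coker (s - i)) = b')%N.
Proof. by move=> i0 lis; rewrite -sdim_exp_socle_coker// sdim_exp_ker_socle. Qed.

End Matrix.

(** * The case of a principal maximal ideal *)

Section PrincipalMaximal.
Variables (b : nat -> nat) (A : forall n, 'M[R]_(b n.+1, b n)).
Hypothesis A_min : minimal_complex A.

Let A0 n : (A n)^p = 0. Proof. exact: complex_residue A_min n. Qed.

Lemma socle_rows_image n (v : 'rV[R]_(b n.+1)) : exists w, x ^+ s *: v = w *m A n.+1.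
Proof.
apply: (complex_ker A_min); rewrite -scalemxAl.
by rewrite gen_xs_row_m// map_mxM A0 mulmx0.
Qed.

Hypothesis m_x : forall z, p z = 0 -> principal x z.

Let rho n i := sdim (exp_module x 0 (A n) i).

Lemma exp_module_ker n i : exp_module x 0 (A n.+1) i = exp_ker (A n) i.
Proof.
apply/seteqP; split=> w; rewrite /exp_module /row_module_y /exp_ker /=.
  move=> [q [v e]]; rewrite scale0r addr0 in e.
  by rewrite scalemxAl e (complex_image A_min).
move=> e; have [|v vE] := @complex_ker _ _ A_min n (x ^+ i *: w).
  by rewrite -scalemxAl.
by exists 0, v; rewrite scale0r addr0.
Qed.

Lemma exp_module_coker n i :
  sdim (exp_module x 0 (A n.+1) i) = sdim (exp_coker (A n.+1) i).
Proof.
apply: sdim_eq => w; split.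
  move=> [q [v e]]; exists v, 0; rewrite scaler0.
  by rewrite scale0r in e.
move=> [v [t [e xt]]].
have [d tE] : exists d, t = x ^+ s *: d.
  have H j : exists c, t 0 j = x ^+ s * c.
    case: x_gen => _ _ _ _ [soc _ _]; have [|c ->] := soc (t 0 j); last by exists c; rewrite mulrC.
    move=> a /m_x[c ->]; rewrite -mulrA; have /rowP/(_ j) := xt.
    by rewrite !mxE => ->; rewrite mulr0.
  by have [f fE] := row_choice H; exists f; apply/rowP => j; rewrite !mxE fE.
have [v' v'E] := socle_rows_image d.
exists 0, (v - v'); rewrite mulmxBl -e -v'E -tE scale0r addr0.
by rewrite addrK.
Qed.

Lemma principal_rho_rec n i : (0 < i)%N -> (i <= s)%N ->
  (rho n.+2 i + rho n.+1 (s - i) = b n.+2)%N.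
Proof.
move=> i0 lis; rewrite /rho exp_module_ker exp_module_coker.
exact: (sdim_exp_ker_coker (A0 n.+1) i0 lis).
Qed.

Lemma principal_rho_full n i : (s <= i)%N -> rho n.+1 i = b n.+1.
Proof.
move=> si; apply: (sdim_full (exp_module_submod _ _ _ _)) => v.
have [w wE] := resmx_lift v; exists w => //.
have [u uE] := socle_rows_image (x ^+ (i - s) *: w).
by exists 0, u; rewrite scale0r addr0 -uE scalerA -exprD subnKC.
Qed.

(** In the relation [w *m A = x ^+ s *: v] every [v] occurs, because socle rows are boundaries. Its
    domain lies in [exp_ker] and its [rel_img0] in [exp_socle], both for the exponent 1, and these
    two add up to the next rank. *)
Lemma principal_betti_mono n : (b n.+1 <= b n.+2)%N.
Proof.
have s0 := gen_s_gt0.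
rewrite -[X in (_ <= X)%N](sdim_exp_ker_socle (A0 n.+1) (ltn0Sn 0) s0).
have hG := exp_rel_submod (A n.+1) 0.
have e := sdim_rel hG.
have full : sdim (rel_img (exp_rel (A n.+1) 0)) = b n.+1.
  apply: (sdim_full (rel_img_submod hG)) => v.
  have [w wE] := resmx_lift v; exists w => //.
  by have [u uE] := socle_rows_image w; exists u; rewrite /exp_rel /= scale1r uE.
rewrite full in e; apply: leq_trans (leq_trans (leq_addr _ _) (eq_leq (esym e))) _.
apply: leq_add.
  apply: (sdim_le (rel_dom_submod hG) (exp_ker_submod _ _)) => w [v].
  rewrite /exp_rel /= scale1r => e'; exists w => //.
  by rewrite /exp_ker /= e' scalerA -exprD add1n gen_xs1 scale0r.
apply: (sdim_le (rel_img0_submod hG) (exp_socle_submod _ _)) => v.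
move=> [w [e' w0]]; rewrite /exp_rel /= scale1r in e'; exists v => //.
have H j : principal x (w 0 j) by apply: m_x; have /map_mx_eq0 := w0.
have [f fE] := row_choice H; exists f; rewrite -e' expr1 scalemxAl.
by congr (_ *m _); apply/rowP => j; rewrite !mxE fE mulrC.
Qed.

Theorem principal_maximal_periodic r : (0 < r)%N -> minors_periodic A r.
Proof.
move=> r0; apply: (ascending_minors_periodic (n0 := 1%N)) => -[//|n] _.
(* The flag comparison is applied with [y = 0], so that [y ^+ r] lies in every ideal. *)
have x0 : x * 0 = 0 by rewrite mulr0.
have m_x0 z : p z = 0 -> exists c d, z = x * c + 0 * d.
  by move=> /m_x[c ->]; exists c, 0; rewrite mulr0 addr0 mulrC.
apply: (flag_minors_sub x0 m_x0 gen_xs1 (A0 _)) => // [i i0|].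
  rewrite -!/(rho _ _); have [si|lt_is] := leqP s i.
    by rewrite !principal_rho_full//; apply: leq_trans (principal_betti_mono _) (principal_betti_mono _).
  have := principal_rho_rec n.+1 i0 (ltnW lt_is).
  have := @principal_rho_rec n (s - i)%N; rewrite subn_gt0 lt_is leq_subr subKn ?(ltnW lt_is)//.
  by move=> /(_ isT isT); have := principal_betti_mono n.+1; lia.
by rewrite expr0n gtn_eqF// ; apply: ideal0 (minors_ideal_ideal _ _).
Qed.

End PrincipalMaximal.

Section TwoLeExponent.
Hypothesis s_ge2 : (2 <= s)%N.

Lemma exists_nondecreasing_step (f : nat -> nat) : exists n, (f n <= f n.+1)%N.
Proof.
apply: contrapT => H; have dec n : (f n.+1 < f n)%N.
  by rewrite ltnNge; apply/negP => le; apply: H; exists n.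
have le n : (f n + n <= f 0)%N by elim: n => [|n]; rewrite ?addn0//; have := dec n; lia.
by have := le (f 0%N).+1; lia.
Qed.

(** * Two independent annihilators of x: growth of the Betti numbers *)

Section LargeEmbdim.
Variables (b : nat -> nat) (A : forall n, 'M[R]_(b n.+1, b n)).
Hypothesis A_min : minimal_complex A.
Hypothesis b_gt0 : forall n, (0 < b n)%N.

Let A0 n : (A n)^p = 0. Proof. exact: complex_residue A_min n. Qed.

Lemma gen_mulmx_square q n (w : 'rV[R]_q) (M : 'M[R]_(q, n)) : w^p = 0 -> M^p = 0 ->
  exists c, w *m M = x *: c.
Proof.
move=> w0 M0; have [c [t [-> xt]]] := gen_split_row w0.
have H j : exists d, (t *m M) 0 j = x * d.
  have H2 i : exists d, t 0 i * M i j = x * d.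
    have [|d [u [-> xu]]] := gen_split (z := M i j); first by have /map_mx_eq0 := M0.
    have xti : x * t 0 i = 0 by have /rowP/(_ i) := xt; rewrite !mxE.
    have [e eE] := gen_ann_mul xti xu.
    exists (t 0 i * d + x ^+ s.-1 * e).
    by rewrite !mulrDr eE !mulrA (mulrC x) -exprS prednK ?gen_s_gt0.
  have [f fE] := choice H2; exists (\sum_i f i).
  by rewrite mxE mulr_sumr; apply: eq_bigr => i _.
have [f fE] := choice H; exists (c *m M + \row_j f j).
rewrite mulmxDl scalerDr scalemxAl; congr (_ + _).
by apply/rowP => j; rewrite !mxE -fE mxE.
Qed.

Lemma gen_ann_mulmx0 q n y (u : 'rV[R]_q) (M : 'M[R]_(q, n)) : x * y = 0 ->
  u^p = 0 -> M^p = 0 -> y *: (u *m M) = 0.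
Proof.
move=> xy u0 M0; have [v vE] := gen_ann_scale xy u0.
rewrite scalemxAl vE -scalemxAl; apply: gen_xs_row_m.
by rewrite map_mxM M0 mulmx0.
Qed.

(** In the relation [y *: (q *m B) = x ^+ s *: v] every [q] occurs, since [y] sends the maximal
    ideal into the socle; a [q] of zero residue is sent to 0. *)
Lemma sdim_ann_ker b1 b0 (B : 'M[R]_(b1, b0)) y : B^p = 0 -> x * y = 0 ->
  (sdim [set q : 'rV_b1 | y *: (q *m B) = 0%R] +
   sdim [set v | exists q, y *: (q *m B) = x ^+ s *: v] = b1)%N.
Proof.
move=> B0 xy; have hG := scaled_rel_submod y (x ^+ s) B.
have := sdim_rel hG; rewrite (sdim0 (rel_img0_submod hG)) ?addn0; last first.
  by move=> v [q [/= e q0]]; apply: gen_xs_row_eq0; rewrite -e gen_ann_mulmx0.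
rewrite (sdim_full (rel_dom_submod hG)); last first.
  move=> w; have [v vE] := resmx_lift w; exists v => //.
  have [//|u uE] := gen_ann_scale (u := v *m B) xy; first exact: mulmx_residue0.
  by exists u.
move=> e0; rewrite [RHS]e0 addnC; congr (_ + _)%N; apply: sdim_eq => q; split.
  by move=> e; exists 0; rewrite map_mx0 /= scaler0.
by move=> [v [/= -> v0]]; rewrite /= gen_xs_row_m.
Qed.

Lemma exp_ker1_ge n : (b n.+1 <= sdim (exp_ker (A n) 1) + b n)%N.
Proof.
have := sdim_exp_ker_coker (A0 n) (ltn0Sn 0) gen_s_gt0.
have := sdim_max (exp_coker (A n) (s - 1)); lia.
Qed.

(** If [x] kills [w *m A n], then [x *: w] is a boundary, hence so is [x ^+ (s - 1) *: w] because
    [s] is at least 2. The duality for [A n.+1] then turns this into the inequality. *)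
Lemma exp_ker1_betti n :
  (sdim (exp_ker (A n.+1) 1) + sdim (exp_ker (A n) 1) <= b n.+2)%N.
Proof.
rewrite -[X in (_ <= X)%N](sdim_exp_ker_coker (A0 n.+1) (ltn0Sn 0) gen_s_gt0).
rewrite leq_add2l; apply: (sdim_le (exp_ker_submod _ _) (exp_coker_submod _ _)).
move=> w xw; exists w => //; have [|v vE] := @complex_ker _ _ A_min n (x *: w).
  by rewrite -scalemxAl; move: xw; rewrite /exp_ker /= expr1.
exists (x ^+ (s - 2) *: v), 0; rewrite scaler0 addr0 -scalemxAl -vE scalerA -exprSr.
by rewrite (_ : (s - 1 = (s - 2).+1)%N)//; lia.
Qed.

Variables y1 y2 : R.
Hypothesis xy1 : x * y1 = 0.
Hypothesis xy2 : x * y2 = 0.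
Hypothesis y_free : forall c1 c2, principal x (c1 * y1 + c2 * y2) -> p c1 = 0 /\ p c2 = 0.

Lemma y_free_rows n q (w : 'rV[R]_q) (M : 'M[R]_(q, n)) (q1 q2 : 'rV_n) :
  w^p = 0 -> M^p = 0 -> w *m M = y1 *: q1 + y2 *: q2 -> q1^p = 0 /\ q2^p = 0.
Proof.
move=> w0 M0 e; suff H j : p (q1 0 j) = 0 /\ p (q2 0 j) = 0.
  by split; apply/map_mx_eq0 => i j; rewrite ord1; case: (H j).
apply: y_free; have [c cE] := gen_mulmx_square w0 M0; exists (c 0 j).
by have /rowP/(_ j) := cE; rewrite e !mxE (mulrC y1) (mulrC y2) (mulrC x).
Qed.

(** Lift the cycles [y1 *: q + y2 *: q2]: the lifts are killed by [x] after [A n.+1]. The condition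
    to be a cycle takes values in socle rows of length [b n], so at least [2 * b n.+1 - b n]
    independent pairs satisfy it. *)
Lemma exp_ker1_two_generators n :
  (2 * b n.+1 <= sdim (exp_ker (A n.+1) 1) + b n)%N.
Proof.
pose G := [set qv : 'rV[R]_(b n.+1) * 'rV[R]_(b n) |
  exists q2 : 'rV_(b n.+1), y1 *: (qv.1 *m A n) + y2 *: (q2 *m A n) = x ^+ s *: qv.2].
have hG : submod (G : set ('rV[R]_(b n.+1) * 'rV[R]_(b n) : lmodType R)%type).
  split=> [|[u v] [u' v'] [q /= e] [q' /= e']|a [u v] [q /= e]].
  - by exists 0; rewrite /= !mul0mx !scaler0 addr0.
  - exists (q + q'); rewrite /= !mulmxDl [_ *: (v + v')]scalerDr -e -e' !scalerDr.
    by rewrite addrACA.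
  - exists (a *: q) => /=; rewrite -!scalemxAl !scalerA ![_ * a]mulrC -!scalerA -scalerDr.
    by rewrite e.
have e := sdim_rel hG.
have full : sdim (rel_dom G) = b n.+1.
  apply: (sdim_full (rel_dom_submod hG)) => w.
  have [v vE] := resmx_lift w; exists v => //.
  have [//|u uE] := gen_ann_scale (u := v *m A n) xy1; first exact: mulmx_residue0.
  by exists u, 0; rewrite /= mul0mx scaler0 addr0.
have img0 : sdim (rel_img0 G) = sdim [set v | exists q, y2 *: (q *m A n) = x ^+ s *: v].
  apply: sdim_eq => v; split.
    move=> [q [[q2 /= e'] q0]]; exists q2.
    by rewrite -e' (gen_ann_mulmx0 xy1 q0 (A0 n)) add0r.
  move=> [q2 /= e']; exists 0; rewrite map_mx0; split => //; exists q2 => /=.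
  by rewrite mul0mx scaler0 add0r.
have := sdim_ann_ker (A0 n) xy2.
suff : (sdim (rel_dom0 G) + sdim [set q : 'rV_(b n.+1) | y2 *: (q *m A n) = 0%R] <=
    sdim (exp_ker (A n.+1) 1))%N.
  by have := sdim_max (rel_img G); rewrite full img0 in e; lia.
apply: (sdim_lift2 (M := A n.+1) (x1 := y1) (x2 := y2)).
- exact: rel_dom0_submod.
- exact: scaled_ker_submod.
- exact: exp_ker_submod.
- by move=> w q1 q2 w0; apply: y_free_rows.
- move=> q [v [[q2 /= e'] v0]].
  have [|w wE] := @complex_ker _ _ A_min n (y1 *: q + y2 *: q2); last by exists w, q2.
  by rewrite mulmxDl -!scalemxAl e' (gen_xs_row_m v0).
- by move=> q /= e'; apply: (complex_ker A_min); rewrite -scalemxAl.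
- move=> w q1 q2 e'; rewrite /exp_ker /= expr1 e' scalerDr !scalerA xy1 xy2.
  by rewrite !scale0r addr0.
Qed.

(** Only the product of the components annihilated by [x] is in question: two of them multiply into
    the socle, and a third one kills it. *)
Lemma gen_prod_two_le r (f : 'I_r -> R) : (2 <= r)%N -> (forall i, p (f i) = 0) ->
  principal (x ^+ r) (\prod_i f i).
Proof.
case: r f => [|[|r]]// f _ f0.
have H i : exists ct : R * R, f i = x * ct.1 + ct.2 /\ x * ct.2 = 0.
  by have [c [t ?]] := gen_split (f0 i); exists (c, t).
have [g gE] := choice H.
have -> : \prod_i f i = \prod_i (x * (g i).1) + \prod_i (g i).2.
  rewrite -prod_add_orthogonal// => [|i j].
    by apply: eq_bigr => i _; have [] := gE i.
  by rewrite mulrAC; have [_ ->] := gE j; rewrite mul0r.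
apply: (idealD (principal_ideal _)).
  exists (\prod_i (g i).1); rewrite big_split /= prodr_const card_ord mulrC.
  by [].
rewrite !big_ord_recl mulrA.
have [_ x0] := gE ord0; have [_ x1] := gE (lift ord0 ord0).
have [c ->] := gen_ann_mul x0 x1.
case: r f f0 g {H} gE x0 x1 c => [|r] f f0 g gE x0 x1 c.
  rewrite big_ord0 mulr1 -(subnK s_ge2) exprD; exists (x ^+ (s - 2) * c).
  by rewrite mulrAC.
rewrite big_ord_recl mulrA -[x ^+ s * c * _]mulrA [c * _]mulrC mulrA.
rewrite (gen_exp_ann gen_s_gt0) ?mul0r; first exact: ideal0 (principal_ideal _).
by have [] := gE (lift ord0 (lift ord0 ord0)).
Qed.

(** The last two inequalities make [b] convex up to the term [z n]. Since [b] cannot decrease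
    forever, it becomes nondecreasing; then [z] is positive, which makes [b] strictly increasing,
    and [z] is bounded below by [b]. *)
Lemma betti_growth (z : nat -> nat) :
  (forall n, b n.+1 <= z n + b n)%N -> (forall n, 2 * b n.+1 <= z n.+1 + b n)%N ->
  (forall n, z n.+1 + z n <= b n.+2)%N ->
  forall r, exists N, forall n, (N <= n)%N -> (r <= z n)%N /\ (b n < b n.+1)%N.
Proof.
move=> h1 h2 h3 r.
have [n0 n0P] := exists_nondecreasing_step b.
have mono n : (n0 <= n)%N -> (b n <= b n.+1)%N.
  move=> /subnK <-; elim: (n - n0)%N => // m IH; rewrite addSn.
  by have := h2 (m + n0)%N; have := h3 (m + n0)%N; lia.
have pos n : (n0 <= n)%N -> (0 < z n.+1)%N.
  by move=> nn; have := h2 n; have := mono n nn; have := b_gt0 n.+1; lia.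
have lt n : (n0 <= n)%N -> (b n.+2 < b n.+3)%N.
  move=> nn; have := pos n nn; have := mono n.+1 (leqW nn).
  by have := h2 n.+1; have := h3 n.+1; lia.
have big m : (m <= b (n0 + m).+2)%N.
  by elim: m => // m IH; rewrite addnS; have := lt (n0 + m)%N (leq_addr _ _); lia.
exists (n0 + r).+3 => -[|[|[|n]]]// nn.
have {}nn : (n0 + r <= n)%N := nn.
have n0n : (n0 <= n)%N by lia.
have bmono m : (b (n0 + r).+2 <= b (n0 + r + m).+2)%N.
  elim: m => [|m IH]; first by rewrite addn0.
  by rewrite addnS; have := lt (n0 + r + m)%N; lia.
have := bmono (n - (n0 + r))%N; rewrite subnKC// => bn.
split; last by have := lt n.+1; lia.
by have := big r; have := h2 n.+2; have := lt n n0n; lia.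
Qed.

Theorem large_embdim_periodic r : (0 < r)%N -> minors_periodic A r.
Proof.
move=> r0.
have [N NP] := betti_growth exp_ker1_ge exp_ker1_two_generators exp_ker1_betti r.
have xP n g : exp_ker (A n) 1 g -> exists w, x *: g = w *m A n.+1.
  rewrite /exp_ker /= expr1 => xg; apply: (complex_ker A_min).
  by rewrite -scalemxAl.
apply: (full_minors_periodic A_min (n0 := N.+1)) => -[//|n] nn f f0.
have [zr lt_b] := NP n nn; have hM := minors_ideal_ideal (A n.+1) r.
have xr : minors_ideal (A n.+1) r (x ^+ r).
  by apply: (minors_ideal_exp_sdim (exp_ker_submod (A n) 1)) => // g; apply: xP.
case: r r0 f f0 {NP} zr hM xr => [//|[|r]] _ f f0 zr hM xr.
  (* For [r = 1] the element [x] does not suffice. A component [t] annihilated by [x] is reached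
     through the rows [q] with [t *: (q *m A n) = 0], of dimension at least [b n.+1 - b n], which is
     positive. *)
  rewrite big_ord1; have [c [t [-> xt]]] := gen_split (f0 0).
  apply: (idealD hM); first by rewrite mulrC; apply: (idealMl _ hM); rewrite -[x]expr1.
  rewrite -[t]expr1; apply: (minors_ideal_exp_sdim (scaled_ker_submod t (A n))).
    have := sdim_ann_ker (A0 n) xt.
    by have := sdim_max [set v | exists q, t *: (q *m A n) = x ^+ s *: v]; lia.
  by move=> g tg; apply: (complex_ker A_min); rewrite -scalemxAl.
have [//|c ->] := gen_prod_two_le _ f0.
exact: (idealMl _ hM).
Qed.

End LargeEmbdim.

(** * Embedding dimension two *)

Section TwoGenerators.
Variables (y u u' : R).
Hypothesis xy : x * y = 0.
Hypothesis yy : y * y = u * x ^+ s.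
Hypothesis uu' : u * u' = 1.
Hypothesis m_xy : forall z, p z = 0 -> exists c d, z = x * c + y * d.
Hypothesis ann_y : forall t, x * t = 0 -> exists d, t = y * d.
Hypothesis y_free : forall c, principal x (c * y) -> p c = 0.

Lemma y_m : p y = 0. Proof. exact: (gen_ann_m xy). Qed.

Lemma ann_y_row n (t : 'rV[R]_n) : x *: t = 0 -> exists d, t = y *: d.
Proof.
move=> xt; have H j : exists d, t 0 j = y * d.
  by apply: ann_y; have /rowP/(_ j) := xt; rewrite !mxE.
have [v vE] := row_choice H; exists v.
by apply/rowP => j; rewrite !mxE.
Qed.

Lemma x_y_row n (d : 'rV[R]_n) : x *: (y *: d) = 0.
Proof. by rewrite scalerA xy scale0r. Qed.

Lemma y_x_row n (d : 'rV[R]_n) : y *: (x *: d) = 0.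
Proof. by rewrite scalerA mulrC xy scale0r. Qed.

Lemma y_y_row n (d : 'rV[R]_n) : y *: (y *: d) = x ^+ s *: (u *: d).
Proof. by rewrite scalerA yy scalerA mulrC. Qed.

Lemma exp_module_coker_y b' b (B : 'M[R]_(b', b)) i : exp_module x y B i = exp_coker B i.
Proof.
apply/seteqP; split=> w.
  by move=> [q [v e]]; exists v, (y *: q); rewrite x_y_row.
by move=> [v [t [e /ann_y_row[d tE]]]]; exists d, v; rewrite -tE.
Qed.

Definition y_module b' b (B : 'M[R]_(b', b)) : set 'rV[R]_b :=
  [set q | exists (a : 'rV_b) (v : 'rV_b'), x *: a + y *: q = v *m B].

Lemma y_module_submod b' b (B : 'M[R]_(b', b)) : submod (y_module B).
Proof.
split.
- by exists 0, 0; rewrite mul0mx !scaler0 addr0.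
- move=> q q' [a [v e]] [a' [v' e']]; exists (a + a'), (v + v').
  by rewrite mulmxDl -e -e' !scalerDr addrACA.
- move=> c q [a [v e]]; exists (c *: a), (c *: v).
  by rewrite -scalemxAl -e scalerDr !scalerA !(mulrC c).
Qed.

Section Step.
Variables (b' b : nat) (B : 'M[R]_(b', b)).
Hypothesis B0 : B^p = 0.

Local Notation S i := (resmx (exp_socle B i)).
Local Notation Y := (resmx (y_module B)).

Lemma mulmx_xy (q : 'rV_b') : exists a q' : 'rV_b, q *m B = x *: a + y *: q' /\ y_module B q'.
Proof.
have [|a [q' e]] := @split_row_xy _ _ m_xy _ (q *m B); first exact: mulmx_residue0.
by exists a, q'; split => //; exists a, q.
Qed.

(** Multiplying by [y] kills the x-part and turns the y-part into a socle row, as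
    [y * y = u * x ^+ s]. With [socle_y] and [y_socle]: [x ^+ s *: v] lies in [y] times the image
    exactly when the residue of [v] lies in [Y]. *)
Lemma y_mulmx (q : 'rV_b') : exists2 q', y_module B q' & y *: (q *m B) = x ^+ s *: (u *: q').
Proof.
have [a [q' [e Yq']]] := mulmx_xy q; exists q' => //.
by rewrite e scalerDr y_x_row add0r y_y_row.
Qed.

Lemma socle_residue (v : 'rV[R]_b) w : v^p = w^p -> x ^+ s *: v = x ^+ s *: w.
Proof.
move=> vw; apply/eqP; rewrite -subr_eq0 -scalerBr; apply/eqP.
by apply: gen_xs_row_m; rewrite map_mxB vw subrr.
Qed.

Lemma socle_y (v : 'rV[R]_b) : (v^p <= Y)%MS -> exists q : 'rV_b', x ^+ s *: v = y *: (q *m B).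
Proof.
move=> /(resmxP _ (y_module_submod B))[q0 [a [v0 e]] /socle_residue ->].
exists (u' *: v0); rewrite -scalemxAl scalerA mulrC -scalerA -e scalerDr y_x_row add0r.
by rewrite y_y_row !scalerA mulrAC (mulrC u') uu' mul1r.
Qed.

Lemma y_socle (v : 'rV[R]_b) (q : 'rV_b') : y *: (q *m B) = x ^+ s *: v -> (v^p <= Y)%MS.
Proof.
have [q' Yq' ->] := y_mulmx q => e.
have -> : v^p = (u *: q')^p.
  apply/eqP; rewrite -subr_eq0 -map_mxB; apply/eqP.
  by apply: gen_xs_row_eq0; rewrite scalerBr e subrr.
apply/(resmxP _ (y_module_submod B)); exists (u *: q') => //.
by have [_ _ hZ] := y_module_submod B; apply: hZ.
Qed.

(** Restrict [exp_rel] to [v] with residue in [Y]: then [x ^+ s *: v] is [y] times an image, so the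
    domain consists of the [w] that some [y *: q] completes to a cycle. By exactness this is
    [exp_module] of the next differential. *)
Lemma sdim_ker_exp_y i : (0 < i)%N -> (i < s)%N ->
  (sdim [set w : 'rV_b' | exists q : 'rV_b', (x ^+ i *: w + y *: q) *m B = 0%R]
     + \rank (S i.+1 :&: Y)%MS = \rank (S i :&: Y)%MS + sdim (exp_ker B i))%N.
Proof.
move=> i0 lis.
have hG := rel_cap_submod Y (exp_rel_submod B i); set G := (G in submod G) in hG.
have := sdim_rel hG.
have -> : rel_dom G = [set w : 'rV_b' | exists q : 'rV_b', (x ^+ i *: w + y *: q) *m B = 0%R].
  apply/seteqP; split=> w.
    move=> [v [/= e /socle_y[q qE]]]; exists (- q).
    by rewrite scalerN mulmxDl mulNmx -!scalemxAl e qE subrr.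
  move=> [q]; rewrite mulmxDl -!scalemxAl => e.
  have [q' Yq' qE] := y_mulmx (- q); exists (u *: q'); split => /=.
    rewrite /exp_rel /= -qE mulNmx scalerN; apply/eqP.
    by rewrite -addr_eq0 e.
  apply/(resmxP _ (y_module_submod B)); exists (u *: q') => //.
  by have [_ _ hZ] := y_module_submod B; apply: hZ.
have -> : sdim (rel_img0 G) = \rank (S i.+1 :&: Y)%MS.
  rewrite -(sdim_cap_res _ (exp_socle_submod B i.+1)).
  apply: sdim_eq => v; split.
    move=> [w [[/= e vY] w0]]; split => //.
    have [c [t [wE xt]]] := gen_split_row w0; exists c.
    rewrite exprSr -scalerA scalemxAl -e /= wE mulmxDl scalerDr.
    by rewrite [_ *: (t *m B)]scalemxAl (gen_exp_ann_row i0 xt) mul0mx addr0.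
  move=> [[w e] vY]; exists (x *: w); rewrite map_mxZ gen_m scale0r; split => //.
  by split => //=; rewrite /exp_rel /= -scalemxAl scalerA -exprSr.
have -> : sdim (rel_img G) = \rank (S i :&: Y)%MS.
  rewrite -(sdim_cap_res _ (exp_socle_submod B i)).
  apply: sdim_eq => v; split; first by move=> [w [/= e vY]]; split => //; exists w.
  by move=> [[w e] vY]; exists w.
have -> : rel_dom0 G = exp_ker B i; last by [].
apply/seteqP; split=> w.
  by move=> [v [[/= e _] v0]]; rewrite /exp_ker /= e gen_xs_row_m.
move=> e; exists 0; rewrite map_mx0; split => //; split; last by rewrite map_mx0 sub0mx.
by rewrite /exp_rel /= scaler0.
Qed.

Lemma y_mulmx_m (q : 'rV_b') : q^p = 0 -> y *: (q *m B) = 0.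
Proof. by move=> q0; apply: (gen_ann_mulmx0 xy q0 B0). Qed.

Lemma sdim_ker_y : (sdim [set q : 'rV_b' | y *: (q *m B) = 0%R] + \rank Y = b')%N.
Proof.
rewrite -[in RHS](sdim_ann_ker B0 xy); congr (_ + _)%N.
have hI := rel_img_submod (scaled_rel_submod y (x ^+ s) B).
apply/eqP; rewrite eqn_leq; apply/andP; split.
  apply: (sdim_le (y_module_submod B) hI) => q [a [v e']].
  exists q => //; exists (u' *: v) => /=.
  rewrite -scalemxAl scalerA mulrC -scalerA -e' scalerDr y_x_row add0r y_y_row !scalerA.
  by rewrite mulrAC (mulrC u') uu' mul1r.
by apply/mxrankS/rV_subP => v /(resmxP _ hI)[g [q /= /y_socle e'] ->].
Qed.

(** The same argument with the roles of [x] and [y] exchanged, restricting to the [v] for which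
    [x ^+ s *: v] is [x] times an image. *)
Lemma sdim_ker_y_module :
  (sdim [set q : 'rV_b' | exists a : 'rV_b', (x *: a + y *: q) *m B = 0%R] + \rank Y =
   \rank (S 1 :&: Y)%MS + b')%N.
Proof.
have hG := rel_cap_submod (S 1) (scaled_rel_submod y (x ^+ s) B); set G := (G in submod G) in hG.
have := sdim_rel hG.
rewrite (sdim0 (rel_img0_submod hG)) ?addn0; last first.
  move=> v [q [[/= e' _] q0]]; apply: gen_xs_row_eq0.
  by rewrite -e' y_mulmx_m.
have S1P v : (v^p <= S 1)%MS <-> exists w : 'rV_b', x *: (w *m B) = x ^+ s *: v.
  split=> [/(resmxP _ (exp_socle_submod B 1))[v' [w e] /socle_residue ->]|[w e]].
    by exists w; rewrite -e expr1.
  apply/(resmxP _ (exp_socle_submod B 1)); exists v => //.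
  by exists w; rewrite expr1.
have -> : rel_dom G = [set q : 'rV_b' | exists a : 'rV_b', (x *: a + y *: q) *m B = 0%R].
  apply/seteqP; split=> q.
    move=> [v [/= e /S1P[w we]]]; exists (- w).
    by rewrite scalerN mulmxDl mulNmx -!scalemxAl e we addNr.
  move=> [a]; rewrite mulmxDl -!scalemxAl => e.
  have [q' _ qE] := y_mulmx q; exists (u *: q'); split => //=.
  apply/S1P; exists (- a); rewrite -qE mulNmx scalerN; apply/eqP.
  by rewrite eq_sym -addr_eq0 addrC e.
have -> : sdim (rel_img G) = \rank (S 1 :&: Y)%MS.
  rewrite -(sdim_cap_res _ (exp_socle_submod B 1)).
  apply/eqP; rewrite eqn_leq; apply/andP; split.
    apply: (sdim_le (rel_img_submod hG)
      (submod_cap_res _ (exp_socle_submod B 1))) => v [q [/= e vS]].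
    exists v => //; split; last exact: y_socle e.
    by have [w we] := (S1P v).1 vS; exists w; rewrite expr1.
  apply: (sdim_le (submod_cap_res _ (exp_socle_submod B 1))
    (rel_img_submod hG)) => v [[w we] /socle_y[q qE]].
  exists v => //; exists q; split => //=; apply/S1P; exists w.
  by rewrite -we expr1.
have -> : rel_dom0 G = [set q : 'rV_b' | y *: (q *m B) = 0%R].
  apply/seteqP; split=> q.
    by move=> [v [[/= -> _] v0]]; rewrite /= gen_xs_row_m.
  move=> e; exists 0; rewrite map_mx0; split => //; split => /=.
    by rewrite e scaler0.
  by rewrite map_mx0 sub0mx.
by have := sdim_ker_y; lia.
Qed.

End Step.

(** * Recurrences for the numbers P_n(i) *)

Section Complex.
Variables (b : nat -> nat) (A : forall n, 'M[R]_(b n.+1, b n)).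
Hypothesis A_min : minimal_complex A.
Hypothesis b_gt0 : forall n, (0 < b n)%N.

Let A0 n : (A n)^p = 0. Proof. exact: complex_residue A_min n. Qed.

Let rho n i : nat := sdim (exp_module x y (A n) i).
Let P n i := resmx (exp_module x y (A n) i).
Let Y n := resmx (y_module (A n)).

Lemma complex_image_ker n (w : 'rV_(b n.+1)) :
  w *m A n = 0 <-> exists v, w = v *m A n.+1.
Proof. by case: A_min => _; apply. Qed.

Lemma exp_module_next n i : exp_module x y (A n.+1) i =
  [set w : 'rV_(b n.+1) | exists q : 'rV_(b n.+1), (x ^+ i *: w + y *: q) *m A n = 0].
Proof.
apply/seteqP; split=> w.
  by move=> [q e]; exists q; apply/complex_image_ker.
by move=> [q /complex_image_ker e]; exists q.
Qed.

Lemma y_module_next n : y_module (A n.+1) =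
  [set q : 'rV_(b n.+1) | exists a : 'rV_(b n.+1), (x *: a + y *: q) *m A n = 0].
Proof.
apply/seteqP; split=> w.
  by move=> [q e]; exists q; apply/complex_image_ker.
by move=> [q /complex_image_ker e]; exists q.
Qed.

Lemma resmx_socle_P n i : (0 < i)%N -> (i <= s)%N ->
  (resmx (exp_socle (A n) i) :=: P n (s - i))%MS.
Proof.
move=> i0 lis; rewrite /P exp_module_coker_y.
exact: (resmx_exp_socle_coker).
Qed.

Lemma rho0 n : rho n 0 = 0%N.
Proof.
apply: (sdim0 (exp_module_submod _ _ _ _)) => w [q [v e]].
rewrite scale1r in e; have -> : w = v *m A n - y *: q by rewrite -e addrK.
by rewrite map_mxB map_mxM A0 mulmx0 map_mxZ y_m scale0r subrr.
Qed.

Lemma rank_cap_P0 n : \rank (P n 0 :&: Y n)%MS = 0%N.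
Proof.
apply/eqP; rewrite -leqn0; have := mxrankS (capmxSl (P n 0) (Y n)).
by rewrite -[\rank (P n 0)]/(rho n 0) rho0.
Qed.

Lemma P_le n i j : (i <= j)%N -> (P n i <= P n j)%MS.
Proof.
move=> ij; apply: (resmx_sub (exp_module_submod _ _ _ _) (exp_module_submod _ _ _ _)).
by move=> w /(exp_module_mono ij); exists w.
Qed.

Lemma rho_rec n i : (0 < i)%N -> (i < s)%N ->
  (rho n.+1 i + \rank (P n (s - i.+1) :&: Y n)%MS + rho n (s - i) =
   \rank (P n (s - i) :&: Y n)%MS + b n.+1)%N.
Proof.
move=> i0 lis; have := sdim_ker_exp_y (A0 n) i0 lis.
rewrite -exp_module_next !(cap_eqmx (resmx_socle_P n _ _) (eqmx_refl _))// ?(ltnW lis)//.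
have := sdim_exp_ker_coker (A0 n) i0 (ltnW lis).
by rewrite -exp_module_coker_y -/(rho n (s - i)) -/(rho n.+1 i) -/(Y n); lia.
Qed.

Lemma rank_Y_rec n :
  (\rank (Y n.+1) + \rank (Y n) = \rank (P n (s - 1) :&: Y n)%MS + b n.+1)%N.
Proof.
have := sdim_ker_y_module (A0 n); rewrite -y_module_next.
by rewrite (cap_eqmx (resmx_socle_P n _ _) (eqmx_refl _))// ltnW.
Qed.

(* Elements [q] with [y *: (q *m A n) = 0] lift through [A n.+1] to generators
   killed by [x], as [x] and [y] annihilate each other. *)
Lemma betti_convex n : (2 * b n.+1 <= b n.+2 + b n)%N.
Proof.
have s1 : (s - 1 < s)%N by lia.
have s1' : (0 < s - 1)%N by lia.
have := rho_rec n s1' s1; rewrite subKn ?(ltnW s_ge2)//.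
have -> : (s - (s - 1).+1 = 0)%N by lia.
have e0 := rank_cap_P0 n.
have sum := mxrank_sum_cap (P n 1) (Y n).
have le_b : (\rank (P n 1 + Y n)%MS <= b n)%N by apply: rank_leq_col.
have := sdim_exp_ker_coker (A0 n.+1) (ltn0Sn 0) gen_s_gt0.
rewrite -exp_module_coker_y -/(rho n.+1 (s - 1)).
suff : (b n.+1 <= sdim (exp_ker (A n.+1) 1) + \rank (Y n))%N.
  by rewrite e0 -/(rho n 1) in sum *; rewrite /rho /sdim -/(P n 1) in sum *; lia.
suff : (sdim [set q : 'rV_(b n.+1) | y *: (q *m A n) = 0%R] <=
    sdim (exp_ker (A n.+1) 1))%N by have := sdim_ker_y (A0 n); rewrite -/(Y n); lia.
apply: (sdim_lift (M := A n.+1) (x := y)); try exact: scaled_ker_submod.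
- move=> w q w0 e'; apply/map_mx_eq0 => i j; rewrite ord1.
  have [c cE] := gen_mulmx_square w0 (A0 n.+1).
  apply: y_free; exists (c 0 j); have /rowP/(_ j) := cE.
  by rewrite e' !mxE mulrC (mulrC x).
- by move=> q /= e'; apply/complex_image_ker; rewrite -scalemxAl.
- by move=> w q e'; rewrite /exp_ker /= e' expr1 x_y_row.
Qed.

(** The sums of two consecutive terms do not increase; once they reach their minimum, both parities
    are constant. *)
Lemma eventually_const_of_nonincreasing (f : nat -> nat) : (forall n, f n.+2 <= f n)%N ->
  exists N, forall n, (N <= n)%N -> f n.+2 = f n.
Proof.
move=> f_le; pose g n := (f n + f n.+1)%N.
have ex_g : exists m, `[< exists N, g N = m >] by exists (g 0%N); apply/asboolP; exists 0%N.
case: (ex_minnP ex_g) => _ /asboolP[N <-] gmin; exists N.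
have g_min n : (g N <= g n)%N by apply: gmin; apply/asboolP; exists n.
move=> n /subnK <-; suff H : (g (n - N + N) <= g N)%N.
  by have := f_le (n - N + N)%N; have := g_min (n - N + N).+1; rewrite /g in H *; lia.
elim: (n - N)%N => // i IH; apply: leq_trans IH; rewrite addSn /g addnC.
by rewrite leq_add2r.
Qed.

(** [D] and [L] are codimensions, of [Y n] and of [P n (s - 1)]. Each bounds the other one step
    later, so [D] is eventually 2-periodic. Equality in these bounds forces [P n 1 + Y n] to be
    everything, and then the intersection terms in [rho_rec] can be eliminated. *)
Lemma two_generators_stable : exists n0, forall n, (n0 <= n)%N ->
  [/\ \rank (P n 1 + Y n)%MS = b n, (b n <= b n.+1)%N
    & forall i, (0 < i)%N -> (rho n i <= rho n.+2 i)%N].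
Proof.
have [n1 n1P] := exists_nondecreasing_step b.
have b_mono n : (n1 <= n)%N -> (b n <= b n.+1)%N.
  move=> /subnK <-; elim: (n - n1)%N => // m IH; rewrite addSn.
  by have := betti_convex (m + n1)%N; lia.
pose D n := (b n - \rank (Y n))%N; pose L n := (b n - rho n (s - 1))%N.
have Yb n : (\rank (Y n) <= b n)%N by apply: rank_leq_col.
have Pb n i : (rho n i <= b n)%N by apply: rank_leq_col.
have sum n i : (\rank (P n i + Y n)%MS + \rank (P n i :&: Y n)%MS = rho n i + \rank (Y n))%N.
  exact: mxrank_sum_cap.
have sum_b n i : (\rank (P n i + Y n)%MS <= b n)%N by apply: rank_leq_col.
have DL n : (D n.+1 <= L n)%N.
  have := rank_Y_rec n; have := sum n (s - 1)%N; have := sum_b n (s - 1)%N.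
  by have := Yb n.+1; have := Yb n; have := Pb n (s - 1)%N; rewrite /D /L; lia.
have recs n : (rho n.+1 (s - 1) + rho n 1 = \rank (P n 1 :&: Y n)%MS + b n.+1)%N.
  have := @rho_rec n (s - 1)%N; have -> : (s - (s - 1).+1 = 0)%N by lia.
  have -> : (s - (s - 1) = 1)%N by lia.
  by rewrite rank_cap_P0 addn0; apply; lia.
have LD n : (L n.+1 <= D n)%N.
  have := recs n; have := sum n 1%N; have := sum_b n 1%N.
  by have := Pb n.+1 (s - 1)%N; have := Yb n; rewrite /D /L; lia.
have [n2 n2P] : exists N, forall n, (N <= n)%N -> D n.+2 = D n.
  by apply: eventually_const_of_nonincreasing => n; apply: leq_trans (DL _) (LD _).
have full n : (n2 <= n)%N -> \rank (P n 1 + Y n)%MS = b n.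
  move=> nn; have LDn : L n.+1 = D n by have := DL n.+1; have := LD n; have := n2P n nn; lia.
  move: LDn; have := recs n; have := sum n 1%N; have := sum_b n 1%N.
  by have := Pb n.+1 (s - 1)%N; have := Yb n; rewrite /D /L; lia.
have full_i n i : (n2 <= n)%N -> (0 < i)%N -> \rank (P n i + Y n)%MS = b n.
  move=> nn i0; apply/eqP; rewrite eqn_leq sum_b /= -{1}(full n nn).
  by apply: mxrankS; apply: addsmxS => //; apply: P_le.
have rec_i n i : (n2 <= n)%N -> (0 < i)%N -> (i < s - 1)%N ->
    (rho n.+1 i + rho n (s - 1 - i) = b n.+1)%N.
  move=> nn i0 lis; have lis' : (i < s)%N by lia.
  have := rho_rec n i0 lis'; have -> : (s - i.+1 = s - 1 - i)%N by lia.
  have := sum n (s - i)%N; have := sum n (s - 1 - i)%N.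
  by rewrite !full_i ?subn_gt0//; lia.
have rec_s n : (n2 <= n)%N -> (rho n.+1 (s - 1) + D n = b n.+1)%N.
  move=> nn; have := recs n; have := sum n 1%N; rewrite full//.
  by have := Yb n; rewrite /D; lia.
exists (maxn n1 n2).+1 => -[//|n] nn; have n1n : (n1 <= n)%N by lia.
have n2n : (n2 <= n)%N by lia.
split; [by apply: full; lia|by apply: b_mono; lia|move=> i i0].
have [si|] := leqP s i.
  apply: leq_trans (Pb _ _) _; apply: leq_trans (b_mono n.+1 (leqW n1n)) _.
  apply: leq_trans (b_mono n.+2 (leqW (leqW n1n))) _.
  rewrite /rho (sdim_full (exp_module_submod _ _ _ _))// => v.
  have [w wE] := resmx_lift v; exists w => //.
  have [v' v'E] := socle_rows_image A_min (x ^+ (i - s) *: w).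
  by exists 0, v'; rewrite scaler0 addr0 -v'E scalerA -exprD subnKC.
have bm := b_mono n.+1 (leqW n1n); have bm' := b_mono n.+2 (leqW (leqW n1n)).
rewrite leq_eqVlt => /orP[/eqP is1|lis].
  have -> : i = (s - 1)%N by lia.
  have := rec_s n n2n; have := rec_s n.+2; have := n2P n n2n.
  by move=> -> /(_ (leqW (leqW n2n))); lia.
have lis1 : (i < s - 1)%N by lia.
have := rec_i n.+2 i (leqW (leqW n2n)) i0 lis1.
have := rec_i n.+1 (s - 1 - i)%N (leqW n2n); rewrite subKn; last by lia.
by rewrite subn_gt0 lis1; move=> /(_ isT) H; have := H _; lia.
Qed.

End Complex.

Let px : p x = 0. Proof. exact: gen_m. Qed.
Let py : p y = 0. Proof. exact: (gen_ann_m xy). Qed.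

Lemma ann_x_m t : x * t = 0 -> p t = 0.
Proof. by move=> /ann_y[d ->]; rewrite rmorphM py mul0r. Qed.

Lemma xy_free d d' : x * d = y * d' -> p d = 0 /\ p d' = 0.
Proof.
move=> e; have d'0 : p d' = 0 by apply: y_free; exists d; rewrite mulrC -e mulrC.
split => //; have [c [c' cE]] := m_xy d'0.
have : x * (d - u * x ^+ (s - 1) * c') = 0.
  rewrite mulrBr e cE mulrDr !mulrA yy (mulrC y) xy mul0r add0r.
  by rewrite -(subnK (ltnW s_ge2)) addnK addn1 exprS; ring.
move=> /ann_x_m /eqP; rewrite rmorphB subr_eq0 => /eqP ->.
by rewrite (_ : (s - 1 = (s - 2).+1)%N) ?exprS ?rmorphM ?px ?(mul0r, mulr0)//; lia.
Qed.

Lemma xy_free_row n (d d' : 'rV[R]_n) : x *: d = y *: d' -> d^p = 0 /\ d'^p = 0.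
Proof.
move=> e; suff H j : p (d 0 j) = 0 /\ p (d' 0 j) = 0.
  by split; apply/map_mx_eq0 => i j; rewrite ord1; case: (H j).
by apply: xy_free; have /rowP/(_ j) := e; rewrite !mxE.
Qed.

(** * Images on which no functional takes the value y *)

Section Image.
Variables (b' b : nat) (B : 'M[R]_(b', b)).
Hypothesis B0 : B^p = 0.

Definition full_image :=
  \rank (resmx (exp_module x y B 1) + resmx (y_module B))%MS = b.

(** The residues of the coefficients [a] and [q] in the rows [x *: a + y *: q] of the image span
    everything, so they detect whether a functional has zero residue. *)
Lemma full_image_app (f : 'cV[R]_b) : full_image ->
  (forall a q w, x *: a + y *: q = w *m B -> p (app a f) = 0 /\ p (app q f) = 0) ->
  f^p = 0.
Proof.
move=> full H.
have V : (1%:M <= resmx (exp_module x y B 1) + resmx (y_module B))%MS.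
  by rewrite sub1mx /row_full full.
suff : (1%:M : 'M_b) *m f^p = 0 by rewrite mul1mx.
have res0 (v : 'rV[R]_b) : p (app v f) = 0 -> v^p *m f^p = 0.
  by move=> v0; rewrite -map_mxM; apply/map_mx_eq0 => i j; rewrite !ord1.
apply/sub_kermxP; apply: submx_trans V _; rewrite addsmx_sub.
apply/andP; split; apply/rV_subP => v.
  move=> /(resmxP _ (exp_module_submod _ _ _ _))[a [q [w e]] ->].
  rewrite expr1 in e; apply/sub_kermxP; apply: res0.
  by have [] := H _ _ _ e.
move=> /(resmxP _ (y_module_submod B))[q [a [w e]] ->].
by apply/sub_kermxP; apply: res0; have [] := H _ _ _ e.
Qed.

Definition scalar_image l := forall v : 'rV[R]_b,
  (exists w, v = w *m B) <-> (exists a, v = l *: a).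

Lemma split_image w : exists a q : 'rV[R]_b, w *m B = x *: a + y *: q.
Proof. by apply: (split_row_xy m_xy); apply: mulmx_residue0. Qed.

Definition y_value := exists w f, app (w *m B) f = y.

Lemma y_value_unit w f e : p e <> 0 -> app (w *m B) f = y * e -> y_value.
Proof.
move=> /p_unit[e' ee'] E; exists (e' *: w), f.
by rewrite -scalemxAl appZl E mulrCA (mulrC e') ee' mulr1.
Qed.

Hypothesis full : full_image.
Hypothesis b_gt0 : (0 < b)%N.
Hypothesis ny : ~ y_value.

Lemma y_part_m i a q w f : (0 < i)%N -> x ^+ i *: a + y *: q = w *m B -> app a f = 0 ->
  p (app q f) = 0.
Proof.
move=> i0 e af; apply: contrapT => qf; apply: ny; apply: (y_value_unit qf (w := w)(f := f)).
by rewrite -e appDl !appZl af mulr0 add0r.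
Qed.

Definition exp_image c := forall w, exists a q : 'rV[R]_b, w *m B = x ^+ c *: a + y *: q.

(** As [x ^+ s] is a multiple of [y], the image would lie in y-multiples. Then every [a] has zero
    residue by [xy_free_row], and every [q] too because [y] is not a value, against fullness. *)
Lemma exp_image_lt_s : ~ exp_image s.
Proof.
move=> Ks; have [j jE] : exists j : 'I_b, true by exists (Ordinal b_gt0).
suff /matrixP/(_ j 0) : (delta_mx j 0 : 'cV[R]_b)^p = 0.
  by rewrite !mxE !eqxx rmorph1 => /eqP; rewrite oner_eq0.
apply: full_image_app => // a q w e.
have [a1 [q1 e1]] := Ks w.
have e2 : w *m B = y *: (q1 + (u' * y) *: a1).
  rewrite e1 scalerDr scalerA mulrCA yy mulrA (mulrC u') uu' mul1r addrC.
  by [].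
have [a0 q0] : a^p = 0 /\ (q1 + (u' * y) *: a1 - q)^p = 0.
  by apply: xy_free_row; rewrite scalerBr -e2 -e addrK.
split; first exact: app_res.
move/eqP: q0; rewrite map_mxB subr_eq0 => /eqP q0.
have H : p (app (q1 + (u' * y) *: a1) (delta_mx j 0)) = 0.
  by apply: (@y_part_m 1 0 _ w) => //; rewrite ?scaler0 ?add0r// /app mul0mx mxE.
have : p (app (q1 + (u' * y) *: a1 - q) (delta_mx j 0)) = 0.
  by apply: app_res; rewrite map_mxB q0 subrr.
by rewrite appBl rmorphB H sub0r => /eqP; rewrite oppr_eq0 => /eqP.
Qed.

Lemma exp_image_pivot : exists c w (a q : 'rV[R]_b),
  [/\ (0 < c)%N, (c < s)%N, exp_image c, w *m B = x ^+ c *: a + y *: q & a^p <> 0].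
Proof.
have [c [c0 Kc nKc]] : exists c, [/\ (0 < c)%N, exp_image c & ~ exp_image c.+1].
  apply: contrapT => H; apply: exp_image_lt_s.
  have K1 n : exp_image n.+1.
    elim: n => [|n IH]; first by move=> w; rewrite expr1; apply: split_image.
    by apply: contrapT => nK; apply: H; exists n.+1.
  by rewrite -(prednK gen_s_gt0); apply: K1.
have cs : (c < s)%N.
  rewrite ltnNge; apply/negP => sc; apply: exp_image_lt_s => w.
  have [a [q e]] := Kc w; exists (x ^+ (c - s) *: a), q.
  by rewrite scalerA -exprD subnKC.
have [w wP] : exists w, ~ exists a q : 'rV[R]_b, w *m B = x ^+ c.+1 *: a + y *: q.
  by apply: contrapT => H; apply: nKc => w; apply: contrapT => nw; apply: H; exists w.
have [a [q e]] := Kc w; exists c, w, a, q; split => // a0.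
apply: wP; have [a1 [a2 aE]] := split_row_xy m_xy a0; exists a1, q.
by rewrite e aE scalerDr !scalerA (exp_mul_y xy c0) scale0r addr0 -exprSr.
Qed.

Lemma unit_coord_functional n (a : 'rV[R]_n) : a^p <> 0 -> exists f, app a f = 1.
Proof.
move=> a0; have [j aj] : exists j, p (a 0 j) <> 0.
  apply: contrapT => H; apply: a0; apply/map_mx_eq0 => i j; rewrite ord1.
  by apply: contrapT => aj; apply: H; exists j.
have [e eE] := p_unit aj; exists (e *: delta_mx j 0).
by rewrite appZr app_delta mulrC.
Qed.

(* A row [x ^ c a + y q] of the image with [c] minimal is a pivot: any other one
   that is not congruent to a multiple of [x ^ c + mu y] would yield the value [y]. *)
Theorem scalar_image_of_not_y_value : exists c mu,
  [/\ (0 < c)%N, (c < s)%N, c = 1%N \/ p mu <> 0 & scalar_image (x ^+ c + mu * y)].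
Proof.
have [c [wg [a0 [q0 [c0 cs Kc gE a00]]]]] := exp_image_pivot.
have [f fE] := unit_coord_functional a00.
have [mu muE] : exists mu, mu = app q0 f by exists (app q0 f).
have [l lE] : exists l, l = x ^+ c + mu * y by exists (x ^+ c + mu * y).
exists c, mu; rewrite -lE.
(* Subtract the multiple of the pivot row that kills the x-part at [g]; what remains at [g] is a
   multiple of [y], which must not be a unit multiple. *)
have psi_eq (g : 'cV[R]_b) w a q : app a0 g = 1 -> w *m B = x ^+ c *: a + y *: q ->
    p (app q g) = p (app a g) * p (app q0 g).
  move=> g1 e; apply/eqP; rewrite -subr_eq0 -rmorphM -rmorphB; apply/eqP.
  rewrite -appZl -appBl; apply: (@y_part_m c (a - app a g *: a0) _ (w - app a g *: wg)) => //.
    rewrite mulmxBl e -scalemxAl gE !scalerBr !scalerDr !scalerA.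
    by rewrite !(mulrC (app a g)) addrACA opprD.
  by rewrite appBl appZl g1 mulr1 subrr.
have q0E (j : 'I_b) : p (q0 0 j) = p (a0 0 j) * p mu.
  have := @y_part_m c a0 q0 wg (delta_mx j 0 - a0 0 j *: f) c0 (esym gE).
  rewrite !appBr !appZr !app_delta fE mulr1 subrr => /(_ erefl)/eqP.
  by rewrite rmorphB subr_eq0 rmorphM -muE => /eqP.
have q_eq (w : 'rV_b') a q : w *m B = x ^+ c *: a + y *: q -> (q - mu *: a)^p = 0.
  move=> e; apply/map_mx_eq0 => i j; rewrite ord1 !mxE rmorphB rmorphM.
  have := psi_eq f w a q fE e; rewrite -muE => e1.
  have := psi_eq (delta_mx j 0 - a0 0 j *: f + f) w a q.
  rewrite !(appBr, appDr) !appZr !app_delta fE mulr1 subrr add0r -muE => /(_ erefl e).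
  rewrite !rmorphD !rmorphN !rmorphM q0E subrr add0r e1 => e2.
  have -> : p (q 0 j) = p (a 0 j) * p mu; last by rewrite mulrC subrr.
  apply: (addIr (- (p (a0 0 j) * (p (app a f) * p mu)) + p (app a f) * p mu)).
  by rewrite addrA e2; ring.
(* Socle corrections are absorbed by multiples of [l]. *)
have xs_l : x ^+ s = x ^+ (s - c) * l.
  rewrite lE mulrDr -exprD subnK ?(ltnW cs)// mulrCA exp_mul_y ?subn_gt0//.
  by rewrite mulr0 addr0.
have image_l (w : 'rV_b') : exists a, w *m B = l *: a.
  have [a [q e]] := Kc w; have [d dE] := gen_ann_scale xy (q_eq w a q e).
  exists (a + x ^+ (s - c) *: d).
  rewrite e scalerDr scalerA mulrC -(mulrC l) [l * _]mulrC -xs_l -dE lE scalerDl scalerBr.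
  by rewrite !scalerA (mulrC y mu) -addrA [_ + (_ - _)]addrC subrK.
(* It remains to see that every [l *: a] is in the image. Fullness shows that [T] has full residue,
   and a matrix of rows of [T] invertible modulo the maximal ideal is invertible. *)
pose T : set 'rV[R]_b := [set a | exists w, l *: a = w *m B].
have hT : submod T.
  split=> [|v v' [w e] [w' e']|a v [w e]].
  - by exists 0; rewrite mul0mx scaler0.
  - by exists (w + w'); rewrite mulmxDl scalerDr e e'.
  - by exists (a *: w); rewrite -scalemxAl scalerA mulrC -scalerA e.
have pair a q (w : 'rV_b') : x *: a + y *: q = w *m B -> exists t, [/\ T t, q^p = (mu *: t)^p &
    a^p = if c == 1%N then t^p else 0].
  move=> e; have [t tE] := image_l w; exists t.
  have e1 : x ^+ c *: t + (y * mu) *: t = x *: a + y *: q.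
    by rewrite e tE lE scalerDl (mulrC y).
  have [] := @xy_free_row _ (x ^+ (c - 1) *: t - a) (q - mu *: t).
    rewrite !scalerBr !scalerA -exprS -subSn// subn1 /=.
    by apply/eqP; rewrite subr_eq addrAC eq_sym subr_eq e1 addrC.
  rewrite !map_mxB => /eqP; rewrite subr_eq0 => /eqP <- /eqP; rewrite subr_eq0 => /eqP ->.
  split => //; first by exists w.
  have [->|c1] := eqVneq c 1%N; first by rewrite scale1r.
  rewrite (_ : (c - 1 = (c - 2).+1)%N); last by lia.
  by rewrite exprS -scalerA map_mxZ px scale0r.
have T_full : row_full (resmx T).
  rewrite -col_leq_rank -[X in (X <= _)%N]full; apply: mxrankS; rewrite addsmx_sub.
  have [T0 _ TZ] := hT.
  apply/andP; split.
    apply: (resmx_sub (exp_module_submod _ _ _ _) hT) => a [q [w e]].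
    rewrite expr1 in e; have [t [Tt _ ->]] := pair _ _ _ e.
    by case: eqP => _; [exists t|exists 0; rewrite ?map_mx0].
  apply: (resmx_sub (y_module_submod _) hT) => q [a [w e]].
  by have [t [Tt -> _]] := pair _ _ _ e; exists (mu *: t) => //; apply: (TZ).
split => //.
  have [|c1] := eqVneq c 1%N; [by left|right => mu0].
  have [j jE] : exists j : 'I_b, true by exists (Ordinal b_gt0).
  suff /matrixP/(_ j 0) : (delta_mx j 0 : 'cV[R]_b)^p = 0.
    by rewrite !mxE !eqxx rmorph1 => /eqP; rewrite oner_eq0.
  apply: full_image_app => // a q w e; have [t [_ q0' a0']] := pair _ _ _ e.
  by split; apply: app_res; rewrite ?q0' ?a0' ?(negPf c1)// map_mxZ mu0 scale0r.
move=> v; split; first by move=> [w ->].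
move=> [a ->].
have Tb : (b <= sdim T)%N by rewrite col_leq_rank.
have [W TW Wf] := sdim_free hT Tb.
have [N [_ NW]] := residue_unitmx (etrans (esym (row_free_unit _)) Wf).
have [w wE] : T a by rewrite -[a]mulmx1 -NW mulmxA; apply: submod_mulmx.
by exists w.
Qed.

End Image.

(** * Images of scalar matrices *)

Section ScalarImage.

Lemma scalar_image_minors b' b (B : 'M[R]_(b', b)) l r : scalar_image B l ->
  minors_ideal B r = minors_ideal (l%:M : 'M_b) r.
Proof.
move=> Bl.
have rowB (w : 'rV_b') : exists a, w *m B = l *: a by apply/Bl; exists w.
have rowl (a : 'rV_b) : exists w, l *: a = w *m B by apply/Bl; exists a.
have [f fE] := choice (fun i => rowB (delta_mx 0 i)).
have [g gE] := choice (fun i => rowl (delta_mx 0 i)).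
have Bf : B = (\matrix_i f i) *m l%:M.
  by apply/row_matrixP => i; rewrite row_mul rowK mul_mx_scalar -fE -rowE.
have Bg : l%:M = (\matrix_i g i) *m B.
  by apply/row_matrixP => i; rewrite row_mul rowK -gE rowE mul_mx_scalar.
by apply/seteqP; split; [rewrite Bf|rewrite Bg]; apply: minors_ideal_mul_sub.
Qed.

Variables (b : nat -> nat) (A : forall n, 'M[R]_(b n.+1, b n)).
Hypothesis A_min : minimal_complex A.

(** Write [A n = l *: Z] and [C *m A n = l%:M]. Exactness and minimality make [Z] and [C] mutually
    inverse modulo the maximal ideal, so the ranks agree, and the cycles are the rows [v] for which
    [l] kills [v *m Z]. *)
Lemma scalar_image_next n l l' : p l = 0 ->
  (forall t, l * t = 0 <-> exists d, t = l' * d) -> p l' = 0 ->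
  scalar_image (A n) l -> b n.+1 = b n /\ scalar_image (A n.+1) l'.
Proof.
move=> pl ann_l pl' Al.
have l'0 : l * l' = 0 by apply/ann_l; exists 1; rewrite mulr1.
have ann_m t : l * t = 0 -> p t = 0 by move=> /ann_l[d ->]; rewrite rmorphM pl' mul0r.
have rowA (w : 'rV_(b n.+1)) : exists a, w *m A n = l *: a by apply/Al; exists w.
have rowl (a : 'rV_(b n)) : exists w, l *: a = w *m A n by apply/Al; exists a.
have [f fE] := choice (fun i => rowA (delta_mx 0 i)).
have [g gE] := choice (fun i => rowl (delta_mx 0 i)).
have [Z ZE] : exists Z, A n = l *: Z.
  exists (\matrix_i f i); apply/row_matrixP => i.
  by rewrite linearZ/= rowK -fE -rowE.
have [C CE] : exists C, C *m A n = l%:M.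
  exists (\matrix_i g i); apply/row_matrixP => i.
  by rewrite row_mul rowK -gE rowE mul_mx_scalar.
have CZ : C^p *m Z^p = 1%:M.
  apply/eqP; rewrite eq_sym -subr_eq0 -map_mxM -(map_mx1 p) -map_mxB; apply/eqP.
  apply/map_mx_eq0 => i j; apply: ann_m.
  have : l *: (1%:M - C *m Z) = 0.
    by rewrite scalerBr scalemx1 -CE {1}ZE -!scalemxAr subrr.
  by move=> /matrixP/(_ i j); rewrite mxE [RHS]mxE.
have ker_m (w : 'rV_(b n.+1)) : w *m A n = 0 -> w^p = 0.
  by apply: (complex_ker_residue A_min).
have ZC : Z^p *m C^p = 1%:M.
  apply/eqP; rewrite eq_sym -subr_eq0 -map_mxM -(map_mx1 p) -map_mxB; apply/eqP.
  apply/row_matrixP => i; rewrite row0 -map_row; apply: ker_m.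
  rewrite -row_mul mulmxBl mul1mx -mulmxA CE mul_mx_scalar -ZE subrr row0.
  by [].
split.
  apply/eqP; rewrite eqn_leq; apply/andP; split.
    by have := mxrankM_maxl Z^p C^p; rewrite ZC mxrank1 => /leq_trans; apply; apply: rank_leq_col.
  by have := mxrankM_maxl C^p Z^p; rewrite CZ mxrank1 => /leq_trans; apply; apply: rank_leq_col.
have [N [NZ _]] := residue_unitmx (M := Z *m C) ltac:(by rewrite map_mxM ZC unitmx1).
move=> v; split.
  move=> [w ->]; have := complex_image A_min w; rewrite {1}ZE -scalemxAr => lw.
  have [d dE] : exists d, w *m A n.+1 *m Z = l' *: d.
    have H j : exists c, (w *m A n.+1 *m Z) 0 j = l' * c.
      by apply/ann_l; have /rowP/(_ j) := lw; rewrite mxE [RHS]mxE.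
    by have [h hE] := row_choice H; exists h; apply/rowP => j; rewrite hE !mxE.
  exists (d *m C *m N).
  by rewrite -[LHS]mulmx1 -NZ !mulmxA dE -!scalemxAl.
move=> [a ->]; apply: (complex_ker A_min).
by rewrite ZE -scalemxAl -scalemxAr scalerA mulrC l'0 scale0r.
Qed.

End ScalarImage.

Section ScalarAnnihilator.
Variables (c : nat) (mu : R).
Hypothesis c_gt0 : (0 < c)%N.
Hypothesis c_lt_s : (c < s)%N.
Hypothesis c_mu : c = 1%N \/ p mu <> 0.

Let l := x ^+ c + mu * y.
(** Chosen so that in [l * l'] the terms [mu * y * y] and [u * mu * x ^+ s] cancel, all others being
    zero by [x * y = 0]. As in a matrix factorization, [l] and [l'] generate each other's
    annihilator, whence the period 2. *)
Let l' := y - u * mu * x ^+ (s - c).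

Let y_xi i : (0 < i)%N -> y * x ^+ i = 0.
Proof. by rewrite mulrC; apply: exp_mul_y. Qed.

Lemma residue_scalar : p l = 0 /\ p l' = 0.
Proof.
have xi i : (0 < i)%N -> p (x ^+ i) = 0 by case: i => // i _; rewrite exprS rmorphM px mul0r.
by rewrite /l /l' rmorphD rmorphB !rmorphM py !xi ?subn_gt0// !mulr0 addr0 subr0.
Qed.

Lemma scalar_mul0 : l * l' = 0.
Proof.
have e1 := y_xi c_gt0; have e2 : y * x ^+ (s - c) = 0 by apply: y_xi; rewrite subn_gt0.
have e3 : x ^+ c * x ^+ (s - c) = x ^+ s by rewrite -exprD subnKC// ltnW.
have -> : l * l' = y * x ^+ c + mu * (y * y) - u * mu * (x ^+ c * x ^+ (s - c))
   - u * mu * mu * (y * x ^+ (s - c)) by rewrite /l /l'; ring.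
by rewrite e1 e2 e3 yy; ring.
Qed.

Lemma scalar_ann t : l * t = 0 <-> exists d, t = l' * d.
Proof.
split=> [lt|[d ->]]; last by rewrite mulrA scalar_mul0 mul0r.
have e1 := y_xi c_gt0; have sc : (0 < s - c)%N by rewrite subn_gt0.
have [|a [d tE]] := @m_xy t.
  apply: contrapT => /p_unit[t' t'E]; apply: gen_xs_neq0.
  have : l = 0 by rewrite -[l]mulr1 -t'E mulrA lt mul0r.
  move=> l0; rewrite -(subnK (ltnW c_lt_s)) exprD.
  have -> : x ^+ c = l - mu * y by rewrite /l addrK.
  by rewrite l0 sub0r mulrN mulrCA (exp_mul_y xy sc) mulr0 oppr0.
(* With [t = x * a + y * d], the product [l * t] is [x ^+ c.+1] times the displayed combination;
   solving for [a] gives [t = l' * d + x ^+ (s - c).+1 * z]. *)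
have [|z [t' [aE xt']]] := @gen_ann_exp (s - c) (a + mu * u * x ^+ (s - c - 1) * d) (leq_subr _ _).
  rewrite subSn ?leq_subr// subKn ?(ltnW c_lt_s)//.
  have e3 : x ^+ c.+1 * x ^+ (s - c - 1) = x ^+ s by rewrite -exprD; congr (_ ^+ _); lia.
  rewrite -[RHS]lt tE mulrDr -[x ^+ c.+1 * (_ * _ * _)](_ : mu * u * (x ^+ c.+1 * x ^+ (s - c - 1)) * d = _); last by ring.
  rewrite e3 -[mu * u * _]mulrA -yy /l exprS.
  have -> : (x ^+ c + mu * y) * (x * a + y * d) =
    x * x ^+ c * a + (y * x ^+ c) * d + mu * a * (x * y) + mu * (y * y) * d by ring.
  by rewrite e1 xy; ring.
have [d' t'E] := ann_y xt'.
have e4 : x * x ^+ (s - c - 1) = x ^+ (s - c) by rewrite -exprS; congr (_ ^+ _); lia.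
(* The remaining power of [x] is a multiple of [l']: for [c = 1] it is the socle, reached by
   multiplying with [y]; otherwise [mu] is a unit and [x * l'] is a unit times that power. *)
have [e eE] : exists e, x ^+ (s - c).+1 * z = l' * e.
  case: c_mu => [c1|/p_unit[mu' muE]].
    exists (u' * y * z); rewrite c1 subn1 (ltn_predK s_ge2) /l' c1.
    have -> : x ^+ s = u' * (y * y) by rewrite yy mulrA (mulrC u') uu' mul1r.
    have e5 := y_xi sc; rewrite c1 in e5.
    have -> : (y - u * mu * x ^+ (s - 1)) * (u' * y * z) =
      u' * (y * y) * z - u * mu * u' * z * (y * x ^+ (s - 1)) by ring.
    by rewrite e5 mulr0 subr0.
  exists (- (mu' * u' * x * z)); rewrite /l' exprS.
  have -> : (y - u * mu * x ^+ (s - c)) * - (mu' * u' * x * z) =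
    (u * u') * (mu * mu') * (x * x ^+ (s - c) * z) - (x * y) * (mu' * u' * z) by ring.
  by rewrite uu' muE xy; ring.
exists (d + e); rewrite mulrDr -eE tE.
have -> : x * a = x * (a + mu * u * x ^+ (s - c - 1) * d) - mu * u * (x * x ^+ (s - c - 1)) * d by ring.
by rewrite aE e4 t'E /l' mulrDr (mulrA x y) xy exprS; ring.
Qed.

Lemma scalar_ann' t : l' * t = 0 <-> exists d, t = l * d.
Proof.
split=> [lt|[d ->]]; last by rewrite mulrA (mulrC l') scalar_mul0 mul0r.
have e1 := y_xi c_gt0; have sc : (0 < s - c)%N by rewrite subn_gt0.
have e2 := y_xi sc.
have [|a [d tE]] := @m_xy t.
  apply: contrapT => /p_unit[t' t'E]; apply: gen_xs_neq0.
  have : l' = 0 by rewrite -[l']mulr1 -t'E mulrA lt mul0r.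
  move=> l0; have : y * l' = u * x ^+ s.
    by rewrite /l' mulrBr yy mulrCA e2 mulr0 subr0.
  by rewrite l0 mulr0 => /esym e; rewrite -[LHS]mul1r -uu' mulrAC e mul0r.
(* Here [l' * t] is [u * x ^+ (s - c).+1] times the displayed combination. *)
have [|z [t' [aE xt']]] := @gen_ann_exp c (x ^+ (c - 1) * d - mu * a) (ltnW c_lt_s).
  rewrite subSn ?(ltnW c_lt_s)//.
  have e3 : x ^+ (s - c).+1 * x ^+ (c - 1) = x ^+ s by rewrite -exprD; congr (_ ^+ _); lia.
  have -> : x ^+ (s - c).+1 * (x ^+ (c - 1) * d - mu * a) = u' * ((l' * t)).
    rewrite tE mulrBr [x ^+ _ * (_ * d)]mulrA e3 /l' exprS.
    have -> : u' * ((y - u * mu * x ^+ (s - c)) * (x * a + y * d)) =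
       u' * (y * y) * d - (u * u') * (mu * (x * x ^+ (s - c) * a)) + u' * a * (x * y)
       - u' * u * mu * d * (y * x ^+ (s - c)) by ring.
    rewrite uu' xy e2 yy.
    have -> : u' * (u * x ^+ s) = (u * u') * x ^+ s by ring.
    by rewrite uu'; ring.
  by rewrite lt mulr0.
have [d' t'E] := ann_y xt'.
case: c_mu => [c1|/p_unit[mu' muE]].
  have xs : x ^+ s = x ^+ (s - 1) * l.
    rewrite /l c1 mulrDr -exprD subnK ?(ltnW s_ge2)//.
    by rewrite mulrCA (exp_mul_y xy) ?mulr0 ?addr0//; lia.
  exists (a + u * x ^+ (s - 1) * d'); rewrite mulrDr.
  have -> : l * (u * x ^+ (s - 1) * d') = u * (x ^+ (s - 1) * l) * d' by ring.
  rewrite -xs -yy tE /l c1 !expr1.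
  have -> : d = mu * a + (x * z + y * d').
    by rewrite -t'E -[x]expr1 -{1}c1 -aE c1 subnn mul1r addrC subrK.
  have -> : y * (mu * a + (x * z + y * d')) = mu * a * y + (x * y) * z + y * y * d' by ring.
  by rewrite xy; ring.
have e4 : x * x ^+ (c - 1) = x ^+ c by rewrite -exprS; congr (_ ^+ _); lia.
exists (mu' * d - mu' * x * z); rewrite tE.
have -> : x * a = mu' * (x * x ^+ (c - 1)) * d - mu' * x * (x ^+ (c - 1) * d - mu * a) +
   (1 - mu * mu') * (x * a) by ring.
rewrite muE subrr mul0r addr0 e4 aE t'E /l.
have -> : (x ^+ c + mu * y) * (mu' * d - mu' * x * z) =
  mu' * x ^+ c * d - mu' * x * x ^+ c * z + (mu * mu') * y * d - (mu * mu' * z) * (x * y) by ring.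
have -> : mu' * x * (x ^+ c * z + y * d') = mu' * x * x ^+ c * z + mu' * d' * (x * y) by ring.
by rewrite muE xy; ring.
Qed.

Variables (b : nat -> nat) (A : forall n, 'M[R]_(b n.+1, b n)).
Hypothesis A_min : minimal_complex A.

Lemma scalar_image_periodic n r : scalar_image (A n) l -> minors_periodic A r.
Proof.
move=> An; exists n => m nm; have [pl pl'] := residue_scalar.
pose e (q : bool) := if q then l' else l.
suff H : b m.+2 = b m /\ exists q, scalar_image (A m) (e q) /\ scalar_image (A m.+2) (e q).
  have [bm [q [h1 h2]]] := H.
  rewrite (scalar_image_minors _ h1) (scalar_image_minors _ h2).
  by rewrite bm.
have step1 i : scalar_image (A i) l -> b i.+1 = b i /\ scalar_image (A i.+1) l'.
  exact: (scalar_image_next A_min pl scalar_ann pl').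
have step2 i : scalar_image (A i) l' -> b i.+1 = b i /\ scalar_image (A i.+1) l.
  exact: (scalar_image_next A_min pl' scalar_ann' pl).
have step q i : scalar_image (A i) (e q) -> b i.+1 = b i /\ scalar_image (A i.+1) (e (~~ q)).
  by case: q => /=; [apply: step2|apply: step1].
have [q Am] : exists q, scalar_image (A m) (e q).
  rewrite -(subnK nm); elim: (m - n)%N => [|j [q IH]]; first by exists false.
  by exists (~~ q); rewrite addSn; have [] := step _ _ IH.
have [b1 Am1] := step _ _ Am; have [b2 Am2] := step _ _ Am1.
by split; [rewrite b2 b1|exists q; rewrite negbK in Am2].
Qed.

End ScalarAnnihilator.

Lemma det_mx22 (M : 'M[R]_2) : \det M = M 0 0 * M 1 1 - M 0 1 * M 1 0.
Proof.
rewrite (expand_det_row M 0) !big_ord_recl big_ord0 addr0 /cofactor !det_mx11 !mxE /=.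
rewrite expr0 expr1 mul1r mulN1r mulrN; congr (_ * M _ _ - M _ _ * M _ _).
all: by apply: val_inj.
Qed.

Lemma minors2_wedge b' b (B : 'M[R]_(b', b)) w1 w2 f g :
  minors_ideal B 2 (app (w1 *m B) f * app (w2 *m B) g - app (w1 *m B) g * app (w2 *m B) f).
Proof.
pose V : 'M[R]_(2, b) := \matrix_i (if i == 0 then w1 *m B else w2 *m B).
pose D : 'M[R]_(b, 2) := \matrix_(i, j) (if j == 0 then f i 0 else g i 0).
have -> : app (w1 *m B) f * app (w2 *m B) g - app (w1 *m B) g * app (w2 *m B) f = \det (V *m D).
  have E i j : (V *m D) i j = app (row i V) (col j D) by rewrite /app -row_mul !mxE; apply: eq_bigr => l _; rewrite !mxE.
  have D0 : col 0 D = f by apply/colP => i; rewrite !mxE.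
  have D1 : col 1 D = g by apply/colP => i; rewrite !mxE.
  by rewrite det_mx22 !E D0 D1 !rowK.
apply: minors_ideal_rowspace => i; rewrite rowK.
by case: eqP => _; [exists w1|exists w2].
Qed.

(** Multiply by [x] while the product is nonzero. The last nonzero product is annihilated by [x],
    hence is [y * d]: for a unit [d] multiply by [y], otherwise it is already a unit times
    [x ^+ s]. *)
Lemma socle_in_ideal (I : set R) z : ideal I -> I z -> z <> 0 -> I (x ^+ s).
Proof.
move=> hI.
have unit_in a : p a <> 0 -> I (x ^+ s * a) -> I (x ^+ s).
  move=> /p_unit[a' aE] Ia; rewrite -[x ^+ s]mulr1 -aE mulrA mulrC.
  exact: (idealMl _ hI).
have mul_in a z' : p z' <> 0 -> I (a * z') -> I a.
  move=> /p_unit[a' aE] Ia; rewrite -[a]mulr1 -aE mulrA mulrC.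
  exact: (idealMl _ hI).
have y_in d : I (y * d) -> y * d <> 0 -> I (x ^+ s).
  move=> Iyd yd; have [d0|/mul_in H] := pselect (p d = 0).
    have [c [c' cE]] := m_xy d0.
    have ydE : y * d = x ^+ s * (u * c') by rewrite cE mulrDr !mulrA yy (mulrC y) xy; ring.
    apply: (unit_in (u * c')); last by rewrite -ydE.
    by move=> uc; apply: yd; rewrite ydE gen_xs_m.
  have -> : x ^+ s = u' * y * y by rewrite -mulrA yy mulrA (mulrC u') uu' mul1r.
  by apply: (idealMl _ hI); apply: H.
suff H n z' : x ^+ n * z' = 0 -> I z' -> z' <> 0 -> I (x ^+ s).
  by apply: (H s.+1); rewrite gen_xs1 mul0r.
elim: n z' => [|n IH] z'; first by rewrite mul1r => ->.
have [xz _ Iz z0|xz] := pselect (x * z' = 0).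
  by have [d dE] := ann_y xz; rewrite dE in Iz z0; apply: (y_in d).
by rewrite exprSr -mulrA => xn Iz _; apply: (IH (x * z')) => //; apply: (idealMl _ hI).
Qed.

(** The ideal [x R] is [R] modulo its annihilator [y R], a ring whose maximal ideal is generated by
    the nilpotent [x]; its elements are totally ordered by divisibility. *)
Lemma exp_comparable j a a' : (0 < j)%N ->
  (exists r, x ^+ j * a = r * (x ^+ j * a')) \/ (exists r, x ^+ j * a' = r * (x ^+ j * a)).
Proof.
move=> j0; have [n nE] : exists n, (s.+1 <= j + n)%N by exists s.+1; apply: leq_addl.
elim: n j j0 nE a a' => [|n IH] j j0 nE a a'.
  left; exists 0; rewrite addn0 in nE.
  by rewrite -(subnK nE) exprD gen_xs1 mulr0 !mul0r.
have unit_case c c' : p c <> 0 -> exists r, x ^+ j * c' = r * (x ^+ j * c).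
  by move=> /p_unit[d dE]; exists (c' * d); rewrite mulrCA -(mulrA c') (mulrC d) dE mulr1.
have [a0|/unit_case H] := pselect (p a = 0); last by right; apply: H.
have [a'0|/unit_case H] := pselect (p a' = 0); last by left; apply: H.
have [c [t [-> xt]]] := gen_split a0; have [c' [t' [-> xt']]] := gen_split a'0.
rewrite !mulrDr (gen_exp_ann j0 xt) (gen_exp_ann j0 xt') !addr0 !mulrA -exprSr.
by apply: (IH j.+1); rewrite // addSnnS.
Qed.

(** * Vanishing 2-minors in rank at least three *)

Section Image.
Variables (b' b : nat) (B : 'M[R]_(b', b)).
Hypothesis B0 : B^p = 0.
Hypothesis full : full_image B.
Hypothesis minors0 : forall z, minors_ideal B 2 z -> z = 0.

Let rel a q := exists w : 'rV_b', x *: a + y *: q = w *m B.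

Lemma rel_wedge a q a' q' f g : rel a q -> rel a' q' ->
  x ^+ 2 * (app a f * app a' g - app a g * app a' f) +
  u * x ^+ s * (app q f * app q' g - app q g * app q' f) = 0.
Proof.
move=> [w e] [w' e']; rewrite -(minors0 (minors2_wedge w w' f g)) -yy -e -e'.
rewrite !appDl !appZl.
have -> : (x * app a f + y * app q f) * (x * app a' g + y * app q' g) -
   (x * app a g + y * app q g) * (x * app a' f + y * app q' f) =
  x ^+ 2 * (app a f * app a' g - app a g * app a' f) +
  y * y * (app q f * app q' g - app q g * app q' f) +
  (x * y) * (app a f * app q' g + app q f * app a' g - app a g * app q' f - app q g * app a' f).
  by ring.
by rewrite xy mul0r addr0.
Qed.

Lemma usocle_eq0 t : u * x ^+ s * t = 0 -> p t = 0.
Proof.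
move=> e; apply: gen_xs_eq0.
by rewrite -[LHS]mul1r -uu' (mulrC u) -!mulrA (mulrA u) e mulr0.
Qed.

Lemma x2_eq0 t : x ^+ 2 * t = 0 -> p t = 0.
Proof.
move=> e; apply: gen_xs_eq0.
by rewrite -(subnK s_ge2) exprD -mulrA e mulr0.
Qed.

(* Otherwise some functional [f] is [1] on [e] and vanishes on the residue of
   [y_module]; wedging with [e] shows that all [a] are multiples of [e], and then
   that all [q] are proportional. *)
Lemma rank3_exp_sub_y : (3 <= b)%N ->
  (resmx (exp_module x y B 1) <= resmx (y_module B))%MS.
Proof.
move=> b3; have [Y YE] : exists Y, Y = resmx (y_module B) by eexists.
rewrite -YE; apply/rV_subP => _ /(resmxP _ (exp_module_submod _ _ _ _))[e [qe [we ee]] ->].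
rewrite expr1 in ee.
apply/negPn/negP => eY.
have [f fE] : exists f : 'cV[R]_b, app e f = 1 /\ forall a q, rel a q -> p (app q f) = 0.
  have [j je] : exists j, (e^p *m cokermx Y) 0 j != 0.
    by apply/rV0Pn; rewrite -submxE.
  have [h hE] := resmx_lift (col j (cokermx Y))^T.
  have hE' v : p (app v h^T) = (v^p *m cokermx Y) 0 j.
    have -> : p (app v h^T) = (v^p *m (h^T)^p) 0 0 by rewrite -map_mxM mxE.
    by rewrite -map_trmx hE trmxK !mxE; apply: eq_bigr => i _; rewrite !mxE.
  have [|c cE] := @p_unit (app e h^T); first by rewrite hE'; apply/eqP.
  exists (c *: h^T); rewrite appZr mulrC cE; split => // a q [w rw].
  rewrite appZr rmorphM hE'.
  have /eqP -> : q^p *m cokermx Y == 0; last by rewrite mxE mulr0.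
  by rewrite -submxE YE; apply/(resmxP _ (y_module_submod _)); exists q => //; exists a, w.
have [fe fq] := fE.
have re : rel e qe by exists we.
have x2 a q g : rel a q -> x ^+ 2 * app a g = app a f * (x ^+ 2 * app e g).
  move=> r; have := rel_wedge f g re r; rewrite fe mul1r.
  have -> : u * x ^+ s * (app qe f * app q g - app qe g * app q f) =
    u * (x ^+ s * app qe f) * app q g - u * (x ^+ s * app q f) * app qe g by ring.
  rewrite !gen_xs_m ?(fq _ _ re) ?(fq _ _ r)// !mulr0 !mul0r subrr addr0.
  by rewrite mulrBr => /eqP; rewrite subr_eq0 => /eqP ->; ring.
have qq a q a' q' g h : rel a q -> rel a' q' -> p (app q g) * p (app q' h) = p (app q h) * p (app q' g).
  move=> r r'; have := rel_wedge g h r r'.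
  have -> : x ^+ 2 * (app a g * app a' h - app a h * app a' g) = 0.
    rewrite mulrBr !mulrA (x2 _ _ g r) (x2 _ _ h r).
    have -> : app a f * (x ^+ 2 * app e g) * app a' h = app a f * app e g * (x ^+ 2 * app a' h) by ring.
    have -> : app a f * (x ^+ 2 * app e h) * app a' g = app a f * app e h * (x ^+ 2 * app a' g) by ring.
    by rewrite (x2 _ _ g r') (x2 _ _ h r'); ring.
  rewrite add0r => /usocle_eq0; rewrite rmorphB !rmorphM => /eqP.
  by rewrite subr_eq0 => /eqP.
have [q1 [r1 r1E]] : exists q1, (exists a1, rel a1 q1) /\
    (q1^p = 0 -> forall a q, rel a q -> q^p = 0).
  have [[q1 [a1 [r1 q10]]]|H] := pselect (exists q1 a1, rel a1 q1 /\ q1^p <> 0).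
    by exists q1; split => //; exists a1.
  exists qe; split; first by exists e.
  by move=> _ a q r; apply: contrapT => q0; apply: H; exists q, a.
have [fk [fk0 ek qk]] := wide_common_kernel e^p q1^p b3.
have [h hE] := resmx_lift fk^T.
have hk v : p (app v h^T) = (v^p *m fk) 0 0.
  have -> : p (app v h^T) = (v^p *m (h^T)^p) 0 0 by rewrite -map_mxM mxE.
  by rewrite -map_trmx hE trmxK.
apply: fk0; rewrite -[fk]trmxK -hE map_trmx; apply: (full_image_app full).
move=> a q w r; have {}r : rel a q by exists w.
have eh : p (app e h^T) = 0 by rewrite hk ek mxE.
split.
  have := x2 _ _ h^T r; rewrite mulrCA => /eqP; rewrite -subr_eq0 -mulrBr => /eqP/x2_eq0/eqP.
  by rewrite rmorphB rmorphM eh mulr0 subr0 => /eqP.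
have [q10|q10] := pselect (q1^p = 0); first by rewrite hk (r1E q10 _ _ r) mul0mx mxE.
have [g gE] := unit_coord_functional q10; have [a1 ra1] := r1.
have := qq _ _ _ _ g h^T ra1 r; rewrite gE rmorph1 mul1r => ->.
by rewrite hk qk mxE mul0r.
Qed.

(** The row carrying the value [y] has [app q0 f] a unit and [x ^+ 2 * app a0 f = 0]. Wedging it
    with two rows whose y-parts are independent and vanish at [f] modulo m expresses both, up to the
    socle factor, through the one functional [app a0]; their coefficients are comparable, which
    contradicts independence. *)
Lemma rank3_minors2 : (3 <= b)%N -> y_value B -> False.
Proof.
move=> b3 [w0 [f w0f]].
have [a0 [q0 e0]] := split_image B0 w0.
have Yfull : row_full (resmx (y_module B)).
  rewrite -col_leq_rank -[X in (X <= _)%N]full; apply: mxrankS; rewrite addsmx_sub.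
  by rewrite rank3_exp_sub_y//= submx_refl.
have r0 : rel a0 q0 by exists w0.
have e1 : x * app a0 f = y * (1 - app q0 f).
  by rewrite mulrBr mulr1 -{1}w0f e0 appDl !appZl addrK.
have [_ /eqP] := xy_free e1.
rewrite rmorphB rmorph1 subr_eq0 eq_sym => /eqP q0f.
have x2a0 : x ^+ 2 * app a0 f = 0 by rewrite exprS -mulrA expr1 e1 mulrA xy mul0r.
pose G : set 'rV[R]_b := [set q | (exists a, rel a q) /\ p (app q f) = 0].
have hG : submod G.
  have [h0 hD hZ] := y_module_submod B.
  split=> [|q q' [rq qf] [rq' qf']|c q [rq qf]].
  - by split; [exact: h0|rewrite /app mul0mx mxE rmorph0].
  - by split; [exact: hD|rewrite appDl rmorphD qf qf' addr0].
  - by split; [exact: hZ|rewrite appZl rmorphM qf mulr0].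
have G2 : (2 <= sdim G)%N.
  have : (kermx f^p <= resmx G)%MS.
    apply/rV_subP => v /sub_kermxP vf.
    have : (v <= resmx (y_module B))%MS by apply: submx_full.
    move=> /(resmxP _ (y_module_submod _))[q rq vq].
    apply/(resmxP _ hG); exists q => //; split => //.
    by move/matrixP/(_ 0 0): vf; rewrite vq -map_mxM mxE [RHS]mxE.
  move=> /mxrankS; rewrite mxrank_ker; have := rank_leq_col f^p.
  by rewrite /sdim; lia.
have [W GW Wf] := sdim_free hG G2.
have [D WD] := residue_row_free Wf.
have WDij i j : app (row i W) (col j D) = (i == j)%:R.
  by have /matrixP/(_ i j) := WD; rewrite /app colE rowE !mxE => <-;
     apply: eq_bigr => l _; rewrite -colE -rowE !mxE.
have key i : exists a, forall g, u * x ^+ s * (app q0 f * app (row i W) g) = (x ^+ 2 * app a f) * app a0 g.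
  have [[a ra] qf] := GW i; exists a => g.
  have := rel_wedge f g r0 ra; rewrite [x ^+ 2 * (_ - _)]mulrBr [x ^+ 2 * (app a0 f * _)]mulrA x2a0 mul0r sub0r.
  rewrite [u * x ^+ s * (_ - _)]mulrBr.
  have -> : u * x ^+ s * (app q0 g * app (row i W) f) = u * app q0 g * (x ^+ s * app (row i W) f) by ring.
  rewrite (gen_xs_m qf) mulr0 subr0 addrC => /eqP; rewrite subr_eq0 => /eqP ->.
  by ring.
have dep (i j : 'I_2) r : i != j -> (forall g, u * x ^+ s * (app q0 f * app (row i W) g) =
     r * (u * x ^+ s * (app q0 f * app (row j W) g))) -> False.
  move=> ij /(_ (col i D)); rewrite !WDij eqxx (eq_sym j) (negPf ij) !mulr0 mulr1.
  by move=> /usocle_eq0; rewrite q0f => /eqP; rewrite oner_eq0.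
have [a1 k1] := key 0; have [a2 k2] := key 1.
have [[r rE]|[r rE]] := exp_comparable (app a1 f) (app a2 f) (ltn0Sn 1).
  by apply: (@dep 0 1 r) => // g; rewrite k1 k2 rE -mulrA.
by apply: (@dep 1 0 r) => // g; rewrite k1 k2 rE -mulrA.
Qed.

End Image.

(** * Two generators: rank two and the conclusion *)

Section TwoGeneratorsPeriodic.

(** The alternating matrix of order 2; [J *m A^T *m J] is minus the adjugate of [A], and
    [J_congruence] says that it gives the determinant. *)
Let J : 'M[R]_2 := \matrix_(i, j) ((j : nat)%:R - (i : nat)%:R).

Lemma J_mulJ : J *m J = - 1%:M.
Proof.
apply/matrixP => i j; rewrite !mxE !big_ord_recl big_ord0 !mxE /=.
have b1 : bump 0 0 = 1%N by [].
by case: i j => [[|[|//]] ?] [[|[|//]] ?] /=; rewrite b1; ring.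
Qed.

Lemma J_congruence (A : 'M[R]_2) : A^T *m J *m A = \det A *: J.
Proof.
apply/matrixP => i j; rewrite det_mx22 !mxE !big_ord_recl !big_ord0 !mxE /=.
rewrite !big_ord_recl !big_ord0 !mxE /=.
have -> : lift ord0 ord0 = 1 :> 'I_2 by apply: val_inj.
have H (i0 : 'I_2) : i0 = 0 \/ i0 = 1.
  by case: i0 => [[|[|//]] ?]; [left|right]; apply: val_inj.
by case: (H i) => ->; case: (H j) => -> /=; ring.
Qed.

Lemma m2_x2 z z' : p z = 0 -> p z' = 0 -> exists c, z * z' = x ^+ 2 * c.
Proof.
move=> /m_xy[a [d ->]] /m_xy[a' [d' ->]].
exists (a * a' + u * x ^+ (s - 2) * d * d').
have e : x ^+ s = x ^+ 2 * x ^+ (s - 2) by rewrite -exprD subnKC.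
have -> : (x * a + y * d) * (x * a' + y * d') =
  x ^+ 2 * a * a' + y * y * d * d' + (x * y) * (a * d' + d * a') by ring.
by rewrite yy e xy; ring.
Qed.

(* The rows of the adjugate of [A] lie in the kernel of [A] and, as [A] is
   full, generate it. *)
Lemma rank2_det0 (A B : 'M[R]_2) : A^p = 0 -> B^p = 0 -> full_image A ->
  (forall v : 'rV_2, v *m A = 0 -> exists w, v = w *m B) -> \det A = 0 -> \det B = 0.
Proof.
move=> A0 B0 full kerA dA.
pose E := J *m A^T *m J.
have EA : E *m A = 0 by rewrite /E -!mulmxA (mulmxA A^T) J_congruence dA scale0r mulmx0.
have H i : exists w, row i E = w *m B by apply: kerA; rewrite -row_mul EA row0.
have [f fE] := choice H.
have [D DE] : exists D, E = D *m B.
  exists (\matrix_i f i); apply/row_matrixP => i.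
  by rewrite row_mul rowK fE.
have [Du|nDu] := boolP (D^p \in unitmx).
  have [N [_ ND]] := residue_unitmx Du.
  have -> : B = N *m E by rewrite DE mulmxA ND mul1mx.
  by rewrite !det_mulmx det_tr dA mulr0 mul0r mulr0.
(* If [D] is singular modulo m, some [h] of nonzero residue has [h *m E] in m^2, a multiple of
   [x ^+ 2]. Transposing, [A] sends the column [(h *m J)^T] into multiples of [x ^+ 2], and fullness
   makes its residue zero. *)
have : kermx D^p != 0 by rewrite kermx_eq0 row_free_unit.
move=> /rowV0Pn[h' /sub_kermxP hD /eqP h0].
have [h hE] := resmx_lift h'; rewrite -hE in hD h0.
have [c cE] : exists c, h *m E = x ^+ 2 *: c.
  have Hj j : exists c, (h *m E) 0 j = x ^+ 2 * c.
    have Hi i : exists c, (h *m D) 0 i * B i j = x ^+ 2 * c.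
      by apply: m2_x2; [move: hD; rewrite -map_mxM => /map_mx_eq0|move/map_mx_eq0: B0].
    have [g gE] := choice Hi; exists (\sum_i g i).
    by rewrite DE mulmxA mxE mulr_sumr; apply: eq_bigr => i _.
  by have [g gE] := row_choice Hj; exists g; apply/rowP => j; rewrite gE !mxE.
have Af : A *m (h *m J)^T = x ^+ 2 *: (- (c *m J))^T.
  rewrite -[A in LHS]trmxK -trmx_mul -linearZ /=; congr (_^T).
  by rewrite scalerN scalemxAl -cE /E -!mulmxA J_mulJ !mulmxN mulmx1 opprK.
have f0 : ((h *m J)^T)^p = 0.
  apply: (full_image_app full) => a q w e.
  have /matrixP/(_ 0 0) := congr1 (mulmx w) Af.
  rewrite mulmxA -e -/(app _ _) appDl !appZl -scalemxAr mxE => e1.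
  set z := (_ *m _) 0 0 in e1.
  have e2 : x * (app a (h *m J)^T - x * z) = y * (- app q (h *m J)^T).
    by rewrite mulrBr mulrA -expr2 -e1 mulrN opprD addrA subrr add0r.
  have [] := xy_free e2.
  rewrite rmorphB rmorphM gen_m mul0r subr0 rmorphN => -> /eqP.
  by rewrite oppr_eq0 => /eqP.
case: h0; have : (h *m J)^p = 0 by rewrite -[LHS]trmxK map_trmx f0 trmx0.
move=> e; have -> : h = (h *m J) *m (- J) by rewrite mulmxN -mulmxA J_mulJ mulmxN mulmx1 opprK.
by rewrite map_mxM e mul0mx.
Qed.

Lemma minors2_det (A : 'M[R]_2) : (forall z, minors_ideal A 2 z -> z = 0) <-> \det A = 0.
Proof.
split=> [H|dA z].
  by apply: H; rewrite -[A in \det A]mul1mx -[_ *m A]mulmx1; apply: minors_ideal_mulmx.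
suff : minors_ideal A 2 `<=` [set 0] by apply.
by apply: (minors_ideal_sub (@ideal_zero R)) => C D; rewrite /= !det_mulmx dA mulr0 mul0r.
Qed.

(** The ranks are variables with equations so that they can be replaced by 2 in the types of the
    matrices. *)
Lemma rank2_minors0 b0 b1 b2 (A : 'M[R]_(b1, b0)) (B : 'M[R]_(b2, b1)) :
  b0 = 2 -> b1 = 2 -> b2 = 2 -> A^p = 0 -> B^p = 0 -> full_image A ->
  (forall v : 'rV_b1, v *m A = 0 -> exists w, v = w *m B) ->
  (forall z, minors_ideal A 2 z -> z = 0) -> forall z, minors_ideal B 2 z -> z = 0.
Proof.
move=> e0 e1 e2; move: A B; rewrite e0 e1 e2 => A B A0 B0 full kerA /minors2_det dA.
by apply/minors2_det; apply: rank2_det0 kerA dA.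
Qed.

Variables (b : nat -> nat) (A : forall n, 'M[R]_(b n.+1, b n)).
Hypothesis A_min : minimal_complex A.
Hypothesis b_gt0 : forall n, (0 < b n)%N.

Let A0 n : (A n)^p = 0. Proof. exact: complex_residue A_min n. Qed.

Lemma minors0_periodic n0 r :
  (forall n, (n0 <= n)%N -> forall z, minors_ideal (A n) r z -> z = 0) ->
  minors_periodic A r.
Proof.
move=> H; exists n0 => n nn; apply/seteqP; split=> z zA.
  rewrite (H n nn z zA); apply: ideal0; exact: minors_ideal_ideal.
by rewrite (H n.+2 _ z zA) ?(leqW (leqW nn))//; apply: ideal0; apply: minors_ideal_ideal.
Qed.

Lemma lt_rank_minors0 n r : (b n < r)%N -> forall z, minors_ideal (A n) r z -> z = 0.
Proof.
move=> br z; suff : minors_ideal (A n) r `<=` [set 0] by apply.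
by apply: (minors_ideal_sub (@ideal_zero R)) => C D; rewrite /= det_mulmx_lt.
Qed.

Theorem two_generators_periodic r : (0 < r)%N -> minors_periodic A r.
Proof.
move=> r0.
have [n0 n0P] := two_generators_stable A_min.
have full n : (n0 <= n)%N -> full_image (A n) by move=> /n0P[].
have [[n [nn nyv]]|yv] := pselect (exists n, (n0 <= n)%N /\ ~ y_value (A n)).
  have [c [mu [c0 cs cmu]]] := scalar_image_of_not_y_value (A0 n) (full n nn) (b_gt0 n) nyv.
  exact: (scalar_image_periodic c0 cs cmu A_min).
have {}yv n : (n0 <= n)%N -> y_value (A n).
  by move=> nn; apply: contrapT => ny; apply: yv; exists n.
have asc : (exists n1, (n0 <= n1)%N /\ forall n, (n1 <= n)%N -> minors_ideal (A n) r (y ^+ r)) ->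
    minors_periodic A r.
  move=> [n1 [n01 yr]]; apply: (ascending_minors_periodic (n0 := n1)) => n nn.
  have [_ _ le] := n0P n (leq_trans n01 nn).
  apply: (flag_minors_sub xy m_xy gen_xs1 (A0 n) le r0).
  by apply: yr; apply: leqW; apply: leqW.
case: r r0 asc => [//|[|[|r]]] _ asc.
- apply: asc; exists n0; split => // n /yv[w [f <-]].
  rewrite expr1 /app -det_mx11; apply: minors_ideal_rowspace => i.
  by exists w; rewrite ord1; apply/rowP => j; rewrite !mxE.
- have b_mono n : (n0 <= n)%N -> (b n <= b n.+1)%N by move=> /n0P[].
  have b_mono2 n m : (n0 <= n)%N -> (n <= m)%N -> (b n <= b m)%N.
    move=> nn /subnK <-; elim: (m - n)%N => // i IH; rewrite addSn.
    by apply: leq_trans IH _; apply: b_mono; apply: leq_trans nn (leq_addl _ _).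
  have nonzero n1 : (n0 <= n1)%N ->
      (forall n, (n1 <= n)%N -> ~ forall z, minors_ideal (A n) 2 z -> z = 0) ->
      minors_periodic A 2.
    move=> nn H; apply: asc; exists n1; split => // n /H nz.
    have hI := minors_ideal_ideal (A n) 2.
    have [z [Iz z0]] : exists z, minors_ideal (A n) 2 z /\ z <> 0.
      apply: contrapT => Hz; apply: nz => z Iz; apply: contrapT => z0.
      by apply: Hz; exists z.
    (* For [r = 2] the power [y ^+ 2] generates the socle, which lies in every nonzero ideal. *)
    rewrite expr2 yy; apply: (idealMl _ hI).
    exact: (socle_in_ideal hI Iz z0).
  have [[n1 [n01 b3]]|b_le2] := pselect (exists n1, (n0 <= n1)%N /\ (3 <= b n1)%N).
    apply: (nonzero n1 n01) => n nn z0.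
    have n0n := leq_trans n01 nn.
    apply: (rank3_minors2 (A0 n) (full n n0n) z0).
      by apply: leq_trans b3 (b_mono2 _ _ _ nn).
    exact: yv.
  have {}b_le2 n : (n0 <= n)%N -> (b n <= 2)%N.
    move=> nn; rewrite leqNgt; apply/negP => b3; apply: b_le2.
    by exists n.
  have [[n1 [n01 b2]]|b_le1] := pselect (exists n1, (n0 <= n1)%N /\ (2 <= b n1)%N); last first.
    apply: (@minors0_periodic n0) => n nn; apply: lt_rank_minors0.
    by rewrite ltnNge; apply/negP => b2; apply: b_le1; exists n.
  have b2E n : (n1 <= n)%N -> b n = 2.
    move=> nn; apply/eqP; rewrite eqn_leq b_le2 ?(leq_trans n01)//=.
    by apply: leq_trans b2 (b_mono2 _ _ _ nn).
  have [[n2 [n12 z0]]|nz] := pselect (exists n2, (n1 <= n2)%N /\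
      forall z, minors_ideal (A n2) 2 z -> z = 0); last first.
    by apply: (nonzero n1 n01) => n nn z0; apply: nz; exists n.
  (* In constant rank two a vanishing determinant propagates to all later differentials. *)
  apply: (@minors0_periodic n2) => n /subnK <-; elim: (n - n2)%N => // i IH.
  rewrite addSn; have le : (n1 <= i + n2)%N by apply: leq_trans n12 (leq_addl _ _).
  apply: (rank2_minors0 (b2E _ le) (b2E _ (leqW le)) (b2E _ (leqW (leqW le))) (A0 _) (A0 _)
    (full _ (leq_trans n01 le)) _ IH).
  by move=> v; apply: (complex_ker A_min).
- apply: asc; exists n0; split => // n _.
  rewrite !exprS mulrA yy mulrA -[_ * y]mulrA (mulrC (x ^+ s)).
  have -> : y * x ^+ s = 0 by rewrite mulrC (exp_mul_y xy gen_s_gt0).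
  by rewrite mulr0 mul0r; apply: ideal0; apply: minors_ideal_ideal.
Qed.

End TwoGeneratorsPeriodic.

End TwoGenerators.
End TwoLeExponent.

(** * The three cases for the annihilator of x *)

Section StretchedPeriodic.
Hypothesis s_le1 : (s <= 1)%N -> forall z, p z = 0 -> principal x z.
Variables (b : nat -> nat) (A : forall n, 'M[R]_(b n.+1, b n)).
Hypothesis A_min : minimal_complex A.
Hypothesis b_gt0 : forall n, (0 < b n)%N.

Lemma unit_mul_principal a c : p c <> 0 -> principal x (c * a) -> principal x a.
Proof.
move=> /p_unit[c' cE] [d dE]; exists (c' * d).
by rewrite -mulrA -dE mulrA (mulrC c') cE mul1r.
Qed.

Lemma ann_mul_m y c : x * y = 0 -> p c = 0 -> principal x (c * y).
Proof.
move=> xy /gen_split[d [t [-> xt]]].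
have [e eE] := gen_ann_mul xt xy.
exists (x ^+ s.-1 * e); rewrite mulrDl eE mulrAC xy mul0r add0r.
by rewrite mulrAC -exprSr prednK// gen_s_gt0.
Qed.

Theorem stretched_generator_periodic r : (0 < r)%N -> minors_periodic A r.
Proof.
move=> r0.
have [m_x|nm_x] := pselect (forall z, p z = 0 -> principal x z).
  exact: (principal_maximal_periodic A_min m_x r0).
have s2 : (2 <= s)%N by rewrite ltnNge; apply/negP => s1; apply: nm_x; apply: s_le1.
have [y xy yx] : exists2 y, x * y = 0 & ~ principal x y.
  apply: contrapT => H; apply: nm_x => z /gen_split[c [t [-> xt]]].
  apply: (idealD (principal_ideal x)); first by exists c; rewrite mulrC.
  by apply: contrapT => tx; apply: H; exists t.
have y_free c : principal x (c * y) -> p c = 0.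
  by move=> cy; apply: contrapT => c0; apply: yx; apply: unit_mul_principal cy.
have [ann|nann] := pselect (forall t, x * t = 0 -> exists a d, t = x * a + y * d).
  have m_xy z : p z = 0 -> exists c d, z = x * c + y * d.
    move=> /gen_split[c [t [-> /ann[a [d ->]]]]].
    by exists (c + a), d; rewrite mulrDr addrA.
  have [u uE] := gen_ann_mul xy xy.
  (* If [u] were not a unit, [y] would be annihilated by m, hence lie in the socle and in [x R]. *)
  have [|u' uu'] := @p_unit u.
    move=> u0; apply: yx; case: (x_gen) => _ _ _ _ [soc _ _].
    have [|c ->] := soc y; last by exists (c * x ^+ s.-1); rewrite -mulrA -exprSr prednK// gen_s_gt0.
    move=> a /m_xy[c [d ->]].
    have -> : (x * c + y * d) * y = c * (x * y) + d * (y * y) by ring.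
    by rewrite xy uE (gen_xs_m u0) !mulr0 addr0.
  have yy : y * y = u * x ^+ s by rewrite uE mulrC.
  have ann_y t : x * t = 0 -> exists d, t = y * d.
    move=> xt; have [a [d tE]] := ann t xt.
    (* As [x ^+ 2] kills [a], the term [x * a] is in the socle, which consists of multiples of
       [y * y]. *)
    have [|z [t' [aE xt']]] := @gen_ann_exp (s - 1) a (leq_subr _ _).
      have -> : (s.+1 - (s - 1) = 2)%N by lia.
      by move: xt; rewrite tE mulrDr !mulrA xy mul0r addr0 expr2.
    exists (d + u' * y * z); rewrite tE aE mulrDr xt' addr0 mulrA -exprS.
    have -> : (s - 1).+1 = s by lia.
    have -> : x ^+ s = u' * (y * y) by rewrite yy mulrA (mulrC u') uu' mul1r.
    by ring.
  exact: (two_generators_periodic s2 xy yy uu' m_xy ann_y y_free A_min b_gt0 r0).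
have [y2 xy2 y2N] : exists2 y2, x * y2 = 0 & ~ exists a d, y2 = x * a + y * d.
  by apply: contrapT => H; apply: nann => t xt; apply: contrapT => nt; apply: H; exists t.
apply: (large_embdim_periodic s2 A_min b_gt0 xy xy2 _ r0) => c1 c2 c12.
have c20 : p c2 = 0.
  apply: contrapT => /p_unit[c2' cE]; apply: y2N; case: c12 => d dE.
  exists (c2' * d), (- (c2' * c1)).
  have -> : y2 = c2 * c2' * y2 by rewrite cE mul1r.
  have -> : c2 * c2' * y2 = c2' * (c1 * y + c2 * y2) - c2' * c1 * y by ring.
  by rewrite dE; ring.
split => //; apply: y_free.
have -> : c1 * y = c1 * y + c2 * y2 - c2 * y2 by rewrite addrK.
by apply: (idealB (principal_ideal x)) => //; apply: ann_mul_m.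
Qed.

End StretchedPeriodic.

End StretchedGenerator.
End ResidueField.

Theorem corollaryB (R : comNzRingType) (m : set R) (k : fieldType)
    (p : {rmorphism R -> k})
    (R_noetherian : noetherian R) (R_local : local_ring m)
    (k_residue : residue_map m p)
    (R_cases : fiber_product_ring R \/
       [/\ artinian R, stretched m, gorenstein R & 2%N \notin [pchar k]])
    (r : nat) (r_gt0 : (0 < r)%N)
    (M : lmodType R) (M_fg : finitely_generated M)
    (M_projdim : ~ finite_projdim M)
    (F : minimal_free_resolution m M) :
  exists N : nat, forall n : nat, (N <= n)%N ->
    res_minors F n r = res_minors F n.+2 r.
Proof.
have [p_surj mE] := k_residue.
have p_unit a : p a <> 0 -> exists a', a * a' = 1.
  exact: residue_local_unit R_noetherian R_local k_residue.
have m_res z : m z -> p z = 0 by rewrite mE.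
have A_min : minimal_complex p (mfr_diff F).
  split=> [n|n v].
    by apply/map_mx_eq0 => i j; apply: m_res; apply: (@mfr_minimal _ _ _ F).
  have [_ _ /(_ n) ex] := mfr_resolution F.
  split=> [v0|[w ->]].
    have : kernel (mulmxr (mfr_diff F n) : {linear 'rV[R]_(mfr_rank F n.+1) -> 'rV[R]_(mfr_rank F n)}) v by [].
    by rewrite -ex => -[w _ <-]; exists w.
  have : range (mulmxr (mfr_diff F n.+1) : {linear 'rV[R]_(mfr_rank F n.+2) -> 'rV[R]_(mfr_rank F n.+1)}) (w *m mfr_diff F n.+1) by exists w.
  by rewrite ex.
(* The index shifts by one: [res_minors F n.+1] is formed from [mfr_diff F n]. *)
suff [N NP] : minors_periodic (mfr_diff F) r.
  by exists N.+1 => -[//|n] nN; apply: NP.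
have [[n0 bn0]|b0] := pselect (exists n0, mfr_rank F n0 = 0%N).
  exact: (rank0_minors_periodic A_min r_gt0 bn0).
have b_gt0 n : (0 < mfr_rank F n)%N.
  by rewrite lt0n; apply/eqP => bn; apply: b0; exists n.
case: R_cases => [fib|[_ str gor char2]].
  have [I [J [IJ I0 J0]]] := fiber_product_decomposition p_unit fib.
  exact: (decomposition_periodic p_surj p_unit R_noetherian A_min b_gt0 IJ I0 J0 r_gt0).
rewrite mE in str.
have two : p 2%:R <> 0.
  by move=> p2; move: char2; rewrite inE /= -(rmorph_nat p) p2 eqxx.
have [x [s [x_gen s_le1]]] := stretched_gorenstein_generator p_unit R_noetherian str gor two.
exact: (stretched_generator_periodic p_surj p_unit R_noetherian x_gen s_le1 A_min b_gt0 r_gt0).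
Qed.
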